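(* Let $(U_n)_{n\ge 0}$ be the negative but linearly reinforced urn scheme with $k$ colours, parameter $\theta\ge 1$, stochastic replacement matrix $R$ and initial configuration $U_0$, and let $N_n=(N_{n,0},\dots,N_{n,k-1})$ be the vector of colour counts. Suppose that $\hat R=\frac{1}{k\theta-1}(\theta J_k-R)$ is irreducible and let $\mu$ be the unique solution of $(\theta\mathbf 1-\mu)R=(k\theta-1)\mu$. Assume that one of the following holds, and define $\sigma_n$ accordingly: (i) $k\ge 3$, and $$\sigma_n=\begin{cases}\sqrt{n\log n}&\text{if } k=3,\ \theta=1 \text{ and one of the eigenvalues of } R \text{ is } -1,\\ \sqrt n&\text{otherwise;}\end{cases}$$ (ii) $k=2$, $\theta\in[1,\tfrac32]$, the eigenvalues of $R$ are $1$ and $\lambda$ with $\lambda\ge\frac{1-2\theta}{2}$, and $$\sigma_n=\begin{cases}\sqrt{n\log n}&\text{if } \lambda=\frac{1-2\theta}{2},\\ \sqrt n&\text{if } \lambda>\frac{1-2\theta}{2}.\end{cases}$$ Then there exists a $k\times k$ variance-covariance matrix $\tilde\Sigma\equiv\tilde\Sigma(\theta,k)$ such that $$\frac{N_n-\frac{n}{k\theta-1}(\theta\mathbf 1-\mu)}{\sigma_n}\Longrightarrow\mathcal N_k(0,\tilde\Sigma)\quad\text{as } n\to\infty .$$ Moreover, $\Sigma=R^T\tilde\Sigma R$, where $\Sigma$ is the variance-covariance matrix for which $\frac{U_n-n\mu}{\sigma_n}\Longrightarrow\mathcal N_k(0,\Sigma)$.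
   Context: Model. Let $k\ge 2$ be an integer, $S=\{0,1,\dots,k-1\}$ the set of colours, $\theta\ge 1$ a real parameter, $R=((R_{i,j}))_{0\le i,j\le k-1}$ a stochastic matrix (nonnegative entries, all row sums equal to $1$), and $U_0=(U_{0,j})_{0\le j\le k-1}$ a (deterministic) probability vector on $S$. The negative but linearly reinforced urn scheme with initial configuration $U_0$ and replacement matrix $R$ is the process $(U_n)_{n\ge0}$ of random row vectors in $[0,\infty)^k$ defined recursively as follows. With $\mathcal F_n=\sigma(U_0,\dots,U_n)$, the random colour $Z_n\in S$ (the colour chosen at draw $n+1$) satisfies $$\mathbb P(Z_n=j\mid\mathcal F_n)=\frac{1}{k\theta-1}\left(\theta-\frac{U_{n,j}}{n+1}\right),\quad 0\le j\le k-1,$$ and $U_{n+1}=U_n+\chi_{n+1}R$, where $\chi_{n+1}=(\mathbf 1(Z_n=j))_{0\le j\le k-1}$ is a row vector. (Then $\sum_j U_{n,j}=n+1$ for all $n$.) Colour counts: $N_n=(N_{n,0},\dots,N_{n,k-1})$ with $N_{n,j}=\sum_{m=0}^{n-1}\mathbf 1(Z_m=j)$. Notation. $\mathbf 1$ denotes the row vector of length $k$ with all entries $1$, $J_k$ the $k\times k$ matrix with all entries $1$. The matrix $\hat R=\frac{1}{k\theta-1}(\theta J_k-R)$ is stochastic, and irreducibility is meant in the Markov chain sense. $\Longrightarrow$ denotes convergence in distribution; $\mathcal N_k(0,\Sigma)$ is the $k$-variate normal law with mean $0$ and covariance $\Sigma$ (covariance matrices are symmetric positive semi-definite and may be singular).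 The model, in particular $R$, is fixed, and the covariance matrices may depend on $R$.
   Formalization: The law of Z_n is prescribed given U_0,…,U_n and the past colours Z_0,…,Z_{n-1}, not given U_0,…,U_n alone; if rows of R coincide the latter leaves the colours undetermined and the claim fails (k=3, θ=1, R=J/3, U_0 uniform, Z_n=Z_0). *)

(* Defs.v *)
From HB Require Import structures.
From mathcomp Require Import all_boot all_order all_algebra.
From mathcomp Require Import all_classical all_reals all_analysis.

Set Implicit Arguments.
Unset Strict Implicit.
Unset Printing Implicit Defensive.

Import Order.TTheory GRing.Theory Num.Theory.
Import numFieldNormedType.Exports.

Local Open Scope classical_set_scope.
Local Open Scope ring_scope.

Definition probability_row (R : realType) (k : nat) (u : 'rV[R]_k) : Prop :=
  (forall j, 0 <= u 0 j) /\ \sum_j u 0 j = 1.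

Definition stochastic_mx (R : realType) (k : nat) (A : 'M[R]_k) : Prop :=
  forall i, probability_row (row i A).

Definition irreducible_mx (R : realType) (k : nat) (A : 'M[R]_k) : Prop :=
  forall i j, exists n : nat, 0 < (A ^+ n) i j.

Definition hat_mx (R : realType) (k : nat) (theta : R) (A : 'M[R]_k) :
    'M[R]_k :=
  (k%:R * theta - 1)^-1 *: (theta *: const_mx 1 - A).

Definition covariance_mx (R : realType) (k : nat) (S : 'M[R]_k) : Prop :=
  S^T = S /\ forall t : 'rV[R]_k, 0 <= (t *m S *m t^T) 0 0.

(* [g] is a version of the conditional probability of [E] given the
   sigma-algebra [F]. *)
Definition is_cond_prob (R : realType) (d : measure_display)
    (T : measurableType d) (P : probability T R) (F : set (set T))
    (E : set T) (g : T -> R) : Prop :=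
  (forall B : set R, measurable B -> F (g @^-1` B)) /\
  (forall H : set T, F H -> P (E `&` H) = (\int[P]_(w in H) (g w)%:E)%E).

(* The sigma-algebra generated by U_0, ..., U_n and Z_0, ..., Z_(n-1).  When two
   rows of the replacement matrix coincide, the past colours cannot be read off
   the configurations, and a rule for the law of Z_n given U_0, ..., U_n alone
   would leave the joint law of the colours undetermined. *)
Definition urn_history (R : realType) (k : nat) (T : Type)
    (U : nat -> T -> 'rV[R]_k) (Z : nat -> T -> 'I_k) (n : nat) :
    set (set T) :=
  <<s [set H | exists m j (B : set R),
         [/\ (m <= n)%N, measurable B & H = [set w | B (U m w 0 j)]]] `|`
      [set H | exists m j, (m < n)%N /\ H = [set w | Z m w = j]] >>.

Record negative_urn (R : realType) (k : nat) (theta : R) (A : 'M[R]_k)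
    (u0 : 'rV[R]_k) (d : measure_display) (T : measurableType d)
    (P : probability T R) (U : nat -> T -> 'rV[R]_k) (Z : nat -> T -> 'I_k) :
    Prop := NegativeUrn {
  urn_measurable_config : forall n j, measurable_fun setT (fun w => U n w 0 j);
  urn_measurable_colour : forall n j, measurable [set w | Z n w = j];
  urn_init : forall w, U 0%N w = u0;
  urn_step : forall n w, U n.+1 w = U n w + delta_mx 0 (Z n w) *m A;
  urn_draw : forall n j,
    is_cond_prob P (urn_history U Z n) [set w | Z n w = j]
      (fun w => (k%:R * theta - 1)^-1 * (theta - U n w 0 j / n.+1%:R)) }.

Definition colour_count (R : realType) (k : nat) (T : Type)
    (Z : nat -> T -> 'I_k) (n : nat) (w : T) : 'rV[R]_k :=
  \row_j \sum_(m < n) (Z m w == j)%:R.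

Arguments colour_count R {k T} Z n w.

(* The real normal law with mean [m] and variance [v].  The library's
   [normal_prob m 0] is the uniform law on [0, 1], not the Dirac mass at [m]. *)
Definition normal_law (R : realType) (m v : R) (B : set R) : \bar R :=
  if v == 0 then \d_m B else normal_prob m (Num.sqrt v) B.

(* [G] has law N_k(0, S), where S may be singular: every linear functional
   <t, G> of the random vector [G] has the law N(0, t S t^T). *)
Definition gaussian_vector (R : realType) (k : nat) (S : 'M[R]_k)
    (d : measure_display) (T : measurableType d) (P : probability T R)
    (G : T -> 'rV[R]_k) : Prop :=
  [/\ covariance_mx S,
      forall j, measurable_fun setT (fun w => G w 0 j) &
      forall (t : 'rV[R]_k) (B : set R), measurable B ->
        P [set w | B ((G w *m t^T) 0 0)]
        = normal_law 0 ((t *m S *m t^T) 0 0) B].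

Definition cvg_in_distribution (R : realType) (k : nat)
    (d : measure_display) (T : measurableType d) (P : probability T R)
    (X : nat -> T -> 'rV[R]_k)
    (d' : measure_display) (T' : measurableType d') (P' : probability T' R)
    (Y : T' -> 'rV[R]_k) : Prop :=
  forall f : 'rV[R]_k -> R,
    continuous f -> (exists M : R, forall x, `|f x| <= M) ->
    (fun n : nat => ('E_P[f \o X n])%E) @ \oo --> ('E_P'[f \o Y])%E.

Definition cvg_to_normal (R : realType) (k : nat)
    (d : measure_display) (T : measurableType d) (P : probability T R)
    (X : nat -> T -> 'rV[R]_k) (S : 'M[R]_k) : Prop :=
  exists (d' : measure_display) (T' : measurableType d')
    (P' : probability T' R) (G : T' -> 'rV[R]_k),
    gaussian_vector S P' G /\ cvg_in_distribution P X P' G.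

Definition clt_scale (R : realType) (critical : bool) (n : nat) : R :=
  if critical then Num.sqrt (n%:R * ln n%:R) else Num.sqrt n%:R.

(* Main.v *)
Require Import Defs.
From HB Require Import structures.
From mathcomp Require Import all_boot all_order all_algebra.
From mathcomp Require Import all_classical all_reals all_analysis.
From mathcomp Require Import measurable_realfun ring lra.
Set Implicit Arguments.
Unset Strict Implicit.
Unset Printing Implicit Defensive.

Import Order.TTheory GRing.Theory Num.Theory.
Import numFieldNormedType.Exports.

Local Open Scope classical_set_scope.
Local Open Scope ring_scope.

(** Let [p = (theta 1 - mu) / (k theta - 1)] be the fixed point of the draw
    probabilities and [W_n = N_n - n p] the deviation of the counts.  Since
    [U_n = u0 + N_n A] and [p A = mu], the draw probabilities at time [n] are [p]
    plus a term linear in [W_n] of order [1 / n], so that [W] follows the noisy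
    linear recursion
    [W_(n+1) = W_n (1 + B / (n+1)) + martingale increment + drift / (n+1)]
    ([centred_step]), where [B] is any matrix that agrees with
    [- A / (k theta - 1)] on rows of sum zero.  Let [flow B m N] be the product
    of the factors [1 + B / j] for [m < j <= N].  For a fixed direction [t] and
    horizon [N], the number [W_m * flow B m N * t^T], corrected by the drift still
    to come, is a martingale in [m] with explicitly bounded increments.

    Its characteristic function is computed by replacing the increments one by one
    with Gaussian increments of the same variance ([cos_step], [compensated_cos]).
    The error is controlled by the size of the increments and by the distance of
    the draw probabilities to [p]; the latter tends to 0 by a second moment bound
    ([second_moment_bounded]).  The variance of the limit is the limit of the
    normalised cumulated variance ([variance_limit]).  When the flow grows at a
    rate [b < 1/2], the squares of the increments add up to order [N] and the limit
    is the solution of a Lyapunov equation; at the rate [1/2] they add up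
    harmonically, to order [N log N], and only the corresponding eigenspace
    contributes.

    The rates are found as follows.  If [k >= 3] then [k theta - 1 >= 2], so [B] has
    norm at most [1/2] because [A] is stochastic.  Equality forces [k = 3] and
    [theta = 1], and then the rate [1/2] is attained exactly when [- A] has the
    eigenvalue 1: that eigenvalue is semisimple since the powers of [A] are bounded
    ([eigenN1_split]), and off its eigenspace the average of 1 and [- A] is a
    contraction for an adapted norm ([subcritical_split]).  If [k = 2] the deviations
    live on a line, on which [A] acts by its second eigenvalue.

    Characteristic functions are turned into convergence in distribution by tightness
    and approximation of bounded continuous functions by trigonometric polynomials,
    built from Fejer kernels ([trig_approx], [cvg_in_distribution_of_cos]).  The
    Gaussian limit is the image of a standard Gaussian vector by a square root of the
    covariance ([gaussian_vector_exists]).  The statement on the configurations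
    follows from the one on the counts because [U_n - n mu = u0 + W_n A]
    ([linear_image_clt]). *)

(** * Taylor bounds with explicit remainders *)

Section TaylorBounds.
Variable R : realType.
Implicit Types x y u : R.

Lemma le_from_derive (f df : R -> R) x :
  (forall z : R, is_derive z 1 f (df z)) -> (forall z, 0 <= z -> 0 <= df z) ->
  0 <= x -> f 0 <= f x.
Proof.
move=> fdf df0; rewrite le_eqVlt => /predU1P[<-//|x0].
have cf : {within `[0, x], continuous f}.
  apply: continuous_subspaceT => z.
  by apply: differentiable_continuous; apply/derivable1_diffP; have [] := fdf z.
have [c /andP[c0 _] e] := MVT x0 (fun z _ => fdf z) cf.
by rewrite -subr_ge0 e subr0 mulr_ge0 ?(ltW x0)// df0// ltW// (itvP c0).
Qed.

Lemma sin_le_id x : 0 <= x -> sin x <= x.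
Proof.
move=> x0; rewrite -subr_ge0.
have := @le_from_derive (fun z => z - sin z) (fun z => 1 - cos z) x.
rewrite sin0 subrr; apply => // z _; by rewrite subr_ge0 cos_le1.
Qed.

Lemma cos_ge_quad x : 0 <= x -> 1 - x ^+ 2 / 2 <= cos x.
Proof.
move=> x0; rewrite -subr_ge0.
have := @le_from_derive (fun z => cos z - (1 - z ^+ 2 / 2)) (fun z => z - sin z) x.
rewrite cos0 expr0n /= mul0r subr0 subrr; apply => // [z|z z0]; last first.
  by rewrite subr_ge0 sin_le_id.
apply: is_derive_eq; rewrite !scaler0 /= ?add0r /GRing.scale /=; by field.
Qed.

Lemma sin_ge_cubic x : 0 <= x -> x - x ^+ 3 / 6 <= sin x.
Proof.
move=> x0; rewrite -subr_ge0.
have := @le_from_derive (fun z => sin z - (z - z ^+ 3 / 6))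
  (fun z => cos z - (1 - z ^+ 2 / 2)) x.
rewrite sin0 expr0n /= mul0r subr0 subrr; apply => // [z|z z0]; last first.
  by rewrite subr_ge0 cos_ge_quad.
apply: is_derive_eq; rewrite !scaler0 /= ?add0r /GRing.scale /=; by field.
Qed.

Lemma cos_le_quad x : 0 <= x -> cos x <= 1 - x ^+ 2 / 2 + x ^+ 3.
Proof.
move=> x0; rewrite -subr_ge0.
have := @le_from_derive (fun z => 1 - z ^+ 2 / 2 + z ^+ 4 / 24 - cos z)
  (fun z => sin z - (z - z ^+ 3 / 6)) x.
rewrite cos0 !expr0n /= !mul0r subr0 addr0 subrr.
(* beyond 4 the cubic term alone exceeds the quadratic one *)
have [x4|x4] := leP x 4.
  move=> /(_ _ _ x0) H; have {H} : 0 <= 1 - x ^+ 2 / 2 + x ^+ 4 / 24 - cos x.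
    apply: H => [z|z z0]; last by rewrite subr_ge0 sin_ge_cubic.
    apply: is_derive_eq; rewrite !scaler0 /= ?add0r /GRing.scale /=; by field.
  move=> H; rewrite (le_trans H)// lerD2r lerD2l.
  rewrite (_ : x ^+ 4 / 24 = x ^+ 3 * (x / 24)); last by field.
  by rewrite ler_piMr ?exprn_ge0//; lra.
move=> _; rewrite subr_ge0 (le_trans (cos_le1 _))//.
rewrite -addrA lerDl (_ : _ + _ = x ^+ 2 * (x - 1 / 2)); last by field.
by rewrite mulr_ge0 ?sqr_ge0//; lra.
Qed.

Lemma cos_taylor y : `|cos y - (1 - y ^+ 2 / 2)| <= `|y| ^+ 3.
Proof.
wlog y0 : y / 0 <= y.
  move=> H; have [|/ltW y0] := leP 0 y; first exact: H.
  by have := H (- y); rewrite cosN sqrrN normrN; apply; rewrite oppr_ge0.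
rewrite (ger0_norm y0) ler_norml; apply/andP; split.
  by rewrite (@le_trans _ _ 0) ?oppr_le0 ?exprn_ge0// subr_ge0 cos_ge_quad.
by rewrite lerBlDl cos_le_quad.
Qed.

Lemma sin_taylor y : `|sin y - y| <= `|y| ^+ 3.
Proof.
wlog y0 : y / 0 <= y.
  move=> H; have [|/ltW y0] := leP 0 y; first exact: H.
  have := H (- y); rewrite sinN -opprD !normrN.
  by apply; rewrite oppr_ge0.
rewrite (ger0_norm y0) ler_norml; apply/andP; split; last first.
  by rewrite (@le_trans _ _ 0) ?exprn_ge0// subr_le0 sin_le_id.
rewrite lerBrDl (le_trans _ (sin_ge_cubic y0))// lerD2l lerN2 ler_pdivrMr//.
by rewrite ler_peMr ?exprn_ge0//; lra.
Qed.

Lemma cosD_taylor x y :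
  `|cos (x + y) - (cos x - sin x * y - cos x * (y ^+ 2 / 2))| <= 2 * `|y| ^+ 3.
Proof.
rewrite cosD (_ : _ - _ = cos x * (cos y - (1 - y ^+ 2 / 2)) -
   sin x * (sin y - y)); last by ring.
rewrite (le_trans (ler_normB _ _))// !normrM mulr2n mulrDl mul1r lerD//.
  by rewrite -[leRHS]mul1r ler_pM ?cos_taylor// ler_norml cos_geN1 cos_le1.
by rewrite -[leRHS]mul1r ler_pM ?sin_taylor// ler_norml sin_geN1 sin_le1.
Qed.

Lemma expRN_taylor u : 0 <= u -> `|expR (- u) - (1 - u)| <= u ^+ 2.
Proof.
move=> u0; rewrite ler_norml; apply/andP; split.
  rewrite (@le_trans _ _ 0) ?oppr_le0 ?sqr_ge0// subr_ge0.
  exact: expR_ge1Dx.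
rewrite lerBlDl expRN.
have le1 : (1 + u)^-1 <= 1 - u + u ^+ 2.
  rewrite -[leLHS]mul1r ler_pdivrMr; last lra.
  rewrite (_ : _ * _ = 1 + u ^+ 3); last ring.
  by rewrite lerDl exprn_ge0.
by rewrite (le_trans _ le1)// lef_pV2 ?posrE ?expR_gt0 ?expR_ge1Dx//; lra.
Qed.

(** On three quarters of a period the quadratic decay of [cos] away from 0
    survives, with a worse constant. *)
Lemma cos_gap y : `|y| <= 3 / 2 * pi -> y ^+ 2 / 162 <= 1 - cos y.
Proof.
wlog y0 : y / 0 <= y.
  move=> H; have [|/ltW y0] := leP 0 y; first exact: H.
  by have := H (- y); rewrite cosN sqrrN normrN; apply; rewrite oppr_ge0.
rewrite (ger0_norm y0) => yle.
(* with y = 2 z, 1 - cos y = 2 sin^2 z, and sin z >= z / 9 up to 3 pi / 4 *)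
have [z e] : exists z, y = z *+ 2 by exists (y / 2); lra.
have zs : z / 9 <= sin z.
  have step (w : R) : 0 <= w -> w <= 2 -> w / 3 <= sin w.
    move=> w0 w2; rewrite (le_trans _ (sin_ge_cubic w0))//.
    rewrite (_ : w - _ = w / 3 + w * (4 - w ^+ 2) / 6); last by field.
    by rewrite lerDl divr_ge0// mulr_ge0//; nra.
  have z0 : 0 <= z by lra.
  have [z2|z2] := leP z 2; first by have := step _ z0 z2; lra.
  have zpi : z <= 3 / 4 * pi by lra.
  have := @step (pi - z); rewrite sinB sinpi cospi mul0r sub0r mulN1r opprK.
  have pi4 : pi <= 4 :> R by by have := @pihalf_lt2 R; lra.
  by move=> /(_ ltac:(lra) ltac:(lra)); lra.
have z0 : 0 <= z by lra.
rewrite {2}e mulr2n cosD -!expr2 cos2sin2.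
have -> : 1 - (1 - sin z ^+ 2 - sin z ^+ 2) = 2 * sin z ^+ 2 by ring.
have -> : y = z * 2 by lra.
by nra.
Qed.
End TaylorBounds.

(** * Limits of sums and signs of limits *)

Lemma cvg_sumr (R : realType) (I T : Type) (F : set_system T) (s : seq I)
    (f : I -> T -> R) (a : I -> R) : Filter F ->
  (forall i, f i x @[x --> F] --> a i) ->
  \sum_(i <- s) f i x @[x --> F] --> \sum_(i <- s) a i.
Proof. by move=> FF fa; apply: cvg_big => //; exact: add_continuous. Qed.

Lemma cvg_ge0 (R : realType) (u : nat -> R) (l : R) :
  u n @[n --> \oo] --> l -> (\forall n \near \oo, 0 <= u n) -> 0 <= l.
Proof.
move=> ul u0; rewrite -(cvg_lim _ ul)//; apply: limr_ge => //.
by apply/cvg_ex; exists l.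
Qed.

(** * Fejer kernels *)

Section Fejer.
Variable R : realType.
Implicit Types y z : R.

(** The squared modulus of the mean of the first [m] characters. *)
Definition fejer (m : nat) y : R :=
  ((\sum_(l < m) cos (l%:R * y)) ^+ 2 + (\sum_(l < m) sin (l%:R * y)) ^+ 2)
  / m%:R ^+ 2.

Lemma fejer_ge0 m y : 0 <= fejer m y.
Proof. by rewrite divr_ge0 ?addr_ge0 ?sqr_ge0. Qed.

(** Multiplying the sum of characters by [1 - exp (i y)] telescopes; [hC] and
    [hS] are the real and imaginary parts of this identity. *)
Lemma fejer_gap m y : (0 < m)%N ->
  fejer m y * (1 - cos y) = (1 - cos (m%:R * y)) / m%:R ^+ 2.
Proof.
move=> m0; rewrite /fejer mulrAC; congr (_ / _).
set C := \sum_(l < m) cos _; set S := \sum_(l < m) sin _.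
have hC : C - (C * cos y - S * sin y) = 1 - cos (m%:R * y).
  rewrite /C /S !mulr_suml -!sumrB.
  rewrite -(big_mkord xpredT (fun l => cos (l%:R * y) -
     (cos (l%:R * y) * cos y - sin (l%:R * y) * sin y))).
  rewrite (eq_bigr (fun l => - (cos (l.+1%:R * y) - cos (l%:R * y)))); last first.
    move=> l _; rewrite -[l.+1%:R]natr1 mulrDl mul1r cosD; ring.
  rewrite sumrN (telescope_sumr (fun l => cos (l%:R * y)))//.
  by rewrite mul0r cos0 opprB.
have hS : S - (S * cos y + C * sin y) = - sin (m%:R * y).
  rewrite /C /S !mulr_suml -!big_split -!sumrB /=.
  rewrite -(big_mkord xpredT (fun l => sin (l%:R * y) -
     (sin (l%:R * y) * cos y + cos (l%:R * y) * sin y))).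
  rewrite (eq_bigr (fun l => - (sin (l.+1%:R * y) - sin (l%:R * y)))); last first.
    move=> l _; rewrite -[l.+1%:R]natr1 mulrDl mul1r sinD; ring.
  rewrite sumrN (telescope_sumr (fun l => sin (l%:R * y)))//.
  by rewrite mul0r sin0 subr0.
have : (1 - cos (m%:R * y)) ^+ 2 + (- sin (m%:R * y)) ^+ 2 =
   2 * (1 - cos (m%:R * y)) by rewrite sqrrN sin2cos2; ring.
have -> : (1 - cos (m%:R * y)) ^+ 2 + (- sin (m%:R * y)) ^+ 2 =
    (C ^+ 2 + S ^+ 2) * ((1 - cos y) ^+ 2 + sin y ^+ 2).
  by rewrite -hC -hS; ring.
rewrite sin2cos2 (_ : (1 - cos y) ^+ 2 + _ = 2 * (1 - cos y)); last by ring.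
by rewrite mulrCA => /mulfI -> //; rewrite pnatr_eq0.
Qed.

Lemma sinB2pi_nat (e : nat) z : sin (z - 2 * pi * e%:R) = sin z.
Proof.
have h (f : nat) (x : R) : sin (x + 2 * pi * f%:R) = sin x.
  elim: f => [|f IH]; first by rewrite mulr0 addr0.
  rewrite -[f.+1%:R]natr1 mulrDr mulr1 addrA sinD.
  have -> : cos (2 * pi) = 1 :> R by rewrite mulr_natl cos2pi.
  have -> : sin (2 * pi) = 0 :> R by rewrite mulr_natl sin2pi.
  by rewrite mulr0 addr0 mulr1.
by rewrite -[in RHS](subrK (2 * pi * e%:R) z) h.
Qed.

(** The angles are equidistributed on the circle; after multiplication by the
    sine of half their step the sum telescopes around the circle. *)
Lemma sum_cos_roots m e z : (0 < e < m)%N ->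
  \sum_(j < m) cos (z - j%:R * (2 * pi * e%:R / m%:R)) = 0.
Proof.
move=> /andP[e0 em]; have m0 : (0 : R) < m%:R by rewrite ltr0n (leq_trans _ em).
set phi := _ / _.
have phi2 : sin (phi / 2) != 0.
  rewrite gt_eqF// sin_gt0_pi//.
  rewrite (_ : phi / 2 = pi * (e%:R / m%:R)); last by rewrite /phi; field; rewrite gt_eqF.
  rewrite mulr_gt0 ?pi_gt0 ?divr_gt0 ?ltr0n ?(leq_trans _ em)//=.
  by rewrite gtr_pMr ?pi_gt0// ltr_pdivrMr// mul1r ltr_nat.
apply: (mulIf phi2); rewrite mul0r mulr_suml.
rewrite -(big_mkord xpredT (fun j => cos (z - j%:R * phi) * sin (phi / 2))).
rewrite (eq_bigr (fun j => - ((sin (z - j.+1%:R * phi + phi / 2) / 2)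
    - (sin (z - j%:R * phi + phi / 2) / 2)))).
  rewrite sumrN (telescope_sumr (fun j => sin (z - j%:R * phi + phi / 2) / 2))//.
  rewrite mul0r subr0 (_ : z - m%:R * phi + phi / 2 = z + phi / 2 - 2 * pi * e%:R).
    by rewrite sinB2pi_nat subrr oppr0.
  by rewrite /phi; field; rewrite gt_eqF.
move=> j _; rewrite -[j.+1%:R]natr1.
rewrite (_ : z - (j%:R + 1) * phi + phi / 2 = z - j%:R * phi - phi / 2); last by field.
by set a := z - _; rewrite sinB sinD; field.
Qed.

Lemma fejer_expand m y :
  fejer m y = (\sum_(l < m) \sum_(l' < m) cos ((l%:R - l'%:R) * y)) / m%:R ^+ 2.
Proof.
rewrite /fejer; congr (_ / _); rewrite !expr2 !mulr_suml -big_split /=.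
apply: eq_bigr => l _; rewrite !mulr_sumr -big_split /=.
by apply: eq_bigr => l' _; rewrite mulrBl cosB.
Qed.

Definition node (m j : nat) : R := 2 * pi * j%:R / m%:R - pi.

(** Only the diagonal terms of [fejer_expand] survive the sum over the nodes. *)
Lemma fejer_partition m y : (0 < m)%N -> \sum_(j < m) fejer m (y - node m j) = 1.
Proof.
move=> m0; have mR : m%:R != 0 :> R by rewrite pnatr_eq0 -lt0n.
under eq_bigr do rewrite fejer_expand.
rewrite -mulr_suml exchange_big /=.
rewrite (eq_bigr (fun=> m%:R)); first by rewrite sumr_const card_ord -[_ *+ m]mulr_natr -expr2 divff ?expf_neq0.
move=> l _; rewrite exchange_big (bigD1 l)//= [X in _ + X]big1 ?addr0.
  rewrite (eq_bigr (fun=> 1)) ?sumr_const ?card_ord//.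
  by move=> j _; rewrite subrr mul0r cos0.
move=> l' ll'.
have main (a b : nat) : (a < b)%N -> (b < m)%N ->
    \sum_(j < m) cos ((b%:R - a%:R) * (y - node m j)) = 0.
  move=> ab bm; rewrite -[RHS](@sum_cos_roots m (b - a) ((b%:R - a%:R) * (y + pi))).
    by apply: eq_bigr => j _; congr cos; rewrite natrB 1?ltnW// /node; field.
  by rewrite subn_gt0 ab/= (leq_ltn_trans (leq_subr _ _)).
have := ll'; rewrite -(inj_eq val_inj) neq_ltn => /orP[h|h]; first exact: main.
rewrite -[RHS](main _ _ h (ltn_ord l')); apply: eq_bigr => j _.
by rewrite -cosN -mulNr opprB.
Qed.

Lemma node_bound m j : (j < m)%N -> `|node m j| <= pi.
Proof.
move=> jm; have m0 : (0 : R) < m%:R by rewrite ltr0n (leq_trans _ jm).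
have p0 := pi_gt0 R.
rewrite /node ler_norml; apply/andP; split.
  by rewrite lerBrDr addrC subrr divr_ge0 ?mulr_ge0 ?(ltW p0).
rewrite lerBlDr ler_pdivrMr// -mulr2n -(mulr_natl pi 2) ler_pM2l ?mulr_gt0//.
by rewrite ler_nat ltnW.
Qed.

(** Under the weights of [fejer_partition] the node is close to [y] modulo the
    period. *)
Lemma fejer_gap_sum m y : (0 < m)%N ->
  \sum_(j < m) fejer m (y - node m j) * (1 - cos (y - node m j)) <= 2 / m%:R.
Proof.
move=> m0; have mR : 0 < m%:R :> R by rewrite ltr0n.
under eq_bigr do rewrite fejer_gap//.
apply: (@le_trans _ _ (\sum_(j < m) (2 / m%:R ^+ 2))).
  apply: ler_sum => j _; rewrite ler_pM2r ?invr_gt0 ?exprn_gt0//.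
  by have := cos_geN1 (m%:R * (y - node m j)); lra.
rewrite sumr_const card_ord -mulr_natr le_eqVlt; apply/orP; left; apply/eqP.
by field; rewrite gt_eqF.
Qed.
End Fejer.

(** * Approximation by trigonometric polynomials *)

Section TrigPoly.
Variables (R : realType) (k : nat).
Local Notation V := 'rV[R]_k.

Definition rdot (t x : V) : R := (x *m t^T) 0 0.

Lemma rdotE t x : rdot t x = \sum_i x 0 i * t 0 i.
Proof. by rewrite /rdot mxE; apply: eq_bigr => i _; rewrite !mxE. Qed.

Lemma rdotC t x : rdot t x = rdot x t.
Proof. by rewrite !rdotE; apply: eq_bigr => i _; rewrite mulrC. Qed.

Lemma rdotDl s t x : rdot (s + t) x = rdot s x + rdot t x.
Proof. by rewrite /rdot linearD mulmxDr mxE. Qed.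

Lemma rdotNl t x : rdot (- t) x = - rdot t x.
Proof. by rewrite /rdot linearN mulmxN mxE. Qed.

Lemma rdotZl c t x : rdot (c *: t) x = c * rdot t x.
Proof. by rewrite /rdot linearZ -scalemxAr mxE. Qed.

Lemma rdot0l x : rdot 0 x = 0.
Proof. by rewrite /rdot trmx0 mulmx0 mxE. Qed.

Lemma rdot_delta i x : rdot (delta_mx 0 i) x = x 0 i.
Proof.
rewrite rdotE (bigD1 i)//= big1 ?addr0 ?mxE ?eqxx ?mulr1// => j ji.
by rewrite mxE (negbTE ji) andbF mulr0.
Qed.

(** Real phases [a] make the class closed under products without sines. *)
Inductive trig_poly : (V -> R) -> Prop :=
| trig_cos t a : trig_poly (fun x => cos (rdot t x + a))
| trig_add f g : trig_poly f -> trig_poly g -> trig_poly (fun x => f x + g x)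
| trig_scale c f : trig_poly f -> trig_poly (fun x => c * f x).

Lemma trig_cst c : trig_poly (fun=> c).
Proof.
have -> : (fun=> c) = (fun x : V => c * cos (rdot 0 x + 0)).
  by apply/funext => x; rewrite rdot0l addr0 cos0 mulr1.
by apply: trig_scale; apply: trig_cos.
Qed.

Lemma trig_sum (I : Type) (s : seq I) (f : I -> V -> R) :
  (forall i, trig_poly (f i)) -> trig_poly (fun x => \sum_(i <- s) f i x).
Proof.
move=> H; elim: s => [|i s IH].
  rewrite (_ : (fun x => _) = fun=> 0); first exact: trig_cst.
  by apply/funext => x; rewrite big_nil.
rewrite (_ : (fun x => _) = fun x => f i x + \sum_(j <- s) f j x).
  exact: trig_add.
by apply/funext => x; rewrite big_cons.
Qed.

Lemma trig_mul f g : trig_poly f -> trig_poly g -> trig_poly (fun x => f x * g x).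
Proof.
elim=> {f} [t a|f1 f2 _ IH1 _ IH2|c f _ IH] hg; last first.
- rewrite (_ : (fun x => _) = fun x => c * (f x * g x)).
    by apply: trig_scale; apply: IH.
  by apply/funext => x; rewrite mulrA.
- rewrite (_ : (fun x => _) = fun x => f1 x * g x + f2 x * g x).
    by apply: trig_add; [apply: IH1|apply: IH2].
  by apply/funext => x; rewrite mulrDl.
elim: hg => {g} [s b|g1 g2 _ IH1 _ IH2|c g _ IH]; last first.
- rewrite (_ : (fun x => _) = fun x => c * (cos (rdot t x + a) * g x)).
    by apply: trig_scale; apply: IH.
  by apply/funext => x; rewrite mulrCA.
- rewrite (_ : (fun x => _) = fun x => cos (rdot t x + a) * g1 x + cos (rdot t x + a) * g2 x).
    by apply: trig_add; [apply: IH1|apply: IH2].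
  by apply/funext => x; rewrite mulrDr.
rewrite (_ : (fun x => _) = fun x => 2^-1 * (cos (rdot (t + s) x + (a + b)) +
    cos (rdot (t - s) x + (a - b)))).
  by apply: trig_scale; apply: trig_add; apply: trig_cos.
apply/funext => x; rewrite !rdotDl rdotNl.
rewrite [rdot t x + rdot s x + _]addrACA.
have -> : rdot t x - rdot s x + (a - b) = (rdot t x + a) - (rdot s x + b) by ring.
set A := _ + a; set B := _ + b.
by rewrite (cosD A B) (cosB A B); field.
Qed.

Lemma trig_prod (I : Type) (s : seq I) (f : I -> V -> R) :
  (forall i, trig_poly (f i)) -> trig_poly (fun x => \prod_(i <- s) f i x).
Proof.
move=> H; elim: s => [|i s IH].
  rewrite (_ : (fun x => _) = fun=> 1); first exact: trig_cst.
  by apply/funext => x; rewrite big_nil.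
rewrite (_ : (fun x => _) = fun x => f i x * \prod_(j <- s) f j x).
  exact: trig_mul.
by apply/funext => x; rewrite big_cons.
Qed.

Lemma trig_fejer m i c b : trig_poly (fun x => fejer m (c * x 0 i - b)).
Proof.
have -> : (fun x : V => fejer m (c * x 0 i - b)) = fun x => m%:R ^- 2 *
    (\sum_(l < m) \sum_(l' < m)
       cos (rdot (((l%:R - l'%:R) * c) *: delta_mx 0 i) x - (l%:R - l'%:R) * b)).
  apply/funext => x; rewrite fejer_expand mulrC; congr (_ * _).
  apply: eq_bigr => l _; apply: eq_bigr => l' _; congr cos.
  by rewrite rdotZl rdot_delta; ring.
apply: trig_scale; apply: trig_sum => l; apply: trig_sum => l'.
exact: trig_cos.
Qed.

Definition fejer_weight (c : R) m (g : {ffun 'I_k -> 'I_m}) (x : V) : R :=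
  \prod_i fejer m (c * x 0 i - node R m (g i)).

Lemma fejer_weight_ge0 c m g x : 0 <= @fejer_weight c m g x.
Proof. by apply: prodr_ge0 => i _; exact: fejer_ge0. Qed.

Lemma fejer_weight_sum c m x : (0 < m)%N -> \sum_g @fejer_weight c m g x = 1.
Proof.
move=> m0; rewrite /fejer_weight.
rewrite -(bigA_distr_bigA (fun i (j : 'I_m) => fejer m (c * x 0 i - node R m j))).
by rewrite big1// => i _; rewrite fejer_partition.
Qed.

Lemma fejer_weight_gap c m x i : (0 < m)%N ->
  \sum_g @fejer_weight c m g x * (1 - cos (c * x 0 i - node R m (g i)))
  <= 2 / m%:R.
Proof.
move=> m0; rewrite (le_trans _ (fejer_gap_sum (c * x 0 i) m0))//.
pose F i' (j : 'I_m) := fejer m (c * x 0 i' - node R m j) *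
  (if i' == i then 1 - cos (c * x 0 i - node R m j) else 1).
rewrite (eq_bigr (fun g : {ffun 'I_k -> 'I_m} => \prod_i' F i' (g i'))).
  rewrite -(bigA_distr_bigA F) (bigD1 i)//= [X in _ * X]big1 ?mulr1.
    by apply: ler_sum => j _; rewrite /F eqxx.
  move=> i' /negbTE ii'; rewrite -[RHS](@fejer_partition R m (c * x 0 i') m0).
  by apply: eq_bigr => j _; rewrite /F ii' mulr1.
move=> g _; rewrite /F big_split/=; congr (_ * _).
by rewrite (bigD1 i)//= eqxx big1 ?mulr1// => i' /negbTE ->.
Qed.

(** Only the first point has to lie in the box, which is why Heine's theorem on
    the box itself would be too weak. *)
Lemma unif_continuous_box (f : V -> R) (L e : R) : continuous f -> 0 < e ->
  exists2 d : R, 0 < d & forall x y : V, (forall i, `|x 0 i| <= L) ->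
    (forall i, `|x 0 i - y 0 i| < d) -> `|f x - f y| < e.
Proof.
move=> cf e0.
have cA : compact [set x : V | forall i, `[- L, L]%classic (x 0 i)].
  by apply: (@rV_compact R k (fun=> `[- L, L]%classic)) => i; exact: segment_compact.
have := (compact_near_coveringP _).1 cA R (0 : R)^'+
  (fun d x => forall y : V, (forall i, `|x 0 i - y 0 i| < d) -> `|f x - f y| < e) _.
have e20 : 0 < e / 2 by lra.
case=> [x _|d d0 dP].
  have /cvgrPdist_lt /(_ _ e20) := cf x.
  rewrite -nbhs_ballE => -[r r0 fr].
  have r20 : 0 < r / 2 by rewrite /= in r0; lra.
  exists (ball x (r / 2), [set d | d <= r / 2]).
    split=> /=; first exact: nbhsx_ballx.
    exact: nbhs_right_le.
  move=> [x' d] /= [xx' dr] y x'y.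
  have h1 : `|f x - f x'| < e / 2 by apply: fr; apply: le_ball xx'; lra.
  have h2 : `|f x - f y| < e / 2.
    apply: fr; split=> // i j; rewrite (ord1 i).
    have := ball_triangle (xx'.2 0 j) (_ : ball (x' 0 j) (r / 2) (y 0 j)).
    by rewrite -splitr; apply; apply: lt_le_trans (x'y j) _.
  rewrite (_ : _ - _ = (f x - f y) - (f x - f x')); last by ring.
  by rewrite (le_lt_trans (ler_normB _ _))//; lra.
exists (d / 2); first by rewrite divr_gt0.
move=> x y xL xy; apply: (dP (d / 2)) => //=.
  rewrite /ball/= sub0r normrN gtr0_norm; rewrite /= in d0; lra.
  by rewrite divr_gt0.
by move=> i; rewrite /= in_itv/= -ler_norml.
Qed.

(** Averaging [f] over a fine grid with tensorized Fejer weights gives a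
    trigonometric polynomial that keeps the bounds of [f] and is close to [f]
    on a given box; the period is chosen four times the half-width of the box,
    so that points of the box stay away from the far copies of the grid. *)
Lemma trig_approx (f : V -> R) (M L e : R) : continuous f ->
  (forall x : V, `|f x| <= M) -> 0 < L -> 0 < e ->
  exists T : V -> R, [/\ trig_poly T, forall x : V, `|T x| <= M &
    forall x : V, (forall i, `|x 0 i| <= L) -> `|f x - T x| <= e].
Proof.
move=> cf fM L0 e0.
have pi0 := pi_gt0 R.
have M0 : 0 <= M by rewrite (le_trans _ (fM 0)).
pose c : R := pi / (2 * L).
have c0 : 0 < c by rewrite divr_gt0// mulr_gt0.
have e20 : 0 < e / 2 by lra.
have [d d0 df] := unif_continuous_box L cf e20.
pose D := 2 * M * (162 / (c * d) ^+ 2).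
have D0 : 0 <= D by rewrite !mulr_ge0// ?invr_ge0 ?sqr_ge0.
pose m := (Num.trunc (D * k%:R * 4 / e)).+1.
have m0 : (0 < m)%N by [].
have mR : 0 < m%:R :> R by rewrite ltr0n.
have mD : D * k%:R * (2 / m%:R) <= e / 2.
  have : D * k%:R * 4 / e < m%:R by rewrite /m truncnS_gt.
  rewrite ltr_pdivrMr// => h.
  rewrite mulrA ler_pdivrMr//; lra.
pose pt (g : {ffun 'I_k -> 'I_m}) : V := \row_i (c^-1 * node R m (g i)).
exists (fun x => \sum_g f (pt g) * @fejer_weight c m g x); split.
- apply: trig_sum => g; apply: trig_scale.
  by rewrite /fejer_weight; apply: trig_prod => i; exact: trig_fejer.
- move=> x; rewrite (le_trans (ler_norm_sum _ _ _))//.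
  apply: (@le_trans _ _ (\sum_g M * @fejer_weight c m g x)).
    apply: ler_sum => g _; rewrite normrM (ger0_norm (fejer_weight_ge0 _ _ _)).
    by rewrite ler_wpM2r ?fejer_weight_ge0.
  by rewrite -mulr_sumr fejer_weight_sum// mulr1.
move=> x xL.
have -> : f x - \sum_g f (pt g) * @fejer_weight c m g x =
    \sum_g (f x - f (pt g)) * @fejer_weight c m g x.
  under [RHS]eq_bigr do rewrite mulrBl.
  by rewrite sumrB -mulr_sumr fejer_weight_sum// mulr1.
rewrite (le_trans (ler_norm_sum _ _ _))//.
apply: (@le_trans _ _ (\sum_g ((e / 2) * @fejer_weight c m g x + D * \sum_i
    (@fejer_weight c m g x * (1 - cos (c * x 0 i - node R m (g i))))))).
  apply: ler_sum => g _; rewrite normrM (ger0_norm (fejer_weight_ge0 _ _ _)).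
  rewrite -mulr_sumr mulrCA [e / 2 * _]mulrC -mulrDr [leLHS]mulrC.
  rewrite ler_wpM2l ?fejer_weight_ge0//.
  have gap_ge0 i : 0 <= 1 - cos (c * x 0 i - node R m (g i)).
    by rewrite subr_ge0 cos_le1.
  (* near nodes are handled by continuity, far nodes have a large gap *)
  have [near|/existsNP[i /negP]] := pselect (forall i, `|x 0 i - pt g 0 i| < d).
    rewrite (le_trans (ltW (df _ _ xL near)))// lerDl mulr_ge0// sumr_ge0//.
  rewrite -leNgt => far.
  apply: (@le_trans _ _ (2 * M)).
    by rewrite (le_trans (ler_normB _ _))// mulr2n mulrDl mul1r lerD.
  apply: (@le_trans _ _ (D * ((c * d) ^+ 2 / 162))).
    rewrite /D -[leLHS]mulr1 -[leRHS]mulrA ler_wpM2l ?mulr_ge0 //.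
    rewrite mulrA divfK ?divff// expf_eq0 /= gt_eqF//; exact: mulr_gt0.
  apply: ler_wpDl; first by lra.
  rewrite ler_wpM2l//.
  apply: (@le_trans _ _ (1 - cos (c * x 0 i - node R m (g i)))); last first.
    by rewrite (bigD1 i)//= lerDl sumr_ge0.
  set y := c * x 0 i - _.
  have yE : y = c * (x 0 i - pt g 0 i).
    by rewrite /y mxE mulrBr mulrA divff ?mul1r// gt_eqF.
  have ybd : `|y| <= 3 / 2 * pi.
    rewrite (le_trans (ler_normB _ _))//.
    have h1 : `|c * x 0 i| <= pi / 2.
      rewrite normrM (gtr0_norm c0) (le_trans (ler_wpM2l (ltW c0) (xL i)))//.
      by rewrite /c le_eqVlt; apply/orP; left; apply/eqP; field; rewrite gt_eqF.
    have h2 : `|node R m (g i)| <= pi by exact: node_bound.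
    lra.
  rewrite (le_trans _ (cos_gap ybd))// ler_pM2r ?invr_gt0//.
  rewrite yE -[leRHS]real_normK ?num_real// normrM (gtr0_norm c0).
  have cd0 : 0 <= c by exact: ltW.
  have dd0 : 0 <= d by exact: ltW.
  by rewrite ler_pXn2r ?nnegrE ?(mulr_ge0 cd0)// ler_pM2l.
rewrite big_split/= -mulr_sumr fejer_weight_sum// mulr1 -mulr_sumr exchange_big/=.
rewrite [leRHS](_ : e = e / 2 + e / 2); last by lra.
rewrite lerD2l (le_trans _ mD)// -mulrA ler_wpM2l//.
apply: (@le_trans _ _ (\sum_(i < k) 2 / m%:R)).
  by apply: ler_sum => i _; exact: fejer_weight_gap.
by rewrite sumr_const card_ord -[leLHS]mulr_natl.
Qed.
End TrigPoly.

(** * Means of bounded random variables *)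

Section Mean.
Context (R : realType) (d : measure_display) (T : measurableType d)
  (P : probability T R).
Implicit Types f g : T -> R.

(** Real-valued expectation: on bounded functions it is linear and monotone
    without finiteness conditions. *)
Definition mean f : R := \int[P]_w f w.

Definition bounded_mfun f := measurable_fun setT f /\ exists M : R, forall w, `|f w| <= M.

Lemma bounded_mfun_integrable f : bounded_mfun f -> P.-integrable setT (EFin \o f).
Proof.
move=> [mf [M fM]]; apply: measurable_bounded_integrable => //.
  by rewrite -ge0_fin_numE// fin_num_measure.
by exists M; split; [exact: num_real|move=> x Mx w _ /=; rewrite (le_trans (fM w))// ltW].
Qed.

Lemma expectation_mean f : bounded_mfun f -> ('E_P[f])%E = (mean f)%:E.
Proof.
move=> bf; rewrite unlock /mean /Rintegral fineK//.
by apply: integrable_fin_num => //; exact: bounded_mfun_integrable.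
Qed.

Lemma bounded_mfun_cst c : bounded_mfun (fun=> c).
Proof. by split; [exact: measurable_cst|exists `|c|]. Qed.

Lemma bounded_mfunD f g : bounded_mfun f -> bounded_mfun g ->
  bounded_mfun (fun w => f w + g w).
Proof.
move=> [mf [M fM]] [mg [N gN]]; split; first exact: measurable_funD.
by exists (M + N) => w; rewrite (le_trans (ler_normD _ _))// lerD.
Qed.

Lemma bounded_mfunZ c f : bounded_mfun f -> bounded_mfun (fun w => c * f w).
Proof.
move=> [mf [M fM]]; split; first by apply: measurable_funM => //; exact: measurable_cst.
by exists (`|c| * M) => w; rewrite normrM ler_wpM2l.
Qed.

Lemma bounded_mfunB f g : bounded_mfun f -> bounded_mfun g ->
  bounded_mfun (fun w => f w - g w).
Proof.
move=> bf bg; rewrite (_ : (fun _ => _) = fun w => f w + (- 1) * g w).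
  by apply: bounded_mfunD => //; exact: bounded_mfunZ.
by apply/funext => w; rewrite mulN1r.
Qed.

Lemma bounded_mfun_sum I (s : seq I) (f : I -> T -> R) :
  (forall i, bounded_mfun (f i)) -> bounded_mfun (fun w => \sum_(i <- s) f i w).
Proof.
move=> H; elim: s => [|i s IH].
  rewrite (_ : (fun _ => _) = fun=> 0); first exact: bounded_mfun_cst.
  by apply/funext => w; rewrite big_nil.
rewrite (_ : (fun _ => _) = fun w => f i w + \sum_(j <- s) f j w).
  exact: bounded_mfunD.
by apply/funext => w; rewrite big_cons.
Qed.

Lemma meanD f g : bounded_mfun f -> bounded_mfun g ->
  mean (fun w => f w + g w) = mean f + mean g.
Proof. by move=> bf bg; rewrite /mean RintegralD//; exact: bounded_mfun_integrable. Qed.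

Lemma meanB f g : bounded_mfun f -> bounded_mfun g ->
  mean (fun w => f w - g w) = mean f - mean g.
Proof. by move=> bf bg; rewrite /mean RintegralB//; exact: bounded_mfun_integrable. Qed.

Lemma meanZ c f : bounded_mfun f -> mean (fun w => c * f w) = c * mean f.
Proof. by move=> bf; rewrite /mean RintegralZl//; exact: bounded_mfun_integrable. Qed.

Lemma mean_cst c : mean (fun=> c) = c.
Proof. by rewrite /mean Rintegral_cst//= [X in fine X](@probability_setT _ _ _ P) mulr1. Qed.

Lemma mean_le f g : bounded_mfun f -> bounded_mfun g -> (forall w, f w <= g w) ->
  mean f <= mean g.
Proof. by move=> bf bg fg; rewrite /mean le_Rintegral//; exact: bounded_mfun_integrable. Qed.

Lemma mean_sum I (s : seq I) (f : I -> T -> R) : (forall i, bounded_mfun (f i)) ->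
  mean (fun w => \sum_(i <- s) f i w) = \sum_(i <- s) mean (f i).
Proof.
move=> H; elim: s => [|i s IH].
  rewrite [RHS]big_nil -[RHS](mean_cst 0); congr mean.
  by apply/funext => w; rewrite big_nil.
rewrite big_cons -IH -meanD//; last exact: bounded_mfun_sum.
by congr mean; apply/funext => w; rewrite big_cons.
Qed.

Lemma mean_dist f g h : bounded_mfun f -> bounded_mfun g -> bounded_mfun h ->
  (forall w, `|f w - g w| <= h w) -> `|mean f - mean g| <= mean h.
Proof.
move=> bf bg bh H; rewrite -meanB// ler_norml; apply/andP; split.
  rewrite -mulN1r -meanZ//; apply: mean_le => //; [exact: bounded_mfunZ|exact: bounded_mfunB|].
  by move=> w; rewrite mulN1r; have := H w; rewrite ler_norml => /andP[].
apply: mean_le => //; first exact: bounded_mfunB.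
by move=> w; have := H w; rewrite ler_norml => /andP[].
Qed.

Lemma mean_cvg (f : nat -> T -> R) g M : (forall n, measurable_fun setT (f n)) ->
  (forall n w, `|f n w| <= M) -> (forall w, (f ^~ w) n @[n --> \oo] --> g w) ->
  mean (f n) @[n --> \oo] --> mean g.
Proof.
move=> mf fM fg.
have mg : measurable_fun setT g by apply: (measurable_fun_cvg mf) => w _; exact: fg.
have h1 : {ae P, forall w, setT w -> (f n w)%:E @[n --> \oo] --> (g w)%:E}.
  by apply/aeW => w _; apply/fine_cvgP; split; [exact: nearW|exact: fg].
have h2 : P.-integrable setT (fun=> M%:E).
  by apply: (@bounded_mfun_integrable (fun=> M)); exact: bounded_mfun_cst.
have h3 : {ae P, forall w n, setT w -> (`|(f n w)%:E| <= M%:E)%E}.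
  by apply/aeW => w n _; rewrite lee_fin.
have [ig _ h] := @dominated_convergence _ _ _ P setT measurableT
  (fun n w => (f n w)%:E) (fun w => (g w)%:E) (fun=> M%:E)
  (fun n => (measurable_EFinP _ _).2 (mf n)) ((measurable_EFinP _ _).2 mg) h1 h2 h3.
apply: fine_cvg; rewrite /mean /Rintegral fineK//.
exact: integrable_fin_num.
Qed.
End Mean.

(** * Convergence in distribution from cosine means *)

Section RandomVector.
Context (R : realType) (k : nat) (d : measure_display) (T : measurableType d).
Local Notation V := 'rV[R]_k.
Variable X : T -> V.
Hypothesis mX : forall i, measurable_fun setT (fun w => X w 0 i).

Lemma measurable_rdot t : measurable_fun setT (fun w => rdot t (X w)).
Proof.
under eq_fun do rewrite rdotE.
by apply: measurable_sum => i; apply: measurable_funM => //; exact: measurable_cst.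
Qed.

Lemma measurable_trig f : trig_poly f -> measurable_fun setT (fun w => f (X w)).
Proof.
elim=> {f} [t a|f g _ mf _ mg|c f _ mf].
- apply: (measurableT_comp (continuous_measurable_fun (@continuous_cos R))) => //.
  apply: measurable_funD; last exact: measurable_cst.
  exact: measurable_rdot.
- exact: measurable_funD.
- by apply: measurable_funM => //; exact: measurable_cst.
Qed.

Lemma bounded_trig f : trig_poly f -> exists M, forall x : V, `|f x| <= M.
Proof.
elim=> {f} [t a|f g _ [M fM] _ [N gN]|c f _ [M fM]].
- by exists 1 => x; rewrite ler_norml cos_geN1 cos_le1.
- by exists (M + N) => x; rewrite (le_trans (ler_normD _ _))// lerD.
- by exists (`|c| * M) => x; rewrite normrM ler_wpM2l.
Qed.

Lemma bounded_mfun_trig f : trig_poly f -> bounded_mfun (fun w => f (X w)).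
Proof.
move=> tf; split; first exact: measurable_trig.
by have [M fM] := bounded_trig tf; exists M.
Qed.

(** [f] is a pointwise limit of trigonometric polynomials, whose measurability
    only involves the coordinates of [X]. *)
Lemma bounded_mfun_comp (f : V -> R) : continuous f -> (exists M : R, forall x : V, `|f x| <= M) ->
  bounded_mfun (fun w => f (X w)).
Proof.
move=> cf [M fM]; split; last by exists M.
have H n : exists g : V -> R, trig_poly g /\
    forall x : V, (forall i, `|x 0 i| <= n.+1%:R) -> `|f x - g x| <= n.+1%:R^-1.
  have n0 : (0 : R) < n.+1%:R by rewrite ltr0n.
  have n1 : (0 : R) < n.+1%:R^-1 by rewrite invr_gt0.
  by have [g [tg _ gf]] := trig_approx cf fM n0 n1; exists g.
have [g gP] := choice H.
apply: (@measurable_fun_cvg _ _ _ _ (fun n w => g n (X w))).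
  by move=> n; apply: measurable_trig; exact: (gP n).1.
move=> w _; apply/cvgrPdist_le => e e0.
have [N NP] : exists N : nat, forall n, (N <= n)%N ->
    (forall i, `|X w 0 i| <= n.+1%:R) /\ n.+1%:R^-1 <= e.
  exists (Num.trunc (\sum_i `|X w 0 i| + e^-1)) => n nN.
  have h : \sum_i `|X w 0 i| + e^-1 < n.+1%:R.
    by rewrite (lt_le_trans (truncnS_gt _))// ler_nat.
  have ei : 0 < e^-1 by rewrite invr_gt0.
  split=> [i|]; last first.
    rewrite invf_ple ?posrE ?ltr0n// (le_trans _ (ltW h))// lerDr.
    by rewrite sumr_ge0.
  rewrite (le_trans _ (ltW h))// (bigD1 i)//= -addrA lerDl addr_ge0 ?(ltW ei)//.
  by rewrite sumr_ge0.
near=> n; have [|h1 h2] := NP n _; first by near: n; exact: nbhs_infty_ge.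
by rewrite (le_trans ((gP n).2 _ h1)).
Unshelve. all: by end_near. Qed.

(** Dominates the indicator of the complement of the box of half-width [L], and
    is itself dominated by second moments. *)
Definition cutoff (L : R) (x : V) : R := \sum_i Num.min 1 ((x 0 i / L) ^+ 2).

Lemma cutoff_ge0 L x : 0 <= cutoff L x.
Proof. by apply: sumr_ge0 => i _; rewrite le_min ler01 sqr_ge0. Qed.

Lemma measurable_cutoff1 L i :
  measurable_fun setT (fun w => Num.min 1 ((X w 0 i / L) ^+ 2)).
Proof.
apply: measurable_minr; first exact: measurable_cst.
apply: measurable_funX; apply: measurable_funM => //; exact: measurable_cst.
Qed.

Lemma bounded_mfun_cutoff1 L i : bounded_mfun (fun w => Num.min 1 ((X w 0 i / L) ^+ 2)).
Proof.
split; first exact: measurable_cutoff1.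
exists 1 => w; rewrite ger0_norm; first by rewrite ge_min lexx.
by rewrite le_min ler01 sqr_ge0.
Qed.

Lemma bounded_mfun_cutoff L : bounded_mfun (fun w => cutoff L (X w)).
Proof. by apply: bounded_mfun_sum => i; exact: bounded_mfun_cutoff1. Qed.

(** Outside the box both functions are bounded by [M] while the cutoff is at
    least 1. *)
Lemma trig_approx_mean (P : probability T R) f g (M L e : R) : continuous f ->
  (forall x : V, `|f x| <= M) -> trig_poly g -> (forall x : V, `|g x| <= M) -> 0 < L ->
  (forall x : V, (forall i, `|x 0 i| <= L) -> `|f x - g x| <= e) -> 0 <= e ->
  `|mean P (fun w => f (X w)) - mean P (fun w => g (X w))| <=
   e + 2 * M * mean P (fun w => cutoff L (X w)).
Proof.
move=> cf fM tg gM L0 fg e0.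
have M0 : 0 <= M by rewrite (le_trans _ (fM 0)).
have bc := bounded_mfun_cutoff L.
rewrite -(mean_cst P e) -meanZ// -meanD//; last 2 first.
  exact: bounded_mfun_cst.
  exact: bounded_mfunZ.
apply: mean_dist.
- by apply: bounded_mfun_comp => //; exists M.
- exact: bounded_mfun_trig.
- by apply: bounded_mfunD; [exact: bounded_mfun_cst|exact: bounded_mfunZ].
move=> w; have [small|/existsNP[i /negP]] := pselect (forall i, `|X w 0 i| <= L).
  by rewrite (le_trans (fg _ small))// lerDl mulr_ge0 ?mulr_ge0 ?cutoff_ge0.
rewrite -ltNge => big.
rewrite (le_trans (ler_normB _ _))// (@le_trans _ _ (2 * M))//.
  by rewrite mulr2n mulrDl mul1r lerD.
apply: ler_wpDl => //; rewrite ler_peMr ?mulr_ge0//.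
rewrite /cutoff (bigD1 i)//= min_l; first by rewrite lerDl sumr_ge0// => j _; rewrite le_min ler01 sqr_ge0.
rewrite -real_normK ?num_real// exprn_ege1// normrM normfV (gtr0_norm L0).
by rewrite ler_pdivlMr// mul1r ltW.
Qed.

Lemma mean_cutoff_tight (P : probability T R) :
  mean P (fun w => cutoff n.+1%:R (X w)) @[n --> \oo] --> (0 : R).
Proof.
rewrite -(mean_cst P 0); apply: (@mean_cvg _ _ _ _ _ _ k%:R).
- by move=> n; have [] := bounded_mfun_cutoff n.+1%:R.
- move=> n w; rewrite ger0_norm ?cutoff_ge0// /cutoff -[k in leRHS]card_ord -sum1_card natr_sum.
  by apply: ler_sum => i _; rewrite ge_min lexx.
move=> w; rewrite /cutoff.
rewrite [X in _ --> X](_ : 0 = \sum_(i < k) 0); last by rewrite big1.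
apply: cvg_sumr => i.
apply: (@squeeze_cvgr _ _ _ _ (fun=> 0) (fun n => (X w 0 i) ^+ 2 * n.+1%:R^-1)).
- near=> n; rewrite le_min ler01 sqr_ge0/= ge_min; apply/orP; right.
  rewrite exprMn ler_wpM2l ?sqr_ge0// expr2 ler_piMl ?invr_ge0// invf_le1 ?ler1n//.
- exact: cvg_cst.
rewrite -(mulr0 (X w 0 i ^+ 2)); apply: cvgMl_tmp.
exact: (@cvg_harmonic R).
Unshelve. all: by end_near. Qed.
End RandomVector.

Section WeakConvergence.
Context (R : realType) (k : nat).
Local Notation V := 'rV[R]_k.

(** Convergence of the characteristic functions together with tightness give
    convergence in law, since trigonometric polynomials approximate a bounded
    continuous function uniformly on any box without exceeding its bound. *)
Lemma cvg_in_distribution_of_cos d (T : measurableType d) (P : probability T R)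
    (X : nat -> T -> V) d' (T' : measurableType d') (P' : probability T' R)
    (Y : T' -> V) :
  (forall n i, measurable_fun setT (fun w => X n w 0 i)) ->
  (forall i, measurable_fun setT (fun w => Y w 0 i)) ->
  (forall t a, mean P (fun w => cos (rdot t (X n w) + a)) @[n --> \oo] -->
     mean P' (fun w => cos (rdot t (Y w) + a))) ->
  (forall e, 0 < e -> \forall m \near \oo, \forall n \near \oo,
     mean P (fun w => cutoff m.+1%:R (X n w)) <= e) ->
  cvg_in_distribution P X P' Y.
Proof.
move=> mX mY XY tX f cf [M fM].
have bX n : bounded_mfun (f \o X n) by apply: bounded_mfun_comp => //; exists M.
have bY : bounded_mfun (f \o Y) by apply: bounded_mfun_comp => //; exists M.
under eq_fun do rewrite expectation_mean//.
rewrite expectation_mean//; apply/fine_cvgP; split; first exact: nearW.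
have trigcvg g : trig_poly g -> mean P (fun w => g (X n w)) @[n --> \oo] -->
    mean P' (fun w => g (Y w)).
  elim=> {g} [t a|g h tg IHg th IHh|c g tg IH]; first exact: XY.
    rewrite (meanD _ (bounded_mfun_trig mY tg) (bounded_mfun_trig mY th)).
    under eq_fun do rewrite (meanD _ (bounded_mfun_trig (mX _) tg) (bounded_mfun_trig (mX _) th)).
    exact: cvgD.
  rewrite (meanZ _ _ (bounded_mfun_trig mY tg)).
  under eq_fun do rewrite (meanZ _ _ (bounded_mfun_trig (mX _) tg)).
  exact: cvgMl_tmp.
have M0 : 0 <= M by rewrite (le_trans _ (fM 0)).
apply/cvgrPdist_le => e e0.
pose e1 := e / (4 * (1 + 4 * M)).
have e10 : 0 < e1 by rewrite divr_gt0// mulr_gt0//; lra.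
have eE : e = 4 * (e1 * (1 + 4 * M)).
  by rewrite /e1; field; apply/eqP; lra.
near \oo => m.
have ctX : \forall n \near \oo, mean P (fun w => cutoff m.+1%:R (X n w)) <= e1.
  by near: m; exact: tX.
have ctY : mean P' (fun w => cutoff m.+1%:R (Y w)) <= e1.
  near: m; have /cvgrPdist_le /(_ _ e10) := mean_cutoff_tight mY P'.
  apply: filterS => m; rewrite sub0r normrN; exact: le_trans (ler_norm _).
have m0 : (0 : R) < m.+1%:R by rewrite ltr0n.
have [g [tg gM fg]] := trig_approx cf fM m0 e10.
have /cvgrPdist_le /(_ _ e10) gXY := trigcvg g tg.
near=> n.
have h1 := @trig_approx_mean R k _ _ Y mY P' f g M _ _ cf fM tg gM m0 fg (ltW e10).
have h2 := @trig_approx_mean R k _ _ (X n) (mX n) P f g M _ _ cf fM tg gM m0 fg (ltW e10).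
have h3 : `|mean P' (fun w => g (Y w)) - mean P (fun w => g (X n w))| <= e1.
  by near: n; exact: gXY.
have h4 : mean P (fun w => cutoff m.+1%:R (X n w)) <= e1 by near: n.
have h5 : 2 * M * mean P (fun w => cutoff m.+1%:R (X n w)) <= 2 * M * e1.
  by rewrite ler_wpM2l ?mulr_ge0.
have h6 : 2 * M * mean P' (fun w => cutoff m.+1%:R (Y w)) <= 2 * M * e1.
  by rewrite ler_wpM2l ?mulr_ge0.
have h7 : 0 <= M * e1 by rewrite mulr_ge0// ltW.
rewrite /= (_ : _ - _ = (mean P' (f \o Y) - mean P' (fun w => g (Y w))) +
  (mean P' (fun w => g (Y w)) - mean P (fun w => g (X n w))) -
  (mean P (f \o X n) - mean P (fun w => g (X n w)))); last by rewrite /=; ring.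
rewrite (le_trans (ler_normB _ _))// (le_trans (lerD (ler_normD _ _) (lexx _)))//.
move: h1 h2 h3; rewrite /comp => h1 h2 h3; lra.
Unshelve. all: by end_near. Qed.
End WeakConvergence.

(** * The characteristic function of the normal law *)

Section NormalCharacteristic.
Context (R : realType) (sigma : R).
Hypothesis sigma0 : 0 < sigma.
Local Notation mu := (@lebesgue_measure R).
Local Notation phi := (normal_pdf 0 sigma).

Let s_neq0 : sigma != 0. Proof. by rewrite gt_eqF. Qed.

Lemma integral_normal_prob (f : R -> R) :
  bounded_mfun (f : measurableTypeR R -> R) ->
  mean (normal_prob 0 sigma) f = \int[mu]_x (f x * phi x).
Proof.
move=> bf; have [mf _] := bf.
have intf : (normal_prob 0 sigma).-integrable setT (EFin \o (f : measurableTypeR R -> R)).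
  exact: bounded_mfun_integrable.
rewrite /mean /Rintegral; congr fine.
rewrite -(Radon_Nikodym_change_of_variables (normal_prob_dominates 0 sigma))//=.
apply: ae_eq_integral => //.
- apply: emeasurable_funM => //; first exact/measurable_EFinP.
  apply: (measurable_int mu).
  by apply: Radon_Nikodym_integrable; exact: normal_prob_dominates.
- apply/measurable_EFinP; apply: measurable_funM => //.
  exact: measurable_normal_pdf.
under [X in ae_eq _ _ _ X]eq_fun do rewrite EFinM.
apply: ae_eqe_mul2l => /=.
rewrite Radon_NikodymE//=; first exact: normal_prob_dominates.
move=> abmu.
case: cid => /= h [h1 h2 h3].
apply: integral_ae_eq => //=.
  by apply/measurable_EFinP; exact: measurable_normal_pdf.
by move=> E _ mE; rewrite -h3.
Qed.

Let phiE x : phi x = normal_peak sigma * expR (- x ^+ 2 / (sigma ^+ 2 *+ 2)).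
Proof. by rewrite normal_pdfE// /normal_fun subr0. Qed.

Let is_derive_phi (x : R) : is_derive x 1 phi (- (x / sigma ^+ 2) * phi x).
Proof.
have -> : phi = (fun y => normal_peak sigma * expR (- y ^+ 2 / (sigma ^+ 2 *+ 2))).
  by apply/funext => y; rewrite phiE.
apply: is_derive_eq.
by rewrite !scaler0 !add0r /GRing.scale/= !mulr1 -[sigma ^+ 2 *+ 2]mulr_natr; field.
Qed.

Let integrable_pdfM (f : R -> R) : measurable_fun setT f ->
  (exists M, forall x, `|f x| <= M) -> mu.-integrable setT (fun x => (f x * phi x)%:E).
Proof.
move=> mf [M fM].
have := @integrable_normal_pdf R 0 sigma.
move=> /(integrableZl measurableT M).
apply: le_integrable => //.
  by apply/measurable_EFinP; apply: measurable_funM => //; exact: measurable_normal_pdf.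
move=> x _; rewrite lee_fin normrM normrM ler_wpM2r//.
by rewrite (le_trans (fM x))// ler_norm.
Qed.

Let mphi : measurable_fun setT phi. Proof. exact: measurable_normal_pdf. Qed.

(** The Gaussian tail absorbs one power of [x] at the price of a larger
    variance. *)
Let integrable_absM : mu.-integrable setT (fun x => (`|x| * phi x)%:E).
Proof.
pose tau := sigma * Num.sqrt 2.
have tau0 : tau != 0 by rewrite mulf_neq0// gt_eqF// sqrtr_gt0.
pose c := sigma * normal_peak sigma / normal_peak tau.
have := @integrable_normal_pdf R 0 tau.
move=> /(integrableZl measurableT c).
apply: le_integrable => //.
  by apply/measurable_EFinP; exact: measurable_funM.
move=> x _; rewrite lee_fin [leLHS]normrM normr_id (ger0_norm (normal_pdf_ge0 _ _ _)).
have pk : 0 < normal_peak tau by exact: normal_peak_gt0.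
rewrite (le_trans _ (ler_norm _))// phiE (normal_pdfE _ tau0) /normal_fun subr0.
rewrite /c [leRHS](_ : _ = sigma * normal_peak sigma *
    expR (- x ^+ 2 / (tau ^+ 2 *+ 2))); last by field; rewrite gt_eqF.
rewrite mulrCA (mulrC sigma) -mulrA ler_wpM2l ?normal_peak_ge0//.
have -> : - x ^+ 2 / (sigma ^+ 2 *+ 2) =
   - x ^+ 2 / (tau ^+ 2 *+ 2) - (x / sigma) ^+ 2 / 4.
  have -> : tau ^+ 2 *+ 2 = sigma ^+ 2 * 4.
    by rewrite /tau exprMn sqr_sqrtr// -[LHS]mulr_natr -mulrA -natrM.
  by rewrite -[sigma ^+ 2 *+ 2]mulr_natr; field.
rewrite expRD mulrCA [leRHS]mulrC ler_wpM2l ?expR_ge0//.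
rewrite expRN ler_pdivrMr ?expR_gt0//.
apply: (@le_trans _ _ (sigma * (1 + (x / sigma) ^+ 2 / 4))); last first.
  by rewrite ler_pM2l// expR_ge1Dx.
rewrite -real_normK ?num_real// normf_div (gtr0_norm sigma0).
set u := `|x| / sigma; have -> : `|x| = sigma * u by rewrite /u; field.
rewrite ler_pM2l// -subr_ge0 (_ : _ - u = (1 - u / 2) ^+ 2) ?sqr_ge0//.
by field.
Qed.

Variable a : R.
(* K is minus the derivative of H, and integration by parts expresses K by H:
   this is the differential equation H' s = - s sigma^2 H s *)
Let H (s : R) : R := \int[mu]_x (cos (s * x + a) * phi x).
Let K (s : R) : R := \int[mu]_x (x * sin (s * x + a) * phi x).

Let bounded_cos (s : R) : exists M : R, forall x : R, `|cos (s * x + a)| <= M.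
Proof. by exists 1 => x; rewrite ler_norml cos_geN1 cos_le1. Qed.

Let continuous_aff (s : R) : continuous (fun x : R => s * x + a).
Proof.
by move=> x; apply: cvgD; [apply: cvgMl_tmp; exact: cvg_id|exact: cvg_cst].
Qed.

Let continuous_cos_aff (s : R) : continuous (fun x : R => cos (s * x + a)).
Proof.
move=> x; apply: (@continuous_comp _ _ _ (fun x => s * x + a) cos); first exact: continuous_aff.
exact: continuous_cos.
Qed.

Let continuous_sin_aff (s : R) : continuous (fun x : R => sin (s * x + a)).
Proof.
move=> x; apply: (@continuous_comp _ _ _ (fun x => s * x + a) sin); first exact: continuous_aff.
exact: continuous_sin.
Qed.

Let measurable_cos_aff (s : R) : measurable_fun setT (fun x : R => cos (s * x + a)).
Proof. by apply: continuous_measurable_fun; exact: continuous_cos_aff. Qed.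

Let measurable_sin_aff (s : R) : measurable_fun setT (fun x : R => sin (s * x + a)).
Proof. by apply: continuous_measurable_fun; exact: continuous_sin_aff. Qed.

Let integrable_K s : mu.-integrable setT (fun x => (x * sin (s * x + a) * phi x)%:E).
Proof.
apply: (le_integrable _ _ _ integrable_absM) => //.
  apply/measurable_EFinP; apply: measurable_funM => //.
  by apply: measurable_funM => //; exact: measurable_sin_aff.
move=> x _; rewrite lee_fin !normrM ler_wpM2r// normr_id ler_piMr//.
by rewrite ler_norml sin_geN1 sin_le1.
Qed.

Let partial_cos (s x : R) : is_derive s 1 (fun s => cos (s * x + a) * phi x)
  (- (x * sin (s * x + a) * phi x)).
Proof.
apply: is_derive_eq.
by rewrite !scaler0 !addr0 ?add0r /GRing.scale/=; ring.
Qed.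

Let is_derive_H (s : R) : is_derive s 1 H (- K s).
Proof.
have dP (x y : R) : partial1of2 (fun s y : R => cos (s * y + a) * phi y) x y =
    - (y * sin (x * y + a) * phi y).
  by rewrite partial1of2E; apply: derive_val; exact: partial_cos.
have I0 : (`]s - 1, s + 1[%classic : set R) s by rewrite /= in_itv/=; apply/andP; split; lra.
have h1 (x : R) : `]s - 1, s + 1[%classic x ->
    mu.-integrable setT (EFin \o (fun y => cos (x * y + a) * phi y)).
  by move=> _; exact: integrable_pdfM.
have h2 (x y : R) : `]s - 1, s + 1[%classic x -> setT y ->
    derivable (fun s : R => cos (s * y + a) * phi y) x 1.
  by move=> _ _; have [] := partial_cos x y.
have h3 (y : R) : 0 <= `|y| * phi y by rewrite mulr_ge0// normal_pdf_ge0.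
have h4 (x y : R) : `]s - 1, s + 1[%classic x -> setT y ->
    `|partial1of2 (fun s y : R => cos (s * y + a) * phi y) x y| <= `|y| * phi y.
  move=> _ _; rewrite dP normrN !normrM (ger0_norm (normal_pdf_ge0 _ _ _)).
  rewrite ler_wpM2r ?normal_pdf_ge0// ler_piMr//.
  by rewrite ler_norml sin_geN1 sin_le1.
have d1 := derivable_under_integral measurableT I0 h1 h2 h3 integrable_absM h4.
have d2 := differentiation_under_integral measurableT I0 h1 h2 h3 integrable_absM h4.
apply: DeriveDef; first exact: d1.
rewrite -derive1E [LHS]d2 /K -mulN1r -RintegralZl//; last exact: integrable_K.
by apply: eq_Rintegral => x _; rewrite dP mulN1r.
Qed.

(* the product integrated by parts, and its derivative in x *)
Let g (s x : R) : R := sin (s * x + a) * phi x.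
Let g' (s x : R) : R := s * (cos (s * x + a) * phi x) - sigma ^- 2 * (x * sin (s * x + a) * phi x).

Let is_derive_g (s x : R) : is_derive x 1 (g s) (g' s x).
Proof.
have dphi := is_derive_phi x; rewrite /g; apply: is_derive_eq.
rewrite addr0 /GRing.scale/= /g'; field.
exact: s_neq0.
Qed.

Let continuous_g' s : continuous (g' s).
Proof.
have cphi : continuous phi by exact: continuous_normal_pdf.
move=> x; apply: cvgB; apply: cvgMl_tmp; apply: cvgM; try exact: cphi.
  exact: continuous_cos_aff.
by apply: cvgM; [exact: cvg_id|exact: continuous_sin_aff].
Qed.

Let continuous_g s : continuous (g s).
Proof.
move=> x; apply: differentiable_continuous; apply/derivable1_diffP.
by have [] := is_derive_g s x.
Qed.

Let integrable_g' s : mu.-integrable setT (fun x => (g' s x)%:E).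
Proof.
have h1 := integrableZl measurableT s (integrable_pdfM (measurable_cos_aff s) (bounded_cos s)).
have h2 := integrableZl measurableT (sigma ^- 2) (integrable_K s).
exact: integrableB h1 h2.
Qed.

Let integral_g'_itv s (n : nat) :
  \int[mu]_(x in `[- n.+1%:R, n.+1%:R]) g' s x = g s n.+1%:R - g s (- n.+1%:R).
Proof.
have n0 : - n.+1%:R < n.+1%:R :> R by rewrite gtrN// ltr0n.
rewrite /Rintegral (@continuous_FTC2 R (g' s) (g s))//.
- by apply: continuous_subspaceT; exact: continuous_g'.
- split; first by move=> x _; have [] := is_derive_g s x.
  + by apply: cvg_at_right_filter; exact: continuous_g.
  + by apply: cvg_at_left_filter; exact: continuous_g.
by move=> x _; rewrite derive1E; apply: derive_val; exact: is_derive_g.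
Qed.

Let g_tail s (n : nat) (x : R) : x ^+ 2 = n.+1%:R ^+ 2 ->
  `|g s x| <= normal_peak sigma * (sigma ^+ 2 *+ 2) * n.+1%:R^-1.
Proof.
move=> xn; rewrite /g normrM (ger0_norm (normal_pdf_ge0 _ _ _)).
apply: (@le_trans _ _ (phi x)).
  by rewrite ler_piMl ?normal_pdf_ge0// ler_norml sin_geN1 sin_le1.
rewrite phiE -mulrA ler_wpM2l ?normal_peak_ge0// mulNr expRN xn.
have v0 : 0 < sigma ^+ 2 *+ 2 by rewrite pmulrn_lgt0// exprn_gt0.
have n1 : (1 : R) <= n.+1%:R by rewrite ler1n.
rewrite invf_ple ?posrE ?expR_gt0 ?mulr_gt0 ?invr_gt0// invfM invrK mulrC.
apply: (@le_trans _ _ (1 + n.+1%:R ^+ 2 / (sigma ^+ 2 *+ 2))); last exact: expR_ge1Dx.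
by rewrite ler_wpDl// ler_wpM2r ?invr_ge0 ?(ltW v0)// expr2 ler_peMl.
Qed.

(** The boundary terms at [n + 1] and [- (n + 1)] vanish in the limit. *)
Let integral_g' s : \int[mu]_x g' s x = 0.
Proof.
pose f (n : nat) (x : R) := (fun x => g' s x) \_ `[- n.+1%:R, n.+1%:R] x.
have c1 : \int[mu]_x f n x @[n --> \oo] --> \int[mu]_x g' s x.
  have mg : measurable_fun setT (g' s).
    by apply: continuous_measurable_fun; exact: continuous_g'.
  have mf n : measurable_fun setT (fun x => (f n x)%:E).
    apply/measurable_EFinP; apply/(measurable_restrictT _ _).1 => //.
    exact: measurable_funTS.
  have h2 := integrable_norm (integrable_g' s).
  have h1 : {ae mu, forall x, setT x -> (f n x)%:E @[n --> \oo] --> (g' s x)%:E}.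
    apply/aeW => x _; apply/fine_cvgP; split; first exact: nearW.
    apply: cvg_near_cst; near=> n; rewrite /f /= patchE ifT//.
    rewrite inE/= in_itv/= -ler_norml (@le_trans _ _ n%:R) ?ler_nat//.
    by near: n; exact: nbhs_infty_ger.
  have h3 : {ae mu, forall x n, setT x -> (`|(f n x)%:E| <= (`|g' s x|)%:E)%E}.
    apply/aeW => x n _; rewrite lee_fin /f patchE; case: ifP => _ //=.
    by rewrite normr0.
  have [_ _ h] := @dominated_convergence _ _ _ mu setT measurableT
    (fun n x => (f n x)%:E) (fun x => (g' s x)%:E) _ mf
    ((measurable_EFinP _ _).2 mg) h1 h2 h3.
  apply: fine_cvg; rewrite /Rintegral fineK//.
  exact: integrable_fin_num.
have c2 : \int[mu]_x f n x @[n --> \oo] --> (0 : R).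
  apply/norm_cvg0P.
  apply: (@squeeze_cvgr _ _ _ _ (fun=> 0)
    (fun n => 2 * (normal_peak sigma * (sigma ^+ 2 *+ 2)) * n.+1%:R^-1)).
  - near=> n; rewrite normr_ge0/= -Rintegral_mkcond integral_g'_itv.
    rewrite (le_trans (ler_normB _ _))// -mulrA mulr2n mulrDl mul1r lerD//.
      exact: g_tail.
    by apply: g_tail; rewrite sqrrN.
  - exact: cvg_cst.
  rewrite -[X in _ --> X](mulr0 (2 * (normal_peak sigma * (sigma ^+ 2 *+ 2)))).
  by apply: cvgMl_tmp; exact: (@cvg_harmonic R).
exact: (cvg_unique _ c1 c2).
Unshelve. all: by end_near. Qed.

Let H_ode s : K s = s * sigma ^+ 2 * H s.
Proof.
have := integral_g' s.
rewrite RintegralB//; last 2 first.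
- exact: (integrableZl measurableT s (integrable_pdfM (measurable_cos_aff s) (bounded_cos s))).
- exact: (integrableZl measurableT (sigma ^- 2) (integrable_K s)).
rewrite RintegralZl//; last exact: integrable_pdfM.
rewrite RintegralZl//; last exact: integrable_K.
rewrite -/(H s) -/(K s) => /eqP; rewrite subr_eq0 => /eqP h.
have -> : K s = sigma ^+ 2 * (sigma ^- 2 * K s).
  by rewrite mulrA divff ?mul1r// expf_neq0.
by rewrite -h; ring.
Qed.

Lemma bounded_mfun_cos_aff s :
  bounded_mfun ((fun x => cos (s * x + a)) : measurableTypeR R -> R).
Proof. by split; [exact: measurable_cos_aff|exact: bounded_cos]. Qed.

(** By [H_ode], the product of [H] with the inverse of the claimed exponential has
    zero derivative. *)
Lemma normal_cos_integral s :
  mean (normal_prob 0 sigma) (fun x => cos (s * x + a)) =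
  expR (- (s ^+ 2 * sigma ^+ 2 / 2)) * cos a.
Proof.
rewrite integral_normal_prob; last exact: bounded_mfun_cos_aff.
rewrite -/(H s).
have H0 : H 0 = cos a.
  rewrite /H; under eq_Rintegral do rewrite mul0r add0r.
  rewrite RintegralZl//; last exact: integrable_normal_pdf.
  by rewrite /Rintegral integral_normal_pdf mulr1.
pose q (s : R) := H s * expR (s ^+ 2 * sigma ^+ 2 / 2).
have qc : q s = q 0.
  apply: is_derive_0_is_cst => z.
  have dH := is_derive_H z.
  rewrite /q; apply: is_derive_eq.
  by rewrite H_ode /GRing.scale/=; field.
rewrite expRN mulrC; apply/eqP; rewrite eq_sym; apply/eqP.
rewrite -H0 (_ : H 0 = q 0); last by rewrite /q expr0n/= !mul0r expR0 mulr1.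
by rewrite -qc /q mulfK// gt_eqF// expR_gt0.
Qed.
End NormalCharacteristic.

(** * Uniqueness of the law with given cosine means *)

Section LawOfCos.
Context (R : realType).

(** A real random variable is determined in law by its characteristic
    function: equal characteristic functions give equal expectations of bounded
    continuous functions, which approximate the indicators of half-lines. *)
Lemma law_of_cos d (T : measurableType d) (P : probability T R) (y : T -> R)
    d' (T' : measurableType d') (P' : probability T' R) (y' : T' -> R) :
  measurable_fun setT y -> measurable_fun setT y' ->
  (forall s a, mean P (fun w => cos (s * y w + a)) =
     mean P' (fun w => cos (s * y' w + a))) ->
  forall B : set R, measurable B -> P (y @^-1` B) = P' (y' @^-1` B).
Proof.
move=> my my' yy'.
(* a constant sequence of one-dimensional vectors that converges in law *)
pose Y w : 'rV[R]_1 := const_mx (y w).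
pose Y' w : 'rV[R]_1 := const_mx (y' w).
have mY i : measurable_fun setT (fun w => Y w 0 i) by under eq_fun do rewrite mxE.
have mY' i : measurable_fun setT (fun w => Y' w 0 i) by under eq_fun do rewrite mxE.
have dY t w : rdot t (Y w) = t 0 0 * y w by rewrite rdotE big_ord1 mxE mulrC.
have dY' t w : rdot t (Y' w) = t 0 0 * y' w by rewrite rdotE big_ord1 mxE mulrC.
have cvgY : cvg_in_distribution P (fun=> Y) P' Y'.
  apply: cvg_in_distribution_of_cos => // [t a|e e0].
    have -> : mean P' (fun w => cos (rdot t (Y' w) + a)) =
        mean P (fun w => cos (rdot t (Y w) + a)).
      transitivity (mean P (fun w => cos (t 0 0 * y w + a))).
        by rewrite yy'; congr mean; apply/funext => w; rewrite dY'.
      by congr mean; apply/funext => w; rewrite dY.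
    exact: cvg_cst.
  have /cvgrPdist_le /(_ _ e0) := mean_cutoff_tight mY P.
  apply: filterS => m; rewrite sub0r normrN => h; apply: nearW => _.
  exact: le_trans (ler_norm _) h.
have meanE (g : R -> R) : continuous g -> (exists M : R, forall x, `|g x| <= M) ->
    mean P (g \o y) = mean P' (g \o y').
  move=> cg [M gM].
  have cf : continuous (fun x : 'rV[R]_1 => g (x 0 0)).
    move=> x; apply: (@continuous_comp _ _ _ (fun x : 'rV[R]_1 => x 0 0) g).
      exact: coord_continuous.
    exact: cg.
  have bf : exists M : R, forall x : 'rV[R]_1, `|g (x 0 0)| <= M by exists M.
  have := cvgY _ cf bf => /(@cvg_unique _ _ _ _ _ _ (@cvg_cst _ _ _ _ _)) h.
  have h1 := expectation_mean P (bounded_mfun_comp mY cf bf).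
  have h2 := expectation_mean P' (bounded_mfun_comp mY' cf bf).
  have : mean P (fun w => g (Y w 0 0)) = mean P' (fun w => g (Y' w 0 0)).
    by apply: EFin_inj; rewrite -h1 -h2 h.
  under [X in mean P X = _ -> _]eq_fun do rewrite mxE.
  by under [X in _ = mean P' X -> _]eq_fun do rewrite mxE.
(* ramps increasing to the indicator of u < x *)
pose g (x : R) (n : nat) (u : R) : R := Num.min 1 (Num.max 0 (n%:R * (x - u))).
have g01 x n u : 0 <= g x n u <= 1.
  by rewrite /g ge_min lexx andbT le_min ler01 le_max lexx.
have cg x n : continuous (g x n).
  move=> u; apply: (@continuous_min _ _ (fun=> 1)
    (fun u => Num.max 0 (n%:R * (x - u)))); first exact: cvg_cst.
  apply: (@continuous_max _ _ (fun=> 0) (fun u => n%:R * (x - u))); first exact: cvg_cst.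
  by apply: cvgMl_tmp; apply: cvgB; [exact: cvg_cst|exact: cvg_id].
have gcvg x u : g x n u @[n --> \oo] --> ((u < x)%R%:R : R).
  case: (ltP u x) => ux /=.
    apply: cvg_near_cst; near=> n; rewrite /g.
    have h : 1 <= n%:R * (x - u).
      rewrite -ler_pdivrMr ?subr_gt0//; near: n; exact: nbhs_infty_ger.
    by rewrite max_r ?min_l// (le_trans ler01).
  apply: cvg_near_cst; near=> n; rewrite /g max_l ?min_r//.
  by rewrite mulr_ge0_le0// subr_le0.
have lim d1 (T1 : measurableType d1) (P1 : probability T1 R) (z : T1 -> R) x :
    measurable_fun setT z ->
    mean P1 (g x n \o z) @[n --> \oo] --> fine (P1 (z @^-1` `]-oo, x[)).
  move=> mz.
  have mA : measurable (z @^-1` `]-oo, x[).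
    by rewrite -[X in measurable X]setTI; apply: mz.
  have -> : fine (P1 (z @^-1` `]-oo, x[)) = mean P1 (fun w => (z w < x)%R%:R).
    rewrite /mean /Rintegral; congr fine.
    rewrite -[in LHS](setIT (z @^-1` _)) -integral_indic//; apply: eq_integral => w _.
    rewrite indicE; suff -> : (w \in z @^-1` `]-oo, x[) = (z w < x)%R by [].
    by apply/idP/idP; rewrite inE/= in_itv/=.
  apply: (@mean_cvg _ _ _ _ _ _ 1) => [n|n w|w]; last exact: gcvg.
    exact: (measurableT_comp (continuous_measurable_fun (cg x n))).
  by have /andP[h0 h1] := g01 x n (z w); rewrite ger0_norm.
move=> B mB.
pose yM : {mfun T >-> measurableTypeR R} :=
  HB.pack (y : T -> measurableTypeR R)
    (isMeasurableFun.Build _ _ T (measurableTypeR R) y my).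
pose yM' : {mfun T' >-> measurableTypeR R} :=
  HB.pack (y' : T' -> measurableTypeR R)
    (isMeasurableFun.Build _ _ T' (measurableTypeR R) y' my').
change (distribution P yM B = distribution P' yM' B).
have mu_ := @measure_unique _ R (measurableTypeR R) (@RGenInftyO.G R)
  (fun n : nat => `]-oo, n%:R[%classic).
apply: (mu_ _ _ _ _ (distribution P yM) (distribution P' yM')) => //; clear mu_.
- exact: (@RGenInftyO.measurableE R).
- move=> _ _ [x1 ->] [x2 ->]; exists (Num.min x1 x2); apply/seteqP; split => x /=.
    by rewrite !in_itv/= lt_min => -[-> ->].
  by rewrite !in_itv/= lt_min => /andP[-> ->].
- by move=> n; exists n%:R.
- apply/seteqP; split => // x _; exists (Num.trunc x).+1 => //=.
  by rewrite in_itv/= truncnS_gt.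
- move=> _ [x ->].
  have mA : measurable (y @^-1` `]-oo, x[) by rewrite -[X in measurable X]setTI; exact: (my measurableT _ (measurable_itv _)).
  have mA' : measurable (y' @^-1` `]-oo, x[) by rewrite -[X in measurable X]setTI; exact: (my' measurableT _ (measurable_itv _)).
  rewrite /distribution /pushforward -[LHS]fineK ?fin_num_measure// -[RHS]fineK ?fin_num_measure//.
  have l1 := lim _ _ P y x my; have l2 := lim _ _ P' y' x my'.
  have e : (fun n => mean P (g x n \o y)) = (fun n => mean P' (g x n \o y')).
    apply/funext => n; apply: meanE; first exact: cg.
    by exists 1 => u; have /andP[h0 h1] := g01 x n u; rewrite ger0_norm.
  by congr (_%:E); rewrite e in l1; exact: (cvg_unique _ l1 l2).
- move=> n; rewrite /distribution /pushforward -ge0_fin_numE// fin_num_measure.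
Unshelve. all: by end_near. Qed.
End LawOfCos.

(** * Gaussian vectors with a given covariance *)

Section Cholesky.
Variable R : realType.

Lemma block_quad n (a : 'M[R]_1) (b : 'rV[R]_n) (D : 'M[R]_n) (x : 'M[R]_1) (y : 'rV[R]_n) :
  (row_mx x y *m block_mx a b b^T D *m (row_mx x y)^T) 0 0 =
  a 0 0 * x 0 0 ^+ 2 + 2 * x 0 0 * (b *m y^T) 0 0 + (y *m D *m y^T) 0 0.
Proof.
rewrite mul_row_block tr_row_mx mul_row_col !mulmxDl.
have addE (A B : 'M[R]_1) : (A + B) 0 0 = A 0 0 + B 0 0 by rewrite mxE.
rewrite !addE.
have -> : (y *m b^T *m x^T) 0 0 = x 0 0 * (b *m y^T) 0 0.
  rewrite [LHS](_ : _ = (y *m b^T) 0 0 * x 0 0); last by rewrite [LHS]mxE big_ord1 [x^T _ _]mxE.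
  rewrite mulrC; congr (_ * _).
  exact: rdotC.
have -> : (x *m a *m x^T) 0 0 = a 0 0 * x 0 0 ^+ 2.
  by rewrite mxE big_ord1 !mxE big_ord1; ring.
have -> : (x *m b *m y^T) 0 0 = x 0 0 * (b *m y^T) 0 0.
  by rewrite -mulmxA mxE big_ord1.
ring.
Qed.

(** Induction on the Schur complement of the first diagonal entry; when that
    entry is zero, positivity forces the rest of its row to vanish. *)
Lemma cholesky n (S : 'M[R]_n) : covariance_mx S -> exists L : 'M[R]_n, S = L^T *m L.
Proof.
elim: n S => [|n IH] S [Ssym Spos].
  by exists 0; apply/matrixP => -[].
rewrite -[n.+1]/(1 + n)%N in S Ssym Spos *.
pose a := ulsubmx S; pose b := ursubmx S; pose D := drsubmx S.
have SE : S = block_mx a b b^T D.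
  by rewrite -[LHS]submxK -/a -/b -/D; congr block_mx; rewrite /b trmx_ursub Ssym.
have q x y := Spos (row_mx x y).
move: q; rewrite SE => q.
pose a0 := a 0 0.
have a0_ge0 : 0 <= a0.
  have := q 1 0; rewrite block_quad trmx0 !mulmx0 !mxE eqxx /= mulr0 !addr0.
  by rewrite expr1n mulr1 /a0 /a !mxE.
have b0 : a0 = 0 -> b = 0.
  move=> a00; apply/rowP => j; rewrite [RHS]mxE; apply/eqP/negPn/negP => bj.
  pose y : 'rV[R]_n := delta_mx 0 j.
  have by_ : (b *m y^T) 0 0 = b 0 j.
    exact: (rdot_delta j b).
  (* this test vector would give the form the value -1 *)
  have := q (const_mx (- ((y *m D *m y^T) 0 0 + 1) / (2 * b 0 j))) y.
  rewrite block_quad -/a0 a00 mul0r add0r by_ mxE.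
  have -> : 2 * (- ((y *m D *m y^T) 0 0 + 1) / (2 * b 0 j)) * b 0 j +
    (y *m D *m y^T) 0 0 = -1 by field.
  by rewrite lerNr oppr0 ler10.
have [L' L'E] : exists L' : 'M[R]_n, D - a0^-1 *: (b^T *m b) = L'^T *m L'.
  apply: IH; split.
    rewrite linearB linearZ /= trmx_mul trmxK; congr (_ - _).
    by rewrite /D trmx_drsub Ssym.
  move=> y; have := q (const_mx (- a0^-1 * (b *m y^T) 0 0)) y.
  rewrite block_quad -/a0 mxE => /le_trans; apply.
  have -> : (y *m (D - a0^-1 *: (b^T *m b)) *m y^T) 0 0 =
      (y *m D *m y^T) 0 0 - a0^-1 * ((b *m y^T) 0 0) ^+ 2.
    have subE (A B : 'M[R]_1) : (A - B) 0 0 = A 0 0 - B 0 0 by rewrite !mxE.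
    have scE u (A : 'M[R]_1) : (u *: A) 0 0 = u * A 0 0 by rewrite mxE.
    rewrite mulmxBr mulmxBl -scalemxAr -scalemxAl subE scE; congr (_ - _ * _).
    rewrite -!mulmxA mulmxA [LHS]mxE big_ord1 expr2; congr (_ * _).
    exact: rdotC.
  rewrite le_eqVlt; apply/orP; left; apply/eqP.
  have [a00|an0] := eqVneq a0 0; last by field.
  by rewrite a00 invr0; ring.
pose c := Num.sqrt a0.
have cc : c * c = a0 by rewrite -expr2 sqr_sqrtr.
exists (block_mx c%:M (c^-1 *: b) 0 L').
rewrite tr_block_mx mulmx_block !trmx0 !mul0mx !mulmx0 !addr0.
rewrite tr_scalar_mx -scalar_mxM cc; congr block_mx.
- by rewrite [LHS]mx11_scalar.
- rewrite mul_scalar_mx scalerA.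
  have [c0|cn0] := eqVneq c 0; last by rewrite divff ?scale1r.
  by rewrite b0 ?scaler0// -cc c0 mulr0.
- rewrite mul_mx_scalar linearZ/= scalerA.
  have [c0|cn0] := eqVneq c 0; last by rewrite divff ?scale1r.
  by rewrite b0 ?trmx0 ?scaler0// -cc c0 mulr0.
- rewrite -L'E [(c^-1 *: b)^T]linearZ /= -scalemxAl -scalemxAr scalerA -invfM cc.
  by rewrite addrC subrK.
Qed.
End Cholesky.

Section GaussianVector.
Variable R : realType.

(** One more coordinate is an independent standard normal variable on a product
    space. *)
Lemma standard_gaussian_vector n : exists (d : measure_display)
    (T : measurableType d) (P : probability T R) (G : T -> 'rV[R]_n),
  (forall j, measurable_fun setT (fun w => G w 0 j)) /\
  forall t a, mean P (fun w => cos (rdot t (G w) + a)) =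
    expR (- (rdot t t / 2)) * cos a.
Proof.
elim: n => [|n [d [T [P [G [mG GE]]]]]].
  exists _, (measurableTypeR R), (normal_prob 0 1), (fun=> 0); split=> [[]//|t a].
  rewrite [rdot t t]rdotE big_ord0 mul0r oppr0 expR0 mul1r -[RHS](mean_cst (normal_prob 0 1)).
  by congr mean; apply/funext => w; rewrite rdotE big_ord0 add0r.
pose Q := @normal_prob R 0 1.
pose G' (z : T * measurableTypeR R) : 'rV[R]_n.+1 :=
  \row_j (if unlift ord0 j is Some i then G z.1 0 i else z.2).
have mG' j : measurable_fun setT (fun z => G' z 0 j).
  under eq_fun do rewrite mxE.
  case: unliftP => [i|] _; last exact: measurable_snd.
  exact: (measurableT_comp (mG i) measurable_fst).
exists _, (T * measurableTypeR R)%type, (P \x Q)%E, G'; split=> // t a.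
pose t' : 'rV[R]_n := \row_i t 0 (lift ord0 i).
have dG z : rdot t (G' z) + a = t 0 ord0 * z.2 + (rdot t' (G z.1) + a).
  rewrite rdotE big_ord_recl mxE unlift_none addrA mulrC; congr (_ + _ + _).
  by rewrite rdotE; apply: eq_bigr => i _; rewrite !mxE liftK.
have bG : bounded_mfun (fun z => cos (rdot t (G' z) + a)).
  by have := bounded_mfun_trig mG' (trig_cos t a).
transitivity (mean P (fun w => expR (- (t 0 ord0 ^+ 2 / 2)) * cos (rdot t' (G w) + a))).
  rewrite /mean /Rintegral.
  rewrite -(integral12_prod_meas1 (bounded_mfun_integrable (P \x Q)%E bG)).
  congr fine; apply: eq_integral => w _; rewrite /fubini_F /=.
  under eq_integral do rewrite dG /=.
  have bc : bounded_mfun (fun x : measurableTypeR R => cos (t 0 ord0 * x + (rdot t' (G w) + a))).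
    exact: bounded_mfun_cos_aff.
  rewrite -[LHS]fineK; last by apply: integrable_fin_num => //; exact: bounded_mfun_integrable.
  congr (_%:E); rewrite -[LHS]/(mean Q _).
  by rewrite normal_cos_integral// expr1n mulr1.
have b' : bounded_mfun (fun w => cos (rdot t' (G w) + a)).
  by have := bounded_mfun_trig mG (trig_cos t' a).
rewrite meanZ//.
rewrite GE mulrA -expRD; congr (expR _ * _).
rewrite [rdot t t]rdotE big_ord_recl -/(ord0) (_ : \sum_(i < n) _ = rdot t' t').
  by field.
by rewrite rdotE; apply: eq_bigr => i _; rewrite !mxE.
Qed.

(** If [S = L^T L] and [G] is standard, then [G L] has the covariance [S]; the law
    of each linear functional is recognised by its characteristic function, the
    Dirac mass included. *)
Lemma gaussian_vector_exists k (S : 'M[R]_k) : covariance_mx S ->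
  exists (d : measure_display) (T : measurableType d) (P : probability T R)
    (G : T -> 'rV[R]_k), gaussian_vector S P G /\
  forall t a, mean P (fun w => cos (rdot t (G w) + a)) =
    expR (- ((t *m S *m t^T) 0 0 / 2)) * cos a.
Proof.
move=> cS; have [L SE] := cholesky cS.
have [d [T [P [G [mG GE]]]]] := standard_gaussian_vector k.
have dL t w : rdot t (G w *m L) = rdot (t *m L^T) (G w).
  by rewrite /rdot trmx_mul trmxK mulmxA.
have tSt t : (t *m S *m t^T) 0 0 = rdot (t *m L^T) (t *m L^T).
  by rewrite /rdot SE trmx_mul trmxK !mulmxA.
have mL j : measurable_fun setT (fun w => (G w *m L) 0 j).
  have := measurable_rdot mG (delta_mx 0 j *m L^T).
  by under eq_fun do rewrite -dL rdot_delta.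
have cE t a : mean P (fun w => cos (rdot t (G w *m L) + a)) =
    expR (- ((t *m S *m t^T) 0 0 / 2)) * cos a.
  by rewrite tSt -GE; congr mean; apply/funext => w; rewrite dL.
exists d, T, P, (fun w => G w *m L); split=> //; split=> // t B mB.
set v := (t *m S *m t^T) 0 0.
have v0 : 0 <= v by exact: cS.2.
have my := measurable_rdot mL t.
have yE s a : mean P (fun w => cos (s * rdot t (G w *m L) + a)) =
    expR (- (s ^+ 2 * v / 2)) * cos a.
  rewrite (_ : s ^+ 2 * v = ((s *: t) *m S *m (s *: t)^T) 0 0).
    by rewrite -cE; congr mean; apply/funext => w; rewrite rdotZl.
  have scE u (A : 'M[R]_1) : (u *: A) 0 0 = u * A 0 0 by rewrite mxE.
  by rewrite linearZ/= -scalemxAr -!scalemxAl !scE mulrA -expr2.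
rewrite /normal_law; case: eqVneq => [v00|vn0].
  rewrite (@law_of_cos R _ _ P (fun w => rdot t (G w *m L)) _ _ P (fun=> 0) my)//.
  - rewrite /dirac indicE; case: (boolP (0 \in B)) => [|] hB.
      rewrite (_ : _ @^-1` B = setT) ?probability_setT//.
      by apply/seteqP; split=> // w _ /=; rewrite inE in hB.
    rewrite (_ : _ @^-1` B = set0) ?measure0//.
    by apply/seteqP; split=> // w /=; move: hB; rewrite notin_setE.
  - move=> s a; rewrite yE v00 mulr0 mul0r oppr0 expR0 mul1r -[LHS](mean_cst P).
    by congr mean; apply/funext => w; rewrite mulr0 add0r.
have vp : 0 < v by rewrite lt_neqAle eq_sym vn0.
have sv : 0 < Num.sqrt v by rewrite sqrtr_gt0.
rewrite (@law_of_cos R _ _ P (fun w => rdot t (G w *m L)) _ (measurableTypeR R)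
  (normal_prob 0 (Num.sqrt v)) id my)//.
move=> s a; rewrite yE normal_cos_integral// sqr_sqrtr//.
Qed.
End GaussianVector.

(** * The law of the colour counts *)

Section CountMean.
Context (R : realType) (k : nat) (theta : R) (A : 'M[R]_k) (u0 : 'rV[R]_k).
Local Notation V := 'rV[R]_k.
Local Notation c := (k%:R * theta - 1).

(** Probability of drawing [j] at time [n] when the counts are [x]: the
    configuration is then [u0 + x *m A]. *)
Definition draw_prob (n : nat) (x : V) (j : 'I_k) : R :=
  c^-1 * (theta - (u0 + x *m A) 0 j / n.+1%:R).

(** The law of the counts is finitely supported, and its expectation functional
    is computed by conditioning on the last draw. *)
Fixpoint count_mean (n : nat) (g : V -> R) : R :=
  if n is m.+1 then
    count_mean m (fun x => \sum_j draw_prob m x j * g (x + delta_mx 0 j))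
  else g 0.

(** An invariant of the counts under which [draw_prob] is a probability. *)
Definition reachable (n : nat) (x : V) : Prop :=
  (forall j, 0 <= x 0 j) /\ \sum_j x 0 j = n%:R.

Lemma count_mean_lin n a g h :
  count_mean n (fun x => a * g x + h x) = a * count_mean n g + count_mean n h.
Proof.
elim: n g h => [//|n IH] g h /=; rewrite -IH; congr (count_mean n _).
apply/funext => x; rewrite mulr_sumr -big_split/=; apply: eq_bigr => j _; ring.
Qed.

Lemma count_mean0 n : count_mean n (fun=> 0) = 0.
Proof.
elim: n => [//|n IH] /=; rewrite -[RHS]IH; congr (count_mean n _).
by apply/funext => x; rewrite big1// => j _; rewrite mulr0.
Qed.

Lemma count_meanD n g h :
  count_mean n (fun x => g x + h x) = count_mean n g + count_mean n h.
Proof.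
rewrite -[in RHS](mul1r (count_mean n g)) -count_mean_lin; congr (count_mean n _).
by apply/funext => x; rewrite mul1r.
Qed.

Lemma count_meanZ n a g : count_mean n (fun x => a * g x) = a * count_mean n g.
Proof.
rewrite -[RHS]addr0 -(count_mean0 n) -count_mean_lin; congr (count_mean n _).
by apply/funext => x; rewrite addr0.
Qed.

Lemma count_meanB n g h :
  count_mean n (fun x => g x - h x) = count_mean n g - count_mean n h.
Proof.
rewrite addrC -mulN1r -count_mean_lin; congr (count_mean n _).
by apply/funext => x; rewrite mulN1r addrC.
Qed.

Lemma count_mean_sum n (I : Type) (s : seq I) (g : I -> V -> R) :
  count_mean n (fun x => \sum_(i <- s) g i x) = \sum_(i <- s) count_mean n (g i).
Proof.
elim: s => [|i s IH].
  rewrite [RHS]big_nil -[RHS](count_mean0 n); congr (count_mean n _).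
  by apply/funext => x; rewrite big_nil.
rewrite big_cons -IH -count_meanD; congr (count_mean n _).
by apply/funext => x; rewrite big_cons.
Qed.

Hypotheses (hk : (2 <= k)%N) (htheta : 1 <= theta).
Hypotheses (hA : stochastic_mx A) (hu0 : probability_row u0).

Lemma scale_gt0 : 0 < c.
Proof.
have : (2 : R) <= k%:R by rewrite ler_nat.
move=> h; have : 2 * 1 <= k%:R * theta by apply: ler_pM.
lra.
Qed.

Lemma stochastic_ge0 i j : 0 <= A i j.
Proof. by have [h _] := hA i; have := h j; rewrite mxE. Qed.

Lemma stochastic_row_sum i : \sum_j A i j = 1.
Proof. by have [_ h] := hA i; rewrite -[RHS]h; apply: eq_bigr => j _; rewrite mxE. Qed.

Lemma sum_mul_stochastic (x : V) : \sum_j (x *m A) 0 j = \sum_j x 0 j.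
Proof.
under eq_bigr do rewrite mxE.
rewrite exchange_big/=; apply: eq_bigr => i _.
by rewrite -mulr_sumr stochastic_row_sum mulr1.
Qed.

Lemma reachable_config n x j : reachable n x ->
  0 <= (u0 + x *m A) 0 j <= n.+1%:R.
Proof.
move=> [x0 xs].
have cge i : 0 <= (u0 + x *m A) 0 i.
  rewrite mxE addr_ge0 ?hu0.1// mxE sumr_ge0// => l _.
  by rewrite mulr_ge0// stochastic_ge0.
rewrite cge/=.
have <- : \sum_i (u0 + x *m A) 0 i = n.+1%:R.
  under eq_bigr do rewrite mxE.
  by rewrite big_split/= sum_mul_stochastic xs hu0.2 -nat1r.
by rewrite (bigD1 j)//= lerDl sumr_ge0.
Qed.

Lemma draw_prob_ge0 n x j : reachable n x -> 0 <= draw_prob n x j.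
Proof.
move=> /reachable_config -/(_ j) /andP[_ h].
rewrite mulr_ge0// ?invr_ge0 ?(ltW scale_gt0)// subr_ge0 (le_trans _ htheta)//.
by rewrite ler_pdivrMr ?ltr0n// mul1r.
Qed.

Lemma draw_prob_sum n x : reachable n x -> \sum_j draw_prob n x j = 1.
Proof.
move=> [_ xs]; rewrite -mulr_sumr sumrB -mulr_suml.
rewrite sumr_const card_ord -[theta *+ k]mulr_natl.
have -> : \sum_i (u0 + x *m A) 0 i = n.+1%:R.
  under eq_bigr do rewrite mxE.
  by rewrite big_split/= sum_mul_stochastic xs hu0.2 -nat1r.
by rewrite divff ?pnatr_eq0// mulVf// gt_eqF// scale_gt0.
Qed.

Lemma reachable0 : reachable 0 0.
Proof. by split=> [j|]; rewrite ?mxE// big1// => j _; rewrite mxE. Qed.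

Lemma reachableS n x j : reachable n x -> reachable n.+1 (x + delta_mx 0 j).
Proof.
move=> [x0 xs]; split=> [i|]; first by rewrite !mxE addr_ge0.
under eq_bigr do rewrite mxE.
rewrite big_split/= xs (bigD1 j)//= mxE !eqxx/= big1 ?addr0 ?natr1// => i ij.
by rewrite mxE (negbTE ij) andbF.
Qed.

Lemma count_mean_le n g h : (forall x, reachable n x -> g x <= h x) ->
  count_mean n g <= count_mean n h.
Proof.
elim: n g h => [|n IH] g h gh /=; first by apply: gh; exact: reachable0.
apply: IH => x rx; apply: ler_sum => j _; rewrite ler_wpM2l ?draw_prob_ge0//.
by apply: gh; exact: reachableS.
Qed.

Lemma count_mean_eq n g h : (forall x, reachable n x -> g x = h x) ->
  count_mean n g = count_mean n h.
Proof.
by move=> gh; apply/eqP; rewrite eq_le !count_mean_le// => x /gh ->.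
Qed.

Lemma count_mean_cst n a : count_mean n (fun=> a) = a.
Proof.
elim: n => [//|n IH] /=; rewrite -[RHS]IH; apply: count_mean_eq => x rx.
by rewrite -mulr_suml draw_prob_sum// mul1r.
Qed.

Lemma count_mean_dist n g h e : (forall x, reachable n x -> `|g x - h x| <= e x) ->
  `|count_mean n g - count_mean n h| <= count_mean n e.
Proof.
move=> H; rewrite -count_meanB ler_norml; apply/andP; split.
  rewrite -mulN1r -count_meanZ; apply: count_mean_le => x rx.
  by rewrite mulN1r; have := H x rx; rewrite ler_norml => /andP[].
by apply: count_mean_le => x rx; have := H x rx; rewrite ler_norml => /andP[].
Qed.

Section UrnLaw.
Context (d : measure_display) (T : measurableType d) (P : probability T R)
  (U : nat -> T -> V) (Z : nat -> T -> 'I_k).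
Hypothesis urn : negative_urn theta A u0 P U Z.
Local Notation N := (colour_count R Z).

Lemma colour_countS n w : N n.+1 w = N n w + delta_mx 0 (Z n w).
Proof.
apply/rowP => j; rewrite !mxE big_ord_recr/=; congr (_ + _).
by rewrite eq_sym.
Qed.

Lemma colour_count0 w : N 0 w = 0.
Proof. by apply/rowP => j; rewrite !mxE big_ord0. Qed.

Lemma config_count n w : U n w = u0 + N n w *m A.
Proof.
elim: n => [|n IH]; first by rewrite (urn_init urn) colour_count0 mul0mx addr0.
by rewrite (urn_step urn) IH colour_countS mulmxDl addrA.
Qed.

(* The counts at time n are constant on each path event, and path events belong
   to the history, so the conditional probabilities may be integrated on them *)
Let path n (z : {ffun 'I_n -> 'I_k}) : set T := [set w | forall i : 'I_n, Z i w = z i].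

Let path_bigI n (z : {ffun 'I_n -> 'I_k}) :
  path z = \big[setI/setT]_(i < n) [set w | Z i w = z i].
Proof.
rewrite -bigcap_seq; apply/seteqP; split => w /=.
  by move=> h i _; exact: h.
by move=> h i; apply: (h i); rewrite /= mem_index_enum.
Qed.

Let measurable_path n (z : {ffun 'I_n -> 'I_k}) : measurable (path z).
Proof.
rewrite path_bigI; apply: bigsetI_measurable => i _.
exact: urn_measurable_colour urn _ _.
Qed.

Let history_path n (z : {ffun 'I_n -> 'I_k}) : urn_history U Z n (path z).
Proof.
rewrite path_bigI /urn_history; set G := (X in <<s X >>).
apply: (@bigsetI_measurable _ (g_sigma_algebraType G)) => i _.
by apply: sub_sigma_algebra; right; exists (i : nat), (z i); split.
Qed.

Let path_count n (z : {ffun 'I_n -> 'I_k}) : V :=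
  \row_j \sum_(i < n) (z i == j)%:R.

Let path_countE n (z : {ffun 'I_n -> 'I_k}) w : path z w -> N n w = path_count z.
Proof.
by move=> zw; apply/rowP => j; rewrite !mxE; apply: eq_bigr => i _; rewrite zw.
Qed.

Let count_decomp n (h : V -> R) w :
  h (N n w) = \sum_z h (@path_count n z) * \1_(path z) w.
Proof.
pose z0 : {ffun 'I_n -> 'I_k} := [ffun i => Z (nat_of_ord i) w].
have z0w : path z0 w by move=> i; rewrite ffunE.
rewrite (bigD1 z0)//= indicE mem_set// mulr1 -(path_countE z0w) big1 ?addr0// => z zz0.
rewrite indicE memNset ?mulr0// => zw; move/eqP: zz0; apply.
by apply/ffunP => i; rewrite ffunE zw.
Qed.

Let bounded_indic (B : set T) : measurable B -> bounded_mfun (\1_B : T -> R).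
Proof.
move=> mB; split; first exact: measurable_indic.
by exists 1 => w; rewrite indicE; case: (_ \in _); rewrite ?normr1 ?normr0.
Qed.

Let mean_indic (B : set T) : measurable B -> mean P (\1_B : T -> R) = fine (P B).
Proof. by move=> mB; rewrite /mean /Rintegral integral_indic// setIT. Qed.

Lemma bounded_mfun_count n (h : V -> R) : bounded_mfun (fun w => h (N n w)).
Proof.
under eq_fun do rewrite count_decomp.
apply: bounded_mfun_sum => z; apply: bounded_mfunZ; apply: bounded_indic.
exact: measurable_path.
Qed.

Let mean_count_draw n (h : V -> R) j :
  mean P (fun w => \1_[set w | Z n w = j] w * h (N n w)) =
  mean P (fun w => draw_prob n (N n w) j * h (N n w)).
Proof.
have mZ := urn_measurable_colour urn n j.
have [_ draw] := urn_draw urn n j.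
transitivity (\sum_z h (@path_count n z) * fine (P ([set w | Z n w = j] `&` path z))).
  transitivity (mean P (fun w => \sum_z h (@path_count n z) *
      \1_([set w | Z n w = j] `&` path z) w)).
    congr mean; apply/funext => w; rewrite count_decomp mulr_sumr.
    by apply: eq_bigr => z _; rewrite indicI mulrCA.
  rewrite mean_sum; last first.
    by move=> z; apply: bounded_mfunZ; apply: bounded_indic; exact: measurableI.
  apply: eq_bigr => z _; rewrite meanZ; last by apply: bounded_indic; exact: measurableI.
  by rewrite mean_indic//; exact: measurableI.
have -> : (fun w => draw_prob n (N n w) j * h (N n w)) = (fun w =>
    \sum_z draw_prob n (@path_count n z) j * h (@path_count n z) * \1_(path z) w).
  by apply/funext => w; rewrite (count_decomp _ (fun x => draw_prob n x j * h x)).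
rewrite mean_sum; last by move=> z; apply: bounded_mfunZ; exact: bounded_indic.
apply: eq_bigr => z _; rewrite meanZ; last exact: bounded_indic.
rewrite mean_indic// draw; last exact: history_path.
rewrite (eq_integral (fun=> (draw_prob n (path_count z) j)%:E)); last first.
  move=> w; rewrite inE => zw.
  by rewrite config_count (path_countE zw).
rewrite integral_cst// fineM// ?fin_num_measure// /=; ring.
Qed.

(** Every urn process with these parameters has the same law of counts, given by
    the recursion; all limits below are limits of [count_mean]. *)
Lemma mean_count n (g : V -> R) : mean P (fun w => g (N n w)) = count_mean n g.
Proof.
elim: n g => [|n IH] g /=.
  rewrite -[RHS](mean_cst P); congr mean; apply/funext => w.
  by rewrite colour_count0.
rewrite -IH.
transitivity (mean P (fun w => \sum_j \1_[set w | Z n w = j] w * g (N n w + delta_mx 0 j))).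
  congr mean; apply/funext => w; rewrite (bigD1 (Z n w))//= indicE mem_set//.
  rewrite mul1r colour_countS big1 ?addr0// => j jZ.
  rewrite indicE memNset ?mul0r// => /= e; by rewrite e eqxx in jZ.
have b1 j : bounded_mfun (fun w => draw_prob n (N n w) j * g (N n w + delta_mx 0 j)).
  exact: (bounded_mfun_count n (fun x => draw_prob n x j * g (x + delta_mx 0 j))).
rewrite !mean_sum//; last first.
  move=> j; have [m1 [M1 h1]] := bounded_indic (urn_measurable_colour urn n j).
  have [m2 [M2 h2]] := bounded_mfun_count n (fun x => g (x + delta_mx 0 j)).
  split; first exact: measurable_funM.
  by exists (M1 * M2) => w; rewrite normrM ler_pM.
apply: eq_bigr => j _.
exact: (mean_count_draw n (fun x => g (x + delta_mx 0 j)) j).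
Qed.

End UrnLaw.
End CountMean.

(** * Martingale decomposition and replacement argument *)

Section FiniteLaw.
Context (R : realType) (k : nat).
Implicit Types p q f : 'I_k -> R.

Definition fmean p f : R := \sum_j p j * f j.
Definition fvar p f : R := \sum_j p j * f j ^+ 2 - fmean p f ^+ 2.

Lemma fmean_bound p f M : (forall j, 0 <= p j) -> \sum_j p j = 1 ->
  (forall j, `|f j| <= M) -> `|fmean p f| <= M.
Proof.
move=> p0 p1 fM; rewrite (le_trans (ler_norm_sum _ _ _))//.
rewrite -[leRHS]mul1r -[X in _ <= X * _]p1 mulr_suml; apply: ler_sum => j _.
by rewrite normrM (ger0_norm (p0 j)) ler_wpM2l.
Qed.

Lemma fvarE p f : \sum_j p j = 1 ->
  fvar p f = \sum_j p j * (f j - fmean p f) ^+ 2.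
Proof.
move=> p1; rewrite /fvar; set b := fmean p f.
rewrite [RHS](eq_bigr (fun j => p j * f j ^+ 2 - (2 * b) * (p j * f j) + b ^+ 2 * p j)).
  rewrite big_split sumrB /= -!mulr_sumr p1 -/(fmean p f) -/b; ring.
by move=> j _; ring.
Qed.

Lemma fvar_ge0 p f : (forall j, 0 <= p j) -> \sum_j p j = 1 -> 0 <= fvar p f.
Proof.
by move=> p0 p1; rewrite fvarE// sumr_ge0// => j _; rewrite mulr_ge0// sqr_ge0.
Qed.

Lemma fvar_le p f M : (forall j, 0 <= p j) -> \sum_j p j = 1 ->
  (forall j, `|f j| <= M) -> fvar p f <= M ^+ 2.
Proof.
move=> p0 p1 fM; rewrite lerBlDr (@le_trans _ _ (M ^+ 2))//; last first.
  by rewrite lerDl sqr_ge0.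
rewrite -[leRHS]mul1r -[X in _ <= X * _]p1 mulr_suml; apply: ler_sum => j _.
rewrite ler_wpM2l// -[leLHS]real_normK ?num_real//.
by rewrite ler_pXn2r ?nnegrE// (le_trans _ (fM j)).
Qed.

Lemma fvar_dist p q f M : (forall j, 0 <= p j) -> \sum_j p j = 1 ->
  (forall j, 0 <= q j) -> \sum_j q j = 1 -> (forall j, `|f j| <= M) -> 0 <= M ->
  `|fvar p f - fvar q f| <= 3 * M ^+ 2 * \sum_j `|p j - q j|.
Proof.
move=> p0 p1 q0 q1 fM M0.
have bp := fmean_bound p0 p1 fM; have bq := fmean_bound q0 q1 fM.
have d1 : `|fmean p f - fmean q f| <= M * \sum_j `|p j - q j|.
  rewrite /fmean -sumrB mulr_sumr (le_trans (ler_norm_sum _ _ _))//.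
  by apply: ler_sum => j _; rewrite -mulrBl normrM mulrC ler_wpM2r.
have d2 : `|\sum_j p j * f j ^+ 2 - \sum_j q j * f j ^+ 2| <= M ^+ 2 * \sum_j `|p j - q j|.
  rewrite -sumrB mulr_sumr (le_trans (ler_norm_sum _ _ _))//.
  apply: ler_sum => j _; rewrite -mulrBl normrM mulrC ler_wpM2r// normrX.
  by rewrite ler_pXn2r ?nnegrE.
have -> : fvar p f - fvar q f = (\sum_j p j * f j ^+ 2 - \sum_j q j * f j ^+ 2) -
    (fmean p f - fmean q f) * (fmean p f + fmean q f) by rewrite /fvar; ring.
rewrite (le_trans (ler_normB _ _))// normrM.
have d3 : `|fmean p f + fmean q f| <= 2 * M.
  by rewrite (le_trans (ler_normD _ _))// mulr2n mulrDl mul1r lerD.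
have := ler_pM (normr_ge0 _) (normr_ge0 _) d1 d3.
move: d2; set S := \sum_j _; nra.
Qed.

Lemma sqr_step p f u : \sum_j p j = 1 ->
  \sum_j p j * (u + (f j - fmean p f)) ^+ 2 = u ^+ 2 + fvar p f.
Proof.
move=> p1; rewrite fvarE//; set b := fmean p f.
rewrite (eq_bigr (fun j => u ^+ 2 * p j + 2 * u * (p j * f j - b * p j) +
  p j * (f j - b) ^+ 2)); last by move=> j _; ring.
rewrite !big_split/= -!mulr_sumr sumrB -mulr_sumr p1 -/(fmean p f) -/b; ring.
Qed.

(** One step of Lindeberg's replacement for characteristic functions: a centred
    bounded increment multiplies the characteristic function by that of a
    Gaussian of the same variance, up to third order. *)
Lemma cos_step p f u M delta : (forall j, 0 <= p j) -> \sum_j p j = 1 ->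
  (forall j, `|f j| <= M) -> 0 <= M -> 0 <= delta ->
  `|\sum_j p j * cos (u + (f j - fmean p f)) - cos u * expR (- (delta / 2))| <=
  `|fvar p f - delta| / 2 + 16 * M ^+ 3 + delta ^+ 2 / 4.
Proof.
move=> p0 p1 fM M0 delta0; set b := fmean p f.
have bM := fmean_bound p0 p1 fM.
have yM j : `|f j - b| <= 2 * M.
  by rewrite (le_trans (ler_normB _ _))// mulr2n mulrDl mul1r lerD.
pose main := \sum_j p j * (cos u - sin u * (f j - b) - cos u * ((f j - b) ^+ 2 / 2)).
have mainE : main = cos u * (1 - fvar p f / 2).
  rewrite fvarE// /main.
  rewrite (eq_bigr (fun j => cos u * p j - sin u * (p j * f j - b * p j) -
    cos u / 2 * (p j * (f j - b) ^+ 2))); last by move=> j _; field.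
  rewrite !sumrB /= -!mulr_sumr sumrB -mulr_sumr p1 -/(fmean p f) -/b; by field.
have e1 : `|\sum_j p j * cos (u + (f j - b)) - main| <= 16 * M ^+ 3.
  rewrite /main -sumrB (le_trans (ler_norm_sum _ _ _))//.
  rewrite -[leRHS]mul1r -[X in _ <= X * _]p1 mulr_suml; apply: ler_sum => j _.
  rewrite -mulrBr normrM (ger0_norm (p0 j)) ler_wpM2l//.
  apply: (le_trans (cosD_taylor u (f j - b))).
  rewrite (_ : 16 * M ^+ 3 = 2 * (2 * M) ^+ 3); last by ring.
  by rewrite ler_pM2l// ler_pXn2r ?nnegrE ?mulr_ge0.
have e2 : `|main - cos u * expR (- (delta / 2))| <= `|fvar p f - delta| / 2 + delta ^+ 2 / 4.
  rewrite mainE -mulrBr normrM -[leRHS]mul1r ler_pM//.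
    by rewrite ler_norml cos_geN1 cos_le1.
  have d20 : 0 <= delta / 2 by rewrite divr_ge0.
  have := expRN_taylor d20.
  rewrite (_ : (delta / 2) ^+ 2 = delta ^+ 2 / 4); last by field.
  move=> h.
  have -> : 1 - fvar p f / 2 - expR (- (delta / 2)) =
    - ((fvar p f - delta) / 2) - (expR (- (delta / 2)) - (1 - delta / 2)) by field.
  by rewrite (le_trans (ler_normB _ _))// lerD// normrN normrM [X in _ * X <= _]ger0_norm.
have := ler_normD (\sum_j p j * cos (u + (f j - b)) - main)
  (main - cos u * expR (- (delta / 2))).
by rewrite subrKA => h; lra.
Qed.
End FiniteLaw.

Section UrnMartingale.
Context (R : realType) (k : nat) (theta : R) (A B : 'M[R]_k) (mu u0 : 'rV[R]_k).
Local Notation V := 'rV[R]_k.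
Local Notation c := (k%:R * theta - 1).
Hypotheses (hk : (2 <= k)%N) (htheta : 1 <= theta).
Hypotheses (hA : stochastic_mx A) (hu0 : probability_row u0).
Hypothesis hmu : (theta *: const_mx 1 - mu) *m A = c *: mu.
Hypothesis hB : forall x : V, \sum_j x 0 j = 0 -> x *m B = - c^-1 *: (x *m A).

Definition limit_draw : V := c^-1 *: (theta *: const_mx 1 - mu).
Definition centred (n : nat) (x : V) : V := x - n%:R *: limit_draw.
(** Contribution of the initial configuration to the draw probabilities, once
    multiplied by [1 / (n + 1)]. *)
Definition drift : V := - c^-1 *: (u0 - mu).
Definition growth (j : nat) : 'M[R]_k := 1%:M + j%:R^-1 *: B.

Let cgt0 := scale_gt0 hk htheta.
Local Notation draw := (draw_prob theta A u0).
Local Notation cmean := (count_mean theta A u0).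

Lemma sum_mu : \sum_j mu 0 j = 1.
Proof.
have e1 : \sum_j ((theta *: const_mx 1 - mu) *m A) 0 j = k%:R * theta - \sum_j mu 0 j.
  rewrite sum_mul_stochastic//; under eq_bigr do rewrite !mxE mulr1.
  by rewrite sumrB sumr_const card_ord -[theta *+ k]mulr_natl.
have e2 : \sum_j (c *: mu) 0 j = c * \sum_j mu 0 j.
  by rewrite mulr_sumr; apply: eq_bigr => j _; rewrite mxE.
have : k%:R * theta * (1 - \sum_j mu 0 j) = 0.
  move: e1; rewrite hmu e2 => e1.
  rewrite mulrBr mulr1; apply/eqP; rewrite subr_eq0; apply/eqP.
  by move: e1; rewrite mulrBl mul1r; lra.
move/eqP; rewrite mulf_eq0 => /orP[/eqP h|]; last by rewrite subr_eq0 eq_sym => /eqP.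
by move: cgt0; rewrite h; lra.
Qed.

Lemma limit_draw_sum : \sum_j limit_draw 0 j = 1.
Proof.
under eq_bigr do rewrite !mxE mulr1.
rewrite -mulr_sumr sumrB sum_mu sumr_const card_ord -[theta *+ k]mulr_natl.
by rewrite mulVf// gt_eqF.
Qed.

Lemma limit_draw_mul : limit_draw *m A = mu.
Proof. by rewrite /limit_draw -scalemxAl hmu scalerA mulVf ?scale1r// gt_eqF. Qed.

Lemma centred_sum n x : reachable n x -> \sum_j centred n x 0 j = 0.
Proof.
move=> [_ xs].
rewrite (eq_bigr (fun j => x 0 j - n%:R * limit_draw 0 j)).
  by rewrite sumrB -mulr_sumr xs limit_draw_sum mulr1 subrr.
by move=> j _; rewrite !mxE.
Qed.

(** The draw probabilities are affine in the deviation, with a slope of order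
    [1 / n]: this is what makes the reinforcement linear. *)
Lemma draw_centred n x : (\row_j draw n x j : V) =
  limit_draw + n.+1%:R^-1 *: drift - (c * n.+1%:R)^-1 *: (centred n x *m A).
Proof.
apply/rowP => j.
have -> : centred n x *m A = x *m A - n%:R *: mu.
  by rewrite mulmxBl -scalemxAl limit_draw_mul.
rewrite /draw_prob /limit_draw /drift !mxE; set s := \sum_ _ _.
rewrite -(natr1 n); field.
by rewrite natr1 pnatr_eq0 /= (gt_eqF cgt0).
Qed.

Lemma centred_step n x j : reachable n x ->
  centred n.+1 (x + delta_mx 0 j) =
  centred n x *m growth n.+1 + (delta_mx 0 j - \row_i draw n x i) + n.+1%:R^-1 *: drift.
Proof.
move=> rx; rewrite /growth mulmxDr mulmx1 -scalemxAr hB ?centred_sum//.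
rewrite draw_centred scalerA mulrN -invfM mulrC scaleNr.
rewrite /centred -(natr1 n) scalerDl scale1r.
set X := _ *: (_ *m A); set Y := _ *: drift.
rewrite !opprD !opprK; apply/rowP => i; rewrite !mxE; ring.
Qed.

Section Column.
Variables (N : nat) (tau : nat -> 'cV[R]_k) (M : nat -> R) (a : R).
Hypothesis tauE : forall m, (m < N)%N -> tau m = growth m.+1 *m tau m.+1.
Hypothesis tauM : forall m i, `|tau m i 0| <= M m.
Hypothesis M0 : forall m, 0 <= M m.

Definition remaining_drift (m : nat) : R :=
  \sum_(m <= l < N) l.+1%:R^-1 * (drift *m tau l.+1) 0 0.

(** A martingale when [x] is the vector of counts at time [m]: by [tauE] the
    column absorbs the linear part of the recursion, and the drift of the future
    steps is added in advance. *)
Definition compensated (m : nat) (x : V) : R :=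
  (centred m x *m tau m) 0 0 + remaining_drift m.

Local Notation f m := (fun j => tau m j 0).

Lemma compensated_step m x j : (m < N)%N -> reachable m x ->
  compensated m.+1 (x + delta_mx 0 j) =
  compensated m x + (f m.+1 j - fmean (draw m x) (f m.+1)).
Proof.
move=> mN rx; rewrite /compensated centred_step//.
rewrite {2}/remaining_drift (big_ltn mN) -/(remaining_drift m.+1).
rewrite (tauE mN) mulmxA; move: (centred m x) => Wm; rewrite !mulmxDl.
have addE (X Y : 'M[R]_1) : (X + Y) 0 0 = X 0 0 + Y 0 0 by rewrite mxE.
have oppE (X : 'M[R]_1) : (- X) 0 0 = - X 0 0 by rewrite mxE.
have scE u (X : 'M[R]_1) : (u *: X) 0 0 = u * X 0 0 by rewrite mxE.
rewrite mulNmx -scalemxAl !addE oppE scE.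
have -> : ((delta_mx 0 j : V) *m tau m.+1) 0 0 = f m.+1 j.
  by rewrite -rowE mxE.
have -> : ((\row_i draw m x i) *m tau m.+1) 0 0 = fmean (draw m x) (f m.+1).
  by rewrite mxE; apply: eq_bigr => i _; rewrite mxE.
ring.
Qed.

(** Martingale increments are orthogonal. *)
Lemma compensated_sqr m : (m <= N)%N ->
  cmean m (fun x => compensated m x ^+ 2) <=
  remaining_drift 0 ^+ 2 + \sum_(l < m) M l.+1 ^+ 2.
Proof.
elim: m => [_|m IH mN].
  by rewrite big_ord0 addr0 /= /compensated /centred scale0r subr0 mul0mx mxE add0r.
rewrite big_ord_recr/= addrA (le_trans _ (lerD (IH (ltnW mN)) (lexx _)))//.
rewrite -[M m.+1 ^+ 2](count_mean_cst hk htheta hA hu0 m) -count_meanD.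
apply: count_mean_le => // x rx.
have p0 j : 0 <= draw m x j by exact: draw_prob_ge0.
have p1 : \sum_j draw m x j = 1 by exact: draw_prob_sum.
under eq_bigr => j _ do rewrite compensated_step//.
by rewrite sqr_step// lerD2l fvar_le.
Qed.

Hypothesis limit_ge0 : forall j, 0 <= limit_draw 0 j.

Definition step_var (m : nat) : R := fvar (limit_draw 0) (f m).
Definition draw_error (m : nat) : R :=
  cmean m (fun x => \sum_j `|draw m x j - limit_draw 0 j|).

Definition remaining_var (m : nat) : R := \sum_(m <= l < N) step_var l.+1.

Let step_var_ge0 m : 0 <= step_var m.
Proof. by apply: fvar_ge0 => //; exact: limit_draw_sum. Qed.

(** The exponential factor stands for the steps not yet made, as if they were
    Gaussian.  It equals 1 at [m = N], and at [m = 0] nothing random is left; each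
    step in between costs one term of the sum. *)
Lemma compensated_cos m : (m <= N)%N ->
  `|cmean m (fun x => cos (compensated m x + a)) * expR (- (remaining_var m / 2)) -
    cos (remaining_drift 0 + a) * expR (- (remaining_var 0 / 2))| <=
  \sum_(l < m) (3 / 2 * M l.+1 ^+ 2 * draw_error l + 16 * M l.+1 ^+ 3 + M l.+1 ^+ 4).
Proof.
elim: m => [_|m IH mN].
  rewrite big_ord0 /= /compensated /centred scale0r subr0 mul0mx mxE add0r.
  by rewrite subrr normr0.
rewrite big_ord_recr/=.
have := IH (ltnW mN).
set S := \sum_(l < m) _; set E0 := cos (remaining_drift 0 + a) * _.
set Em := _ * expR (- (remaining_var m / 2)) => h.
set Em1 := _ * expR (- (remaining_var m.+1 / 2)).
suff h2 : `|Em1 - Em| <= 3 / 2 * M m.+1 ^+ 2 * draw_error m + 16 * M m.+1 ^+ 3 + M m.+1 ^+ 4.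
  rewrite (_ : Em1 - E0 = (Em - E0) + (Em1 - Em)); last by ring.
  by rewrite (le_trans (ler_normD _ _))// lerD.
have rv : remaining_var m = step_var m.+1 + remaining_var m.+1.
  by rewrite /remaining_var (big_ltn mN).
have -> : Em = cmean m (fun x => cos (compensated m x + a) *
    expR (- (step_var m.+1 / 2))) * expR (- (remaining_var m.+1 / 2)).
  rewrite /Em rv mulrDl opprD expRD mulrA; congr (_ * _).
  rewrite mulrC -count_meanZ; congr (count_mean _ _ _ m _).
  by apply/funext => x; rewrite mulrC.
rewrite /Em1 -mulrBl normrM -[leRHS]mulr1 ler_pM//; last first.
  rewrite (ger0_norm (expR_ge0 _)) -expR0 ler_expR oppr_le0 divr_ge0//.
  by apply: sumr_ge0 => l _.
apply: (@le_trans _ _ (cmean m (fun x =>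
  (3 / 2 * M m.+1 ^+ 2 * \sum_j `|draw m x j - limit_draw 0 j|) +
  (16 * M m.+1 ^+ 3 + M m.+1 ^+ 4)))); last first.
  by rewrite count_meanD count_meanZ count_mean_cst// addrA.
apply: count_mean_dist => // x rx.
have p0 j : 0 <= draw m x j by exact: draw_prob_ge0.
have p1 : \sum_j draw m x j = 1 by exact: draw_prob_sum.
have q1 := limit_draw_sum.
under eq_bigr => j _ do rewrite compensated_step// addrAC.
have := @cos_step R k (draw m x) (f m.+1) (compensated m x + a) (M m.+1)
  (step_var m.+1) p0 p1 (tauM m.+1) (M0 _) (step_var_ge0 _).
move=> /le_trans; apply.
have h1 := fvar_dist p0 p1 limit_ge0 q1 (tauM m.+1) (M0 _).
rewrite -/(step_var m.+1) in h1.
have h3 : step_var m.+1 ^+ 2 <= M m.+1 ^+ 4.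
  rewrite (_ : M m.+1 ^+ 4 = (M m.+1 ^+ 2) ^+ 2); last by ring.
  by rewrite ler_pXn2r ?nnegrE ?sqr_ge0//; exact: fvar_le.
have h4 : 0 <= M m.+1 ^+ 4 by rewrite exprn_ge0.
by move: h1; set S' := \sum_j _; lra.
Qed.

End Column.
End UrnMartingale.

(** * Harmonic numbers and a discrete Gronwall inequality *)

Section Harmonic.
Variable R : realType.

Definition harm (n : nat) : R := \sum_(j < n) j.+1%:R^-1.

Lemma harmS n : harm n.+1 = harm n + n.+1%:R^-1.
Proof. by rewrite /harm big_ord_recr. Qed.

Lemma harm_ge_ln n : ln (n.+1%:R) <= harm n.
Proof.
elim: n => [|n IH]; first by rewrite ln1 /harm big_ord0.
have n0 : (0 : R) < n.+1%:R by rewrite ltr0n.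
rewrite harmS (_ : n.+2%:R = n.+1%:R * (1 + n.+1%:R^-1)); last first.
  by rewrite mulrDr mulr1 divff ?gt_eqF// natr1.
have v0 : (0 : R) < n.+1%:R^-1 by rewrite invr_gt0.
rewrite lnM ?posrE// ?addr_gt0//.
by rewrite lerD// le_ln1Dx// (lt_trans _ v0)// ltrN10.
Qed.

Lemma harm_le_ln n : harm n.+1 <= 1 + ln (n.+1%:R).
Proof.
elim: n => [|n IH]; first by rewrite ln1 /harm big_ord1 invr1 addr0.
have n0 : (0 : R) < n.+1%:R by rewrite ltr0n.
have n2 : (0 : R) < n.+2%:R by rewrite ltr0n.
rewrite harmS (le_trans (lerD IH (lexx _)))// -addrA lerD2l -lerBrDl.
have h : ln (n.+1%:R) = ln (n.+2%:R) + ln (1 + - n.+2%:R^-1 : R).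
  have v1 : n.+2%:R^-1 < 1 :> R by rewrite invf_lt1// ltr1n.
  rewrite -lnM ?posrE//; last by rewrite subr_gt0.
  congr ln; rewrite mulrDr mulr1 mulrN divff ?gt_eqF//.
  by rewrite -(natr1 n.+1) addrK.
have v1 : n.+2%:R^-1 < 1 :> R by rewrite invf_lt1// ltr1n.
have := @le_ln1Dx R (- n.+2%:R^-1); rewrite h => /(_ _) h2.
have {h2} := h2 _; rewrite ltrN2 v1 => /(_ isT).
by move: (n.+2%:R^-1) => v; lra.
Qed.

Lemma harm_unbounded (K : R) : exists n0, forall n, (n0 <= n)%N -> K <= harm n.
Proof.
exists (Num.trunc (expR K)) => n nn.
rewrite (le_trans _ (harm_ge_ln n))// -[leLHS]expRK ler_ln ?posrE ?expR_gt0 ?ltr0n//.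
by rewrite ltW// (lt_le_trans (truncnS_gt _))// ler_nat.
Qed.

Lemma inv_le_eventually (e : R) : 0 < e -> exists n0, forall n, (n0 <= n)%N -> n.+1%:R^-1 <= e.
Proof.
move=> e0; exists (Num.trunc e^-1) => n nn.
rewrite invf_ple ?posrE ?ltr0n// ltW// (lt_le_trans (truncnS_gt _))// ler_nat//.
Qed.

Section Gronwall.
Variables (x e : nat -> R) (al D : R).
Hypotheses (al0 : 0 <= al) (al1 : al < 1) (x0 : forall n, 0 <= x n) (D0 : 0 <= D).
Hypothesis xe : forall n, x n.+1 <= (1 + al / n.+1%:R + D / n.+1%:R ^+ 2) * x n + e n.

(* an exponent below 1 that absorbs the term in D from some rank on *)
Let al' := (1 + al) / 2.
Let al'1 : al' < 1. Proof. by have := al1; rewrite /al'; lra. Qed.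
Let al'0 : 0 < al'. Proof. by have := al0; rewrite /al'; lra. Qed.

Let step : exists n0, forall n, (n0 <= n)%N ->
  x n.+1 <= (1 + al' / n.+1%:R) * x n + e n.
Proof.
have al1_ := al1; have al0_ := al0; have D0_ := D0.
have e0 : 0 < (1 - al) / (2 * (D + 1)) by rewrite divr_gt0//; lra.
have [n0 n0P] := inv_le_eventually e0.
exists n0 => n /n0P h; rewrite (le_trans (xe n))// lerD2r ler_wpM2r//.
have v0 : (0 : R) < n.+1%:R^-1 by rewrite invr_gt0 ltr0n.
rewrite -addrA lerD2l /al' expr2.
rewrite (_ : D / _ = n.+1%:R^-1 * (D * n.+1%:R^-1)); last by rewrite invfM mulrCA mulrA.
rewrite (_ : al / _ = n.+1%:R^-1 * al); last by rewrite mulrC.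
rewrite -mulrDr [leRHS]mulrC ler_pM2l//.
have h2 : D * n.+1%:R^-1 <= D * ((1 - al) / (2 * (D + 1))) by rewrite ler_wpM2l.
have h3 : D * ((1 - al) / (2 * (D + 1))) <= (1 - al) / 2.
  rewrite mulrA ler_pdivrMr; last by lra.
  by nra.
have := le_trans h2 h3; clear h2 h3; move: (D * n.+1%:R^-1) => v hv; lra.
Qed.

Lemma gronwall_bounded E : (forall n, e n <= E) -> exists C, forall n, x n <= C * n.+1%:R.
Proof.
move=> eE; have [n0 n0P] := step.
have E0 : 0 <= `|E| / (1 - al') by rewrite divr_ge0// subr_ge0 ltW.
pose C := \sum_(j < n0.+1) x j + `|E| / (1 - al').
exists C.
have S0 : 0 <= \sum_(j < n0.+1) x j by rewrite sumr_ge0.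
have C0 : 0 <= C by rewrite addr_ge0.
have small n : (n <= n0)%N -> x n <= C * n.+1%:R.
  move=> nn; apply: (@le_trans _ _ C); last by rewrite ler_peMr// ler1n.
  have nlt : (n < n0.+1)%N by [].
  by rewrite /C (bigD1 (Ordinal nlt))//= -addrA lerDl addr_ge0// sumr_ge0.
elim=> [|n IH]; first exact: small.
have [nn|nn] := leqP n.+1 n0; first exact: small.
rewrite (le_trans (n0P n _))//.
have v0 : (0 : R) < n.+1%:R by rewrite ltr0n.
have h : 0 <= 1 + al' / n.+1%:R by rewrite addr_ge0// divr_ge0// ltW.
have CE : `|E| <= C * (1 - al').
  by rewrite -ler_pdivrMr ?subr_gt0// /C lerDr.
have EE := ler_norm E.
rewrite -(natr1 n.+1) mulrDr mulr1.
apply: (@le_trans _ _ ((1 + al' / n.+1%:R) * (C * n.+1%:R) + E)).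
  by rewrite lerD// ler_wpM2l.
rewrite mulrDl mul1r [al' / _ * _]mulrCA mulfVK ?gt_eqF// -addrA lerD2l; lra.
Qed.

(** The gap between the growth rate [al] and 1 makes [x n / n] a convex
    combination of its past and of the forcing term, with weights whose sum
    diverges like the harmonic series. *)
Lemma gronwall_o : e n @[n --> \oo] --> (0 : R) -> (x n / n.+1%:R) @[n --> \oo] --> (0 : R).
Proof.
move=> ecv; apply/cvgrPdist_le => eps eps0.
have [n0 n0P] := step.
have d0 : 0 < 1 - al' by rewrite subr_gt0.
pose eta := eps / 2.
have eta0 : 0 < eta by rewrite divr_gt0.
have /cvgrPdist_le /(_ (eta * (1 - al')) (mulr_gt0 eta0 d0)) [n1 _ n1P] := ecv.
pose n2 := maxn n0 n1.
pose y n := x n / n.+1%:R.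
pose w n : R := (1 - al') / n.+2%:R.
have w01 n : 0 <= w n <= 1.
  rewrite divr_ge0 ?(ltW d0)//= ler_pdivrMr ?ltr0n// mul1r.
  rewrite (@le_trans _ _ 1) ?ler1n//; by rewrite lerBlDr lerDl ltW.
have ystep n : (n2 <= n)%N -> y n.+1 - eta <= (1 - w n) * (y n - eta).
  move=> nn.
  have h0 : x n.+1 <= (1 + al' / n.+1%:R) * x n + e n.
    by apply: n0P; rewrite (leq_trans _ nn)// leq_maxl.
  have h1 : e n <= eta * (1 - al').
    have := n1P n; rewrite /= sub0r normrN => h.
    by rewrite (le_trans (ler_norm _))// h// (leq_trans _ nn)// leq_maxr.
  have v0 : (0 : R) < n.+1%:R by rewrite ltr0n.
  have v2 : (0 : R) < n.+2%:R by rewrite ltr0n.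
  rewrite lerBlDr ler_pdivrMr//.
  apply: (le_trans h0).
  rewrite (_ : _ * n.+2%:R = (1 + al' / n.+1%:R) * x n + eta * (1 - al')); first by rewrite lerD2l.
  rewrite /w /y -(natr1 n.+1); field.
  by rewrite nat1r natr1 !pnatr_eq0.
pose S n : R := \sum_(n2 <= j < n) w j.
pose u n := (1 + S n) * Num.max 0 (y n - eta).
have S0 n : 0 <= S n by apply: sumr_ge0 => j _; have /andP[] := w01 j.
have umono n : (n2 <= n)%N -> u n.+1 <= u n.
  move=> nn; rewrite /u /S big_nat_recr//= -/(S n).
  have /andP[w0 w1] := w01 n.
  have : Num.max 0 (y n.+1 - eta) <= (1 - w n) * Num.max 0 (y n - eta).
    rewrite ge_max mulr_ge0 ?subr_ge0 ?le_max ?lexx//=.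
    rewrite (le_trans (ystep n nn))// ler_wpM2l ?subr_ge0// le_max lexx orbT//.
  set p := Num.max 0 (y n - eta); set q := Num.max 0 _ => pq.
  have p0 : 0 <= p by rewrite le_max lexx.
  have Sn := S0 n.
  apply: (@le_trans _ _ ((1 + (S n + w n)) * ((1 - w n) * p))).
    by rewrite ler_wpM2l// !addr_ge0.
  rewrite mulrA ler_wpM2r//; nra.
have ubound n : (n2 <= n)%N -> u n <= u n2.
  elim: n => [|n IH]; first by rewrite leqn0 => /eqP ->.
  rewrite leq_eqVlt => /predU1P[<-//|]; rewrite ltnS => nn.
  by rewrite (le_trans (umono n nn))// IH.
have u0 : 0 <= u n2 by rewrite mulr_ge0 ?addr_ge0 ?le_max ?lexx.
have [n3 n3P] := harm_unbounded ((u n2 / eta) / (1 - al') + harm n2.+1 + 1).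
have SE n : (n2 <= n)%N -> S n = (1 - al') * (harm n.+1 - harm n2.+1).
  elim: n => [|n IH]; first by rewrite leqn0 => /eqP <-; rewrite /S big_geq// subrr mulr0.
  rewrite leq_eqVlt => /predU1P[<-|]; first by rewrite /S big_geq// subrr mulr0.
  rewrite ltnS => nn; rewrite /S big_nat_recr//= -/(S n) IH// (harmS n.+1) /w; ring.
near=> n.
have nn2 : (n2 <= n)%N by near: n; exact: nbhs_infty_ge.
have nn3 : (n3 <= n.+1)%N.
  by rewrite (@leq_trans n)//; near: n; exact: nbhs_infty_ge.
have y0 : 0 <= y n by rewrite divr_ge0.
rewrite sub0r normrN ger0_norm// -/(y n).
suff : y n - eta <= eta by rewrite /eta; lra.
have hS : u n2 / eta <= S n.
  rewrite SE//; have := n3P _ nn3 => h.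
  have : (u n2 / eta) / (1 - al') <= harm n.+1 - harm n2.+1 by lra.
  by rewrite ler_pdivrMr// [_ * (1 - al')]mulrC.
have hu := ubound n nn2.
rewrite leNgt; apply/negP => lt_eta.
have : eta < Num.max 0 (y n - eta) by rewrite lt_max lt_eta orbT.
set p := Num.max _ _ => ep.
have : (1 + S n) * eta <= u n.
  by rewrite /u ler_wpM2l ?addr_ge0// ltW.
rewrite ler_pdivrMr// in hS.
by move=> h; lra.
Unshelve. all: by end_near. Qed.
End Gronwall.
End Harmonic.

(** * Growth products and the normalisation *)

Section GrowthProducts.
Variable R : realType.
Implicit Types b g : R.

(** Of order [(n / m) ^ b] for [0 < m <= n]. *)
Definition gprod b (m n : nat) : R := \prod_(m <= j < n) (1 + b / j.+1%:R).

Lemma gprod_ge1 b m n : 0 <= b -> 1 <= gprod b m n.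
Proof.
move=> b0; rewrite /gprod; elim/big_rec: _ => [//|j x _ x1].
by rewrite -[leLHS]mulr1 ler_pM// lerDl divr_ge0.
Qed.

Lemma gprod_ge0 b m n : 0 <= b -> 0 <= gprod b m n.
Proof. by move=> b0; rewrite (le_trans ler01)// gprod_ge1. Qed.

Lemma gprod_nil b m : gprod b m m = 1.
Proof. by rewrite /gprod big_geq. Qed.

Lemma gprodS b m n : (m <= n)%N -> gprod b m n.+1 = (1 + b / n.+1%:R) * gprod b m n.
Proof. by move=> mn; rewrite /gprod big_nat_recr//= mulrC. Qed.

Lemma gprod_step b m N : (m < N)%N -> gprod b m N = (1 + b / m.+1%:R) * gprod b m.+1 N.
Proof. by move=> mN; rewrite /gprod big_ltn. Qed.

Lemma gprod_mono b g m n : 0 <= b <= g -> gprod b m n <= gprod g m n.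
Proof.
move=> /andP[b0 bg]; rewrite /gprod; apply: ler_prod => j _.
by rewrite addr_ge0 ?divr_ge0//= lerD2l ler_wpM2r.
Qed.

Lemma gprod_le0 b m n : 0 <= b -> (m <= n)%N -> gprod b m n <= gprod b 0 n.
Proof.
move=> b0 mn; rewrite [leRHS]/gprod (big_cat_nat (n := m))//= -/(gprod b 0 m) -/(gprod b m n).
by rewrite ler_peMl ?gprod_ge0// gprod_ge1.
Qed.

(** The sum telescopes, since consecutive products differ by
    [b * gprod b m.+1 N / m.+1%:R]. *)
Lemma gprod_harmonic_sum b N : 0 < b ->
  \sum_(m < N) gprod b m.+1 N / m.+1%:R <= gprod b 0 N / b.
Proof.
move=> b0; have step (m : 'I_N) : gprod b m.+1 N / m.+1%:R =
    - (gprod b m.+1 N - gprod b m N) / b.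
  rewrite [gprod b m N]gprod_step//; move: (gprod b m.+1 N) => g.
  by field; rewrite nat1r pnatr_eq0 /= gt_eqF.
under eq_bigr => m _ do rewrite step.
rewrite -mulr_suml sumrN -(big_mkord xpredT (fun m => gprod b m.+1 N - gprod b m N)).
rewrite telescope_sumr// gprod_nil opprB ler_pM2r ?invr_gt0// gerBl//.
Qed.

(** The order of magnitude of accumulated covariances when the noise of step
    [m + 1] is amplified at the rates [b] and [g] up to time [N]. *)
Definition gsum b g (w : nat -> R) (N : nat) : R :=
  \sum_(m < N) gprod b m.+1 N * gprod g m.+1 N * w m.

Lemma gsumS b g w N : gsum b g w N.+1 =
  (1 + (b + g) / N.+1%:R + (b * g) / N.+1%:R ^+ 2) * gsum b g w N + w N.
Proof.
rewrite /gsum big_ord_recr/= !gprod_nil !mul1r mulr_sumr; congr (_ + _).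
apply: eq_bigr => m _; rewrite !gprodS//.
by field; rewrite nat1r pnatr_eq0.
Qed.

Lemma gsum_ge0 b g w N : 0 <= b -> 0 <= g -> (forall m, 0 <= w m) -> 0 <= gsum b g w N.
Proof. by move=> b0 g0 w0; apply: sumr_ge0 => m _; rewrite !mulr_ge0// gprod_ge0. Qed.

Lemma gsum_bounded b g : 0 <= b -> 0 <= g -> b + g < 1 ->
  exists C, forall N, gsum b g (fun=> 1) N <= C * N.+1%:R.
Proof.
move=> b0 g0 bg.
apply: (@gronwall_bounded R _ (fun=> 1) (b + g) (b * g)) => //.
- exact: addr_ge0.
- by move=> n; exact: gsum_ge0.
- exact: mulr_ge0.
- by move=> n; rewrite gsumS.
Qed.

Lemma gsum_o b g : 0 <= b -> 0 <= g -> b + g < 1 ->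
  (gsum b g (fun m => m.+1%:R^-1) N / N.+1%:R) @[N --> \oo] --> (0 : R).
Proof.
move=> b0 g0 bg.
apply: (@gronwall_o R _ (fun n => n.+1%:R^-1) (b + g) (b * g)) => //.
- exact: addr_ge0.
- by move=> n; exact: gsum_ge0.
- exact: mulr_ge0.
- by move=> n; rewrite gsumS.
- exact: (@cvg_harmonic R).
Qed.

Lemma gprod_sqr_o b : 0 <= b -> b < 1 / 2 ->
  (gprod b 0 N ^+ 2 / N.+1%:R) @[N --> \oo] --> (0 : R).
Proof.
move=> b0 bg.
apply: (@gronwall_o R _ (fun=> 0) (b + b) (b * b)) => //.
- exact: addr_ge0.
- by lra.
- by move=> n; rewrite sqr_ge0.
- exact: mulr_ge0.
- move=> n; rewrite gprodS// addr0 le_eqVlt; apply/orP; left; apply/eqP.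
  by field; rewrite nat1r pnatr_eq0.
- exact: cvg_cst.
Qed.

Lemma gprod_half_sqr N : gprod (1 / 2) 0 N ^+ 2 <= 2 * N.+1%:R.
Proof.
suff : gprod (1 / 2) 0 N ^+ 2 <= (2 - N.+1%:R^-1) * N.+1%:R.
  move=> /le_trans; apply; rewrite ler_wpM2r// gerBl invr_ge0//.
elim: N => [|N IH]; first by rewrite gprod_nil invr1; lra.
rewrite gprodS// exprMn -(natr1 N.+1).
have : (1 : R) <= N.+1%:R by rewrite ler1n.
move: IH; set x := N.+1%:R; set y := gprod _ _ _ ^+ 2 => IH x1.
have x0 : x != 0 by rewrite gt_eqF//; lra.
apply: (@le_trans _ _ ((1 + 1 / 2 / x) ^+ 2 * ((2 - x^-1) * x))).
  by rewrite ler_wpM2l ?sqr_ge0.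
rewrite (_ : _ * x = 2 * x - 1); last by rewrite mulrBl mulVf.
rewrite (_ : _ * (x + 1) = 2 * (x + 1) - 1); last first.
  by rewrite mulrBl mulVf// gt_eqF//; lra.
rewrite -subr_ge0 (_ : _ - _ = (2 * x + 1) / (4 * x ^+ 2)); last by field.
by rewrite divr_ge0 ?mulr_ge0 ?sqr_ge0//; lra.
Qed.

(** At the critical exponent the quadratic growth is harmonic, hence the
    logarithm in the normalisation. *)
Lemma gsum_half_bounds N :
  N.+1%:R * (harm R N.+1 - 1) <= gsum (1 / 2) (1 / 2) (fun=> 1) N <=
  N.+1%:R * (harm R N.+1 + 1).
Proof.
suff : N.+1%:R * (harm R N.+1 - 1) <= gsum (1 / 2) (1 / 2) (fun=> 1) N <=
  N.+1%:R * (harm R N.+1 + 1 - (harm R N.+1 + 1) / N.+1%:R).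
  move=> /andP[-> h] /=; rewrite (le_trans h)// ler_wpM2l// gerBl divr_ge0//.
  by rewrite addr_ge0// /harm sumr_ge0.
elim: N => [|N /andP[IH1 IH2]].
  by rewrite harmS /harm /gsum !big_ord0 invr1 add0r; apply/andP; split; lra.
have h1 : 1 <= harm R N.+1.
  by rewrite /harm big_ord_recl/= invr1 lerDl sumr_ge0.
rewrite gsumS (harmS R N.+1) -(natr1 N.+1).
have : (1 : R) <= N.+1%:R by rewrite ler1n.
move: IH1 IH2 h1; move: (gsum _ _ _ N) (harm R N.+1) (N.+1%:R : R) => y H x.
move=> IH1 IH2 H1 x1.
have x0 : x != 0 by rewrite gt_eqF//; lra.
have x10 : x + 1 != 0 by rewrite gt_eqF//; lra.
set f := 1 + _ + _.
have fE : f = 1 + x^-1 + 1 / 4 * x ^- 2 by rewrite /f; field.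
have f0 : 0 <= f by rewrite fE !addr_ge0// ?mulr_ge0 ?invr_ge0 ?exprn_ge0//; lra.
apply/andP; split.
  apply: (@le_trans _ _ (f * (x * (H - 1)) + 1)); last by rewrite lerD2r ler_wpM2l.
  rewrite -subr_ge0 (_ : _ - _ = (H - 1) / (4 * x)); last by rewrite fE; field; rewrite x0 x10.
  by rewrite divr_ge0//; lra.
apply: (@le_trans _ _ (f * (x * (H + 1 - (H + 1) / x)) + 1)).
  by rewrite lerD2r ler_wpM2l.
rewrite -subr_ge0 (_ : _ - _ = (3 / 4 * (H + 1) - x / (x + 1)) / x + (H + 1) / (4 * x ^+ 2)); last first.
  by rewrite fE; field; rewrite x0 x10.
have h2 : x / (x + 1) <= 1 by rewrite ler_pdivrMr; lra.
by rewrite addr_ge0// divr_ge0// ?mulr_ge0 ?sqr_ge0//; lra.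
Qed.
End GrowthProducts.

Section Scale.
Variable R : realType.

(** The square of [clt_scale], see [sqr_clt_scale]. *)
Definition scale2 (crit : bool) (N : nat) : R := if crit then N%:R * ln N%:R else N%:R.

Lemma scale2E crit N : clt_scale R crit N = Num.sqrt (scale2 crit N).
Proof. by case: crit. Qed.

Lemma scale2_gt0 crit N : (2 <= N)%N -> 0 < scale2 crit N.
Proof.
move=> N2; have N0 : (0 : R) < N%:R by rewrite ltr0n (leq_trans _ N2).
by case: crit => //=; rewrite mulr_gt0// ln_gt0// ltr1n.
Qed.

Lemma sqr_clt_scale crit N : (2 <= N)%N -> clt_scale R crit N ^+ 2 = scale2 crit N.
Proof. by move=> N2; rewrite scale2E sqr_sqrtr// ltW// scale2_gt0. Qed.

Lemma ln_infty (K : R) : exists n0, forall n, (n0 <= n)%N -> K <= ln n%:R.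
Proof.
exists (Num.trunc (expR K)).+1 => n nn.
have n0 : (0 < n)%N by rewrite (leq_trans _ nn).
rewrite -[leLHS]expRK ler_ln ?posrE ?expR_gt0 ?ltr0n//.
by rewrite ltW// (lt_le_trans (truncnS_gt _))// ler_nat.
Qed.

Lemma cvg_ln_inv : (ln (N%:R : R))^-1 @[N --> \oo] --> (0 : R).
Proof.
apply/cvgrPdist_le => e e0; have [n0 n0P] := ln_infty e^-1.
near=> n; have nn : (n0 <= n)%N by near: n; exact: nbhs_infty_ge.
have h := n0P n nn; have e1 : 0 < e^-1 by rewrite invr_gt0.
have l0 : 0 < ln (n%:R : R) by rewrite (lt_le_trans e1).
by rewrite sub0r normrN ger0_norm ?invr_ge0 ?(ltW l0)// invf_ple ?posrE.
Unshelve. all: by end_near. Qed.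

Lemma cvg_succ_ratio : (N.+1%:R / N%:R : R) @[N --> \oo] --> (1 : R).
Proof.
apply/cvgrPdist_le => e e0; have [n0 n0P] := inv_le_eventually e0.
near=> n; have nn : (n0.+1 <= n)%N by near: n; exact: nbhs_infty_ge.
have [m nm] : exists m, n = m.+1 by exists n.-1; rewrite prednK// (leq_trans _ nn).
move: nn; rewrite nm ltnS => nn.
rewrite -(natr1 m.+1) mulrDl divff ?pnatr_eq0// mul1r opprD addNKr normrN.
by rewrite ger0_norm ?invr_ge0// n0P.
Unshelve. all: by end_near. Qed.

Lemma cvg_succ_scale2_crit : (N.+1%:R / scale2 true N) @[N --> \oo] --> (0 : R).
Proof.
rewrite -(mulr0 1); under eq_fun do rewrite /= invfM mulrA.
exact: (cvgM cvg_succ_ratio cvg_ln_inv).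
Qed.

Lemma succ_scale2_bounded crit : exists C : R, \forall N \near \oo,
  N.+1%:R / scale2 crit N <= C.
Proof.
case: crit.
  have /cvgrPdist_le /(_ 1 ltr01) h := cvg_succ_scale2_crit.
  exists 1; apply: filterS h => n; rewrite sub0r normrN; exact: le_trans (ler_norm _).
have /cvgrPdist_le /(_ 1 ltr01) h := cvg_succ_ratio.
exists 2; apply: filterS h => n /= h; rewrite ler_norml in h; lra.
Qed.

Lemma cvg_o_scale2 crit (x : nat -> R) :
  (x N / N.+1%:R) @[N --> \oo] --> (0 : R) ->
  (x N / scale2 crit N) @[N --> \oo] --> (0 : R).
Proof.
move=> xo.
have h : (x N / N.+1%:R * (N.+1%:R / scale2 crit N)) @[N --> \oo] --> (0 : R).
  case: crit.
    by rewrite -(mulr0 0); apply: cvgM xo cvg_succ_scale2_crit.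
  by rewrite -(mul0r 1); apply: cvgM xo cvg_succ_ratio.
have <- : (fun N => x N / N.+1%:R * (N.+1%:R / scale2 crit N)) =
    (fun N => x N / scale2 crit N).
  by apply/funext => N; rewrite mulrA divfK// pnatr_eq0.
exact: h.
Qed.

Lemma cvg_O_scale2_crit (x : nat -> R) C : (forall N, `|x N| <= C * N.+1%:R) ->
  (x N / scale2 true N) @[N --> \oo] --> (0 : R).
Proof.
move=> xC; apply: norm_cvg0; apply: (@squeeze_cvgr _ _ _ _ (fun=> 0)
  (fun N => C * (N.+1%:R / scale2 true N))); last 2 first.
- exact: cvg_cst.
- by rewrite -(mulr0 C); apply: cvgMl_tmp; exact: cvg_succ_scale2_crit.
near=> N; rewrite normr_ge0/= normrM mulrA.
have s0 : 0 < scale2 true N by apply: scale2_gt0; near: N; exact: nbhs_infty_ge.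
by rewrite normfV (gtr0_norm s0) ler_pM2r ?invr_gt0.
Unshelve. all: by end_near. Qed.

Lemma cvg_gsum_half : (gsum (1 / 2) (1 / 2) (fun=> 1) N / scale2 true N)
  @[N --> \oo] --> (1 : R).
Proof.
pose e (N : nat) : R := (1 + N.+1%:R^-1 + 2) * (N.+1%:R / scale2 true N).
have ecv : e N @[N --> \oo] --> (0 : R).
  rewrite -(mulr0 (1 + 0 + 2)); apply: cvgM; last exact: cvg_succ_scale2_crit.
  apply: cvgD; last exact: cvg_cst.
  apply: cvgD; first exact: cvg_cst.
  exact: (@cvg_harmonic R).
pose lo (N : nat) : R := N.+1%:R / N%:R - e N.
pose hi (N : nat) : R := N.+1%:R / N%:R + e N.
apply: (@squeeze_cvgr _ _ _ _ lo hi); last 2 first.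
- by rewrite -(subr0 1); apply: cvgB ecv; exact: cvg_succ_ratio.
- by rewrite -(addr0 1); apply: cvgD ecv; exact: cvg_succ_ratio.
near=> N.
have N2 : (2 <= N)%N by near: N; exact: nbhs_infty_ge.
have s0 : 0 < scale2 true N by exact: scale2_gt0.
have N0 : (0 : R) < N%:R by rewrite ltr0n (leq_trans _ N2).
have N1 : (0 : R) < N.+1%:R by rewrite ltr0n.
have l0 : 0 < ln (N%:R : R) by rewrite ln_gt0// ltr1n.
have ratio : N.+1%:R / N%:R = N.+1%:R * ln N%:R / scale2 true N.
  by rewrite /scale2 invfM mulrA mulrAC mulfK// gt_eqF.
have /andP[b1 b2] := gsum_half_bounds R N.
have lnle : ln (N%:R : R) <= ln (N.+2%:R).
  by rewrite ler_ln ?posrE// ler_nat (leq_trans (leqnSn _)).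
have lnS : ln (N.+1%:R : R) <= ln (N%:R) + 1.
  rewrite (_ : N.+1%:R = N%:R * (1 + N%:R^-1)); last first.
    by rewrite mulrDr mulr1 divff ?gt_eqF// natr1.
  have v0 : (0 : R) < N%:R^-1 by rewrite invr_gt0.
  have v1 : N%:R^-1 <= 1 :> R by rewrite invf_le1// ler1n (leq_trans _ N2).
  rewrite lnM ?posrE ?addr_gt0// lerD2l (le_trans _ v1)// le_ln1Dx//.
  by rewrite (lt_trans _ v0)// ltrN10.
have h1 := harm_ge_ln R N.+1; have h2 := harm_le_ln R N.
have eE : e N * scale2 true N = (1 + N.+1%:R^-1 + 2) * N.+1%:R.
  by rewrite /e mulrA mulfVK// gt_eqF.
have v0 : (0 : R) <= N.+1%:R^-1 by rewrite invr_ge0.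
rewrite /lo /hi ratio ler_pdivlMr// ler_pdivrMr// mulrBl mulrDl eE.
rewrite mulfVK ?gt_eqF// ![_ * N.+1%:R]mulrC -mulrBr -mulrDr.
rewrite (le_trans _ b1) ?(le_trans b2)//; rewrite ler_wpM2l ?(ltW N1)//;
  move: h1 h2 lnS lnle v0; move: (harm R N.+1) (N.+1%:R^-1 : R) (ln (N.+1%:R : R))
    (ln (N%:R : R)) (ln (N.+2%:R : R)) => *; lra.
Unshelve. all: by end_near. Qed.

Lemma cvg_scale2_inv crit : (scale2 crit N)^-1 @[N --> \oo] --> (0 : R).
Proof.
have h := @cvg_o_scale2 crit (fun=> 1) _.
under eq_fun do rewrite -[_^-1]mul1r; apply: h.
by under eq_fun do rewrite mul1r; exact: (@cvg_harmonic R).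
Qed.

(** The logarithm is below twice the square root. *)
Lemma cvg_scale2_sqr crit : (scale2 crit N / N.+1%:R ^+ 2) @[N --> \oo] --> (0 : R).
Proof.
apply: (@squeeze_cvgr _ _ _ _ (fun=> 0) (fun N => 2 / Num.sqrt N.+1%:R)); last 2 first.
- exact: cvg_cst.
- rewrite -(mulr0 2); apply: cvgMl_tmp.
  apply/cvgrPdist_le => e e0.
  have e20 : 0 < e ^+ 2 by rewrite exprn_gt0.
  have [n0 n0P] := inv_le_eventually e20.
  near=> n; have nn : (n0 <= n)%N by near: n; exact: nbhs_infty_ge.
  rewrite sub0r normrN ger0_norm ?invr_ge0 ?sqrtr_ge0//.
  rewrite -sqrtrV//; rewrite -[leRHS]ger0_norm ?(ltW e0)// -sqrtr_sqr.
  by rewrite ler_sqrt ?sqr_ge0 ?n0P//; exact: n0P.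
near=> N.
have N2 : (2 <= N)%N by near: N; exact: nbhs_infty_ge.
rewrite divr_ge0 ?sqr_ge0 ?(ltW (scale2_gt0 crit N2))//=.
have N1 : (0 : R) < N.+1%:R by rewrite ltr0n.
pose q := Num.sqrt (N.+1%:R : R).
have q0 : 0 < q by rewrite sqrtr_gt0.
have qq : N.+1%:R = q ^+ 2 by rewrite sqr_sqrtr// ltW.
have q1 : 1 <= q by rewrite -(sqrtr1 R) ler_sqrt ?ler1n.
have lnq : ln (N.+1%:R : R) <= 2 * q.
  rewrite qq lnXn// -[_ *+ 2]mulr_natl ler_pM2l//.
  have := @le_ln1Dx R (q - 1); rewrite (addrC 1) subrK => h.
  by rewrite (le_trans (h _))//; lra.
have s2 : scale2 crit N <= N.+1%:R * (2 * q).
  have NN : N%:R <= N.+1%:R :> R by rewrite ler_nat.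
  case: crit => /=.
    apply: ler_pM => //; first by rewrite ln_ge0// ler1n (leq_trans _ N2).
    rewrite (le_trans _ lnq)// ler_ln ?posrE//.
    by rewrite ltr0n (leq_trans _ N2).
  by rewrite (le_trans NN)// ler_peMr ?(ltW N1)//; lra.
rewrite -/q ler_pdivrMr ?exprn_gt0// (le_trans s2)// qq.
by rewrite le_eqVlt; apply/orP; left; apply/eqP; field; rewrite gt_eqF.
Unshelve. all: by end_near. Qed.
End Scale.

(** * Column norm, bilinear forms and the backward flow *)

Section ColumnNorm.
Context (R : realType) (k : nat).
Implicit Types (t s : 'cV[R]_k) (A : 'M[R]_k).

(** The supremum norm, for which a stochastic matrix acting on columns is a
    contraction. *)
Definition cnorm t : R := \big[Num.max/0]_i `|t i 0|.

Lemma cnorm_ge0 t : 0 <= cnorm t.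
Proof. by rewrite /cnorm; elim/big_rec: _ => // i x _ x0; rewrite le_max x0 orbT. Qed.

Lemma le_cnorm t i : `|t i 0| <= cnorm t.
Proof. exact: (le_bigmax_cond 0 (fun i => `|t i 0|)). Qed.

Lemma cnorm_le t M : 0 <= M -> (forall i, `|t i 0| <= M) -> cnorm t <= M.
Proof. by move=> M0 tM; apply: bigmax_le. Qed.

Lemma cnormD s t : cnorm (s + t) <= cnorm s + cnorm t.
Proof.
apply: cnorm_le => [|i]; first by rewrite addr_ge0 ?cnorm_ge0.
by rewrite mxE (le_trans (ler_normD _ _))// lerD ?le_cnorm.
Qed.

Lemma cnormZ a t : cnorm (a *: t) <= `|a| * cnorm t.
Proof.
apply: cnorm_le => [|i]; first by rewrite mulr_ge0 ?cnorm_ge0.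
by rewrite mxE normrM ler_wpM2l ?le_cnorm.
Qed.

Definition entry_sum A : R := \sum_i \sum_j `|A i j|.

Lemma entry_sum_ge0 A : 0 <= entry_sum A.
Proof. by apply: sumr_ge0 => i _; exact: sumr_ge0. Qed.

Lemma cnorm_mul A t : cnorm (A *m t) <= entry_sum A * cnorm t.
Proof.
apply: cnorm_le => [|i]; first by rewrite mulr_ge0 ?entry_sum_ge0 ?cnorm_ge0.
rewrite mxE (le_trans (ler_norm_sum _ _ _))//.
apply: (@le_trans _ _ ((\sum_j `|A i j|) * cnorm t)).
  by rewrite mulr_suml; apply: ler_sum => j _; rewrite normrM ler_wpM2l ?le_cnorm.
rewrite ler_wpM2r ?cnorm_ge0// /entry_sum [leRHS](bigD1 i)//= lerDl.
by apply: sumr_ge0 => l _; exact: sumr_ge0.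
Qed.

Definition bil A s t : R := (s^T *m A *m t) 0 0.

Lemma bilE A s t : bil A s t = \sum_i \sum_j s i 0 * A i j * t j 0.
Proof.
rewrite /bil mxE exchange_big/=; apply: eq_bigr => j _.
by rewrite mxE mulr_suml; apply: eq_bigr => i _; rewrite mxE.
Qed.

Lemma bil_bound A s t : `|bil A s t| <= entry_sum A * (cnorm s * cnorm t).
Proof.
rewrite bilE (le_trans (ler_norm_sum _ _ _))// /entry_sum mulr_suml.
apply: ler_sum => i _; rewrite (le_trans (ler_norm_sum _ _ _))// mulr_suml.
apply: ler_sum => j _; rewrite !normrM -mulrA mulrCA ler_wpM2l//.
by rewrite ler_pM ?le_cnorm.
Qed.

Lemma bilDl A r s t : bil A (r + s) t = bil A r t + bil A s t.
Proof. by rewrite /bil linearD/= !mulmxDl mxE. Qed.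

Lemma bilDr A r s t : bil A r (s + t) = bil A r s + bil A r t.
Proof. by rewrite /bil mulmxDr mxE. Qed.

Lemma bilZl A a s t : bil A (a *: s) t = a * bil A s t.
Proof. by rewrite /bil linearZ/= -!scalemxAl mxE. Qed.

Lemma bilZr A a s t : bil A s (a *: t) = a * bil A s t.
Proof. by rewrite /bil -scalemxAr mxE. Qed.

Lemma bilDm A B s t : bil (A + B) s t = bil A s t + bil B s t.
Proof. by rewrite /bil mulmxDr mulmxDl mxE. Qed.

Lemma bilBm A B s t : bil (A - B) s t = bil A s t - bil B s t.
Proof. by rewrite /bil mulmxBr mulmxBl !mxE. Qed.

Lemma bil_mull A B s t : bil A (B *m s) t = bil (B^T *m A) s t.
Proof. by rewrite /bil trmx_mul !mulmxA. Qed.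

Lemma bil_mulr A B s t : bil A s (B *m t) = bil (A *m B) s t.
Proof. by rewrite /bil !mulmxA. Qed.

Lemma bil_delta A i j : bil A (delta_mx i 0) (delta_mx j 0) = A i j.
Proof. by rewrite /bil trmx_delta -rowE -colE !mxE. Qed.

Lemma bil_sym A s t : bil A s t = bil A^T t s.
Proof.
rewrite !bilE exchange_big/=; apply: eq_bigr => j _; apply: eq_bigr => i _.
by rewrite mxE; ring.
Qed.

(** Symmetry and positivity pass to the limit of covariance forms. *)
Lemma bil_cvg (A : 'M[R]_k) (q : nat -> 'cV[R]_k -> 'cV[R]_k -> R) :
  (forall s t, q n s t @[n --> \oo] --> bil A s t) ->
  (forall n s t, q n s t = q n t s) -> (forall n t, 0 <= q n t t) ->
  covariance_mx A.
Proof.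
move=> qA qsym q0; split.
  apply/matrixP => i j; rewrite mxE -!bil_delta.
  have qc := qA (delta_mx i 0) (delta_mx j 0).
  have qe : (fun n => q n (delta_mx i 0) (delta_mx j 0)) =
    (fun n => q n (delta_mx j 0) (delta_mx i 0)) by apply/funext => n; rewrite qsym.
  rewrite qe in qc.
  exact: (cvg_unique _ (qA _ _) qc).
move=> t; have -> : (t *m A *m t^T) 0 0 = bil A t^T t^T by rewrite /bil trmxK.
by apply: (cvg_ge0 (qA _ _)); exact: nearW.
Qed.
End ColumnNorm.

Section Flow.
Context (R : realType) (k : nat) (B : 'M[R]_k).
Local Notation G := (growth B).

Fixpoint flow_aux (m n : nat) : 'M[R]_k :=
  if n is n'.+1 then G m.+1 *m flow_aux m.+1 n' else 1%:M.
(** The product of [growth B j] for [m < j <= N], the factor of lowest index on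
    the left. *)
Definition flow (m N : nat) : 'M[R]_k := flow_aux m (N - m).

Lemma flow_nil m : flow m m = 1%:M.
Proof. by rewrite /flow subnn. Qed.

Lemma flow_step m N : (m < N)%N -> flow m N = G m.+1 *m flow m.+1 N.
Proof. by move=> mN; rewrite /flow -(subnSK mN). Qed.

(** The function [nu] may be any adapted norm, and [E] any invariant subspace. *)
Lemma flow_ind (E : 'cV[R]_k -> Prop) (nu : 'cV[R]_k -> R) b : 0 <= b ->
  (forall m t, E t -> E (G m.+1 *m t) /\ nu (G m.+1 *m t) <= (1 + b / m.+1%:R) * nu t) ->
  forall m N t, (m <= N)%N -> E t ->
    E (flow m N *m t) /\ nu (flow m N *m t) <= gprod b m N * nu t.
Proof.
move=> b0 step m N t mN Et; rewrite -(subKn mN).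
elim: (N - m)%N (leq_subr m N) => [|d IH] dN.
  by rewrite subn0 flow_nil mul1mx gprod_nil mul1r.
have lt : (N - d.+1 < N)%N by rewrite ltn_subrL/= (leq_trans _ dN).
rewrite flow_step// gprod_step// subnSK// -mulmxA.
have [E1 n1] := IH (ltnW dN).
have := step (N - d.+1)%N _ E1; rewrite !subnSK// => -[E2 n2]; split=> //.
by rewrite (le_trans n2)// -mulrA ler_wpM2l// addr_ge0// divr_ge0.
Qed.

Lemma flow_eigen (P : 'M[R]_k) a m N : (m <= N)%N -> B *m P = a *: P ->
  flow m N *m P = gprod a m N *: P.
Proof.
move=> mN BP; rewrite -(subKn mN).
elim: (N - m)%N (leq_subr m N) => [|d IH] dN.
  by rewrite subn0 flow_nil mul1mx gprod_nil scale1r.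
have lt : (N - d.+1 < N)%N by rewrite ltn_subrL/= (leq_trans _ dN).
rewrite flow_step// gprod_step// subnSK// -mulmxA IH ?(ltnW dN)//.
rewrite -scalemxAr /growth mulmxDl mul1mx -scalemxAl BP scalerA.
rewrite -[X in X + _]scale1r -scalerDl scalerA mulrC.
by congr (_ *: _); rewrite (mulrC a).
Qed.
End Flow.

(** * Limit of the cumulated variance *)

Section StableSplit.
Context (R : realType) (k : nat).
Implicit Types s t : 'cV[R]_k.

(** [P] extracts the part of the deviations that grows exactly at the critical
    rate 1/2; what is left grows at a rate [b] below it. *)
Record stable_split (crit : bool) (B P : 'M[R]_k) (C b : R) : Prop := StableSplit {
  split_eigen : B *m P = (1 / 2) *: P;
  split_crit : ~~ crit -> P = 0;
  split_rate : 0 < b < 1 / 2;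
  split_cst : 0 <= C;
  split_bound : forall m N t, (m <= N)%N ->
    cnorm (flow B m N *m ((1%:M - P) *m t)) <= C * gprod b m N * cnorm t }.

Context (crit : bool) (B P : 'M[R]_k) (C b : R).
Hypothesis split : stable_split crit B P C b.

Definition rate : R := if crit then 1 / 2 else b.

Let b0 : 0 <= b. Proof. by have /andP[/ltW] := split_rate split. Qed.
Let b_lt : b < 1 / 2. Proof. by have /andP[] := split_rate split. Qed.
Let C0 := split_cst split.

Lemma rate_gt0 : 0 < rate.
Proof. by rewrite /rate; have /andP[] := split_rate split; case: crit => // *; lra. Qed.

Lemma rate_ge0 : 0 <= rate.
Proof. exact: ltW rate_gt0. Qed.

Let b_le_rate : 0 <= b <= rate.
Proof. by rewrite b0/= /rate; case: crit => //; exact: ltW. Qed.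

Lemma flow_decomp m N t : (m <= N)%N ->
  flow B m N *m t = gprod (1 / 2) m N *: (P *m t) + flow B m N *m ((1%:M - P) *m t).
Proof.
move=> mN; rewrite mulmxBl mul1mx mulmxBr mulmxA (flow_eigen mN (split_eigen split)).
by rewrite -scalemxAl addrC subrK.
Qed.

Lemma flow_bound : exists2 C', 0 <= C' & forall m N t, (m <= N)%N ->
  cnorm (flow B m N *m t) <= C' * gprod rate m N * cnorm t.
Proof.
exists (entry_sum P + C); first by rewrite addr_ge0 ?entry_sum_ge0.
move=> m N t mN; rewrite (flow_decomp t mN) (le_trans (cnormD _ _))//.
rewrite mulrDl mulrDl lerD//; last first.
  rewrite (le_trans (split_bound split t mN))// ler_wpM2r ?cnorm_ge0//.
  by rewrite ler_wpM2l// gprod_mono.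
rewrite (le_trans (cnormZ _ _))// ger0_norm ?gprod_ge0 ?divr_ge0//.
rewrite [entry_sum P * _]mulrC -mulrA.
have [ncrit|crit_] := boolP (~~ crit).
  have -> : cnorm (P *m t) = 0.
    apply/eqP; rewrite eq_le cnorm_ge0 andbT (split_crit split ncrit) mul0mx.
    by apply: cnorm_le => // i; rewrite mxE normr0.
  by rewrite mulr0 !mulr_ge0 ?gprod_ge0 ?rate_ge0 ?entry_sum_ge0 ?cnorm_ge0.
rewrite /rate (negbNE crit_) ler_wpM2l ?cnorm_mul//.
by rewrite gprod_ge0// divr_ge0.
Qed.

Lemma rate_sqr_o : (gprod rate 0 N ^+ 2 / scale2 R crit N) @[N --> \oo] --> (0 : R).
Proof.
rewrite /rate; case: (boolP crit) => _.
  apply: (@cvg_O_scale2_crit _ _ 2) => N.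
  by rewrite ger0_norm ?sqr_ge0// gprod_half_sqr.
by apply: cvg_o_scale2; exact: gprod_sqr_o.
Qed.

Lemma rate_gsum_bounded : exists K, \forall N \near \oo,
  gsum rate rate (fun=> 1) N / scale2 R crit N <= K.
Proof.
rewrite /rate; case: (boolP crit) => _.
  exists 2; have /cvgrPdist_le /(_ 1 ltr01) h := @cvg_gsum_half R.
  by apply: filterS h => N /=; rewrite ler_norml => /andP[h1 h2]; lra.
have bb : b + b < 1 by have := b_lt; lra.
have [K KP] := gsum_bounded b0 b0 bb.
have [K' K'P] := succ_scale2_bounded R false.
exists (`|K| * K'); near=> N.
have N2 : (2 <= N)%N by near: N; exact: nbhs_infty_ge.
rewrite (@le_trans _ _ (`|K| * (N.+1%:R / scale2 R false N)))//.
  rewrite mulrA ler_pM2r ?invr_gt0 ?scale2_gt0// (le_trans (KP N))//.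
  by rewrite ler_wpM2r// ler_norm.
by rewrite ler_wpM2l//; near: N.
Unshelve. all: by end_near. Qed.

Variable Gam : 'M[R]_k.

Definition cumulated_var (N : nat) (s t : 'cV[R]_k) : R :=
  \sum_(m < N) bil Gam (flow B m.+1 N *m s) (flow B m.+1 N *m t).

Section Lyapunov.
Hypothesis ncrit : crit = false.

Lemma flow_bound_noncrit m N t : (m <= N)%N ->
  cnorm (flow B m N *m t) <= C * gprod b m N * cnorm t.
Proof.
move=> mN; have := split_bound split t mN.
by rewrite (split_crit split) ?ncrit// subr0 mul1mx.
Qed.

(** The numbers [m * bil S (flow B m N *m s) (flow B m N *m t)] telescope, and
    their increments are [bil G] of the next columns up to a relative error of
    order [1 / m]. *)
Lemma lyapunov_limit (S G : 'M[R]_k) s t : S - (B^T *m S + S *m B) = G ->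
  ((\sum_(m < N) bil G (flow B m.+1 N *m s) (flow B m.+1 N *m t)) / N%:R)
    @[N --> \oo] --> bil S s t.
Proof.
move=> SG.
pose K := entry_sum (B^T *m S + S *m B) + entry_sum (B^T *m S *m B).
have K0 : 0 <= K by rewrite addr_ge0 ?entry_sum_ge0.
pose q (N : nat) : R := \sum_(m < N) bil G (flow B m.+1 N *m s) (flow B m.+1 N *m t).
pose K' := K * (C ^+ 2 * (cnorm s * cnorm t)).
have main N : `|N%:R * bil S s t - q N| <= K' * gsum b b (fun m => m.+1%:R^-1) N.
  pose D (m : nat) := m%:R * bil S (flow B m N *m s) (flow B m N *m t).
  have -> : N%:R * bil S s t = \sum_(m < N) (D m.+1 - D m).
    rewrite -(big_mkord xpredT (fun m => D m.+1 - D m)) telescope_sumr//.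
    by rewrite /D flow_nil !mul1mx mul0r subr0.
  rewrite /q -sumrB (le_trans (ler_norm_sum _ _ _))// /gsum mulr_sumr.
  apply: ler_sum => -[m mN] _ /=.
  rewrite /D !(flow_step B mN) -!mulmxA.
  move: (flow_bound_noncrit s mN) (flow_bound_noncrit t mN).
  move: (flow B m.+1 N *m s) (flow B m.+1 N *m t) => u v cu cv.
  set x : R := m.+1%:R^-1.
  have x0 : 0 <= x by rewrite invr_ge0.
  have mx : m%:R * x = 1 - x.
    have -> : m%:R = m.+1%:R - 1 :> R by rewrite -natr1 addrK.
    by rewrite mulrBl divff ?pnatr_eq0// mul1r.
  have x1 : x <= 1 by rewrite invf_le1 ?ler1n// ltr0n.
  have -> : m.+1%:R * bil S u v - m%:R * bil S (growth B m.+1 *m u) (growth B m.+1 *m v)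
     - bil G u v = x * bil (B^T *m S + S *m B) u v - (1 - x) * x * bil (B^T *m S *m B) u v.
    rewrite /growth -/x !mulmxDl !mul1mx -!scalemxAl !(bilDl, bilDr, bilZl, bilZr).
    rewrite -SG bilBm !bilDm !bil_mull !bil_mulr -/x.
    have -> : m.+1%:R = m%:R + 1 :> R by rewrite natr1.
    move: (bil S u v) (bil (B^T *m S) u v) (bil (S *m B) u v)
      (bil (B^T *m S *m B) u v) => X0 X1 X2 X3.
    have -> : (m%:R + 1) * X0 - m%:R * (X0 + x * X2 + x * (X1 + x * X3)) -
        (X0 - (X1 + X2)) = (X1 + X2) - (m%:R * x) * (X1 + X2 + x * X3) by ring.
    rewrite mx; ring.
  have cc : cnorm u * cnorm v <= C ^+ 2 * (cnorm s * cnorm t) *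
      (gprod b m.+1 N * gprod b m.+1 N).
    rewrite (le_trans (ler_pM (cnorm_ge0 _) (cnorm_ge0 _) cu cv))//.
    by rewrite le_eqVlt; apply/orP; left; apply/eqP; ring.
  have b1 := bil_bound (B^T *m S + S *m B) u v.
  have b2 := bil_bound (B^T *m S *m B) u v.
  rewrite (le_trans (ler_normB _ _))// !normrM (ger0_norm x0).
  have x1' : `|1 - x| <= 1 by rewrite ger0_norm ?subr_ge0// gerBl.
  apply: (@le_trans _ _ (x * (K * (cnorm u * cnorm v)))).
    rewrite /K mulrDl mulrDr lerD//; first by rewrite ler_wpM2l.
    rewrite -mulrA -[leRHS]mul1r ler_pM ?mulr_ge0//.
    by rewrite ler_wpM2l.
  by rewrite mulrC [leRHS]mulrA ler_wpM2r// /K' -mulrA ler_wpM2l.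
have bb : b + b < 1 by have := b_lt; lra.
have go := cvg_o_scale2 false (gsum_o b0 b0 bb).
rewrite -[X in _ --> X]subr0.
have lim0 : ((N%:R * bil S s t - q N) / N%:R) @[N --> \oo] --> (0 : R).
  apply: norm_cvg0; apply: (@squeeze_cvgr _ _ _ _ (fun=> 0)
    (fun N => K' * (gsum b b (fun m => m.+1%:R^-1) N / scale2 R false N))); last 2 first.
  - exact: cvg_cst.
  - by rewrite -(mulr0 K'); apply: cvgMl_tmp.
  near=> N; rewrite normr_ge0/= normrM mulrA normfV (@ger0_norm _ N%:R)//.
  by rewrite ler_wpM2r ?invr_ge0.
apply: cvg_trans (cvgB (cvg_cst (bil S s t)) lim0).
apply: near_eq_cvg; near=> N.
have N0 : N%:R != 0 :> R.
  by rewrite pnatr_eq0 -lt0n; near: N; exact: nbhs_infty_ge.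
rewrite /= -[LHS]/(bil S s t - (N%:R * bil S s t - q N) / N%:R).
by rewrite mulrBl [N%:R * _]mulrC mulfK// opprB addrC subrK.
Unshelve. all: by end_near. Qed.

(** The stationary covariance equation has a solution: by [lyapunov_limit]
    its homogeneous version has only the trivial one. *)
Lemma lyapunov_exists (G : 'M[R]_k) : exists S, S - (B^T *m S + S *m B) = G.
Proof.
pose f (S : 'M[R]_k) := S - (B^T *m S + S *m B).
have flin : linear f.
  move=> a S1 S2; rewrite /f !mulmxDr !mulmxDl -!scalemxAr -!scalemxAl.
  rewrite scalerBr scalerDr.
  move: (a *: S1) (a *: (B^T *m S1)) (a *: (S1 *m B)) (B^T *m S2) (S2 *m B).
  by move=> X1 X2 X3 X4 X5; apply/matrixP => i j; rewrite !mxE; ring.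
pose F : {linear 'M[R]_k -> 'M[R]_k} := HB.pack f (GRing.isLinear.Build _ _ _ _ f flin).
have finj S : f S = 0 -> S = 0.
  move=> fS; apply/matrixP => i j; rewrite mxE -bil_delta.
  have := @lyapunov_limit S 0 (delta_mx i 0) (delta_mx j 0) fS.
  rewrite (_ : (fun N => _) = fun=> 0); last first.
    apply/funext => N; rewrite big1 ?mul0r// => m _.
    by rewrite /bil mulmx0 mul0mx mxE.
  by move=> h; exact: (cvg_unique _ h (cvg_cst _)).
pose L := lin_mx F.
have Lfree : row_free L.
  rewrite -kermx_eq0; apply/eqP/row_matrixP => i; rewrite row0.
  have h : row i (kermx L) *m L = 0 by rewrite -row_mul mulmx_ker row0.
  rewrite -[row i _]vec_mxK in h *; rewrite mul_vec_lin in h.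
  have /finj -> : f (vec_mx (row i (kermx L))) = 0.
    by apply: (can_inj mxvecK); rewrite linear0 -h.
  by rewrite linear0.
have Lunit : L \in unitmx by rewrite -row_free_unit.
exists (vec_mx (mxvec G *m invmx L)).
rewrite -[LHS]/(F _).
by apply: (can_inj mxvecK); rewrite -mul_vec_lin -/L vec_mxK mulmxKV.
Qed.
End Lyapunov.

(** In the critical case the cross terms and the noncritical terms are of order
    [N], which the normalisation by [N ln N] kills. *)
Lemma variance_limit : exists S, forall s t,
  (cumulated_var N s t / scale2 R crit N) @[N --> \oo] --> bil S s t.
Proof.
have [ncrit|crit_] := boolP (~~ crit).
  have cf : crit = false by apply/negbTE.
  have [S SG] := lyapunov_exists cf Gam.
  by exists S => s t; rewrite cf; exact: lyapunov_limit.
have ct := negbNE crit_.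
exists (P^T *m Gam *m P) => s t; rewrite ct.
pose Q : 'M[R]_k := 1%:M - P.
pose rho m N : R := gprod (1 / 2) m N.
have half0 : (0 : R) <= 1 / 2 by rewrite divr_ge0.
have rho0 m N : 0 <= rho m N by exact: gprod_ge0.
pose w m N u : 'cV[R]_k := flow B m N *m (Q *m u).
pose rest N := \sum_(m < N) (rho m.+1 N * (bil Gam (P *m s) (w m.+1 N t) +
  bil Gam (w m.+1 N s) (P *m t)) + bil Gam (w m.+1 N s) (w m.+1 N t)).
have decomp N : cumulated_var N s t =
    bil (P^T *m Gam *m P) s t * gsum (1 / 2) (1 / 2) (fun=> 1) N + rest N.
  rewrite /cumulated_var /gsum mulr_sumr -big_split/=; apply: eq_bigr => -[m mN] _ /=.
  rewrite (flow_decomp s mN) (flow_decomp t mN) -/Q -/(w _ _ _) -/(w _ _ _).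
  rewrite !(bilDl, bilDr, bilZl, bilZr) -/(rho m.+1 N).
  rewrite -bil_mulr -bil_mull; ring.
have wb m N u : (m <= N)%N -> cnorm (w m N u) <= C * gprod b m N * cnorm u.
  by move=> mN; exact: (split_bound split u mN).
pose E := entry_sum Gam.
have E0 : 0 <= E by exact: entry_sum_ge0.
pose c1 := E * C * (cnorm (P *m s) * cnorm t + cnorm s * cnorm (P *m t)).
pose c2 := E * C ^+ 2 * (cnorm s * cnorm t).
have c10 : 0 <= c1 by rewrite !mulr_ge0 ?addr_ge0 ?mulr_ge0 ?cnorm_ge0.
have c20 : 0 <= c2 by rewrite !mulr_ge0 ?cnorm_ge0 ?exprn_ge0.
have restb N : `|rest N| <= c1 * gsum (1 / 2) b (fun=> 1) N + c2 * gsum b b (fun=> 1) N.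
  rewrite /rest (le_trans (ler_norm_sum _ _ _))// /gsum !mulr_sumr -big_split/=.
  apply: ler_sum => -[m mN] _ /=; rewrite !mulr1.
  have g0 : 0 <= gprod b m.+1 N by exact: gprod_ge0.
  have ws := wb m.+1 N s mN; have wt := wb m.+1 N t mN.
  rewrite (le_trans (ler_normD _ _))// lerD//.
    rewrite normrM (ger0_norm (rho0 _ _)) -/(rho m.+1 N) mulrCA ler_wpM2l//.
    have -> : c1 * gprod b m.+1 N =
        E * (cnorm (P *m s) * (C * gprod b m.+1 N * cnorm t)) +
        E * ((C * gprod b m.+1 N * cnorm s) * cnorm (P *m t)).
      by rewrite /c1; ring.
    rewrite (le_trans (ler_normD _ _))// lerD// (le_trans (bil_bound _ _ _))//.
      by rewrite ler_wpM2l// ler_wpM2l ?cnorm_ge0.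
    by rewrite ler_wpM2l// ler_wpM2r ?cnorm_ge0.
  rewrite (le_trans (bil_bound _ _ _))// /c2 -!mulrA ler_wpM2l//.
  rewrite (le_trans (ler_pM (cnorm_ge0 _) (cnorm_ge0 _) ws wt))//.
  by rewrite le_eqVlt; apply/orP; left; apply/eqP; ring.
have hb1 : 1 / 2 + b < 1 by have := b_lt; lra.
have hb2 : b + b < 1 by have := b_lt; lra.
have [K1 K1P] := gsum_bounded half0 b0 hb1.
have [K2 K2P] := gsum_bounded b0 b0 hb2.
have rest0 : (rest N / scale2 R true N) @[N --> \oo] --> (0 : R).
  apply: (@cvg_O_scale2_crit _ _ (c1 * K1 + c2 * K2)) => N.
  move: (c1) (c2) c10 c20 (restb N) => d1 d2 d10 d20 rb.
  by rewrite (le_trans rb)// mulrDl -!mulrA lerD// ler_wpM2l.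
have lim1 : (bil (P^T *m Gam *m P) s t * (gsum (1 / 2) (1 / 2) (fun=> 1) N / scale2 R true N))
    @[N --> \oo] --> bil (P^T *m Gam *m P) s t * 1.
  by apply: cvgMl_tmp; exact: cvg_gsum_half.
have lim := cvgD lim1 rest0.
rewrite mulr1 addr0 in lim.
have -> : (fun N => cumulated_var N s t / scale2 R true N) = (fun N =>
    bil (P^T *m Gam *m P) s t * (gsum (1 / 2) (1 / 2) (fun=> 1) N / scale2 R true N) +
    rest N / scale2 R true N).
  by apply/funext => N; rewrite decomp mulrDl mulrA.
exact: lim.
Qed.
End StableSplit.

(** * The eigenvalue -1 of a stochastic matrix *)

Section StochasticNorm.
Context (R : realType) (k : nat) (A : 'M[R]_k).
Hypothesis hA : stochastic_mx A.
Implicit Types t : 'cV[R]_k.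

Lemma cnorm_stochastic t : cnorm (A *m t) <= cnorm t.
Proof.
apply: cnorm_le => [|i]; first exact: cnorm_ge0.
rewrite mxE (le_trans (ler_norm_sum _ _ _))//.
rewrite -[leRHS]mul1r -[X in _ <= X * _](stochastic_row_sum hA i) mulr_suml.
apply: ler_sum => j _; rewrite normrM (ger0_norm (stochastic_ge0 hA i j)).
by rewrite ler_wpM2l ?le_cnorm// stochastic_ge0.
Qed.

Lemma cnorm_stochastic_pow n t : cnorm (A ^+ n *m t) <= cnorm t.
Proof.
elim: n => [|n IH]; first by rewrite expr0 mul1mx.
by rewrite exprS -mulmxE -mulmxA (le_trans (cnorm_stochastic _)).
Qed.

Lemma row_mul_bound (x : 'rV[R]_k) t : `|(x *m t) 0 0| <= (\sum_i `|x 0 i|) * cnorm t.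
Proof.
rewrite mxE (le_trans (ler_norm_sum _ _ _))// mulr_suml.
by apply: ler_sum => i _; rewrite normrM ler_wpM2l ?le_cnorm.
Qed.

Local Notation D := (1%:M + A).

(** Powers of [A] are bounded, so -1 has no generalized eigenvector of order 2. *)
Lemma eigenN1_semisimple (x : 'rV[R]_k) : x *m (D *m D) = 0 -> x *m D = 0.
Proof.
move=> xDD; set y := x *m D.
have yA : y *m A = - y.
  apply/eqP; rewrite -addr_eq0 addrC -[X in X + _]mulmx1 -mulmxDr /y -mulmxA.
  by rewrite xDD.
have xA : x *m A = y - x by rewrite /y mulmxDr mulmx1 addrC addKr.
clearbody y.
have pw n : x *m A ^+ n = (-1) ^+ n *: (x - n%:R *: y).
  elim: n => [|n IH]; first by rewrite expr0 mulmx1 scale0r subr0 expr0 scale1r.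
  rewrite exprSr -mulmxE mulmxA IH -scalemxAl mulmxBl xA -scalemxAl yA.
  rewrite exprSr -scalerA; congr (_ *: _); rewrite -natr1.
  by apply/rowP => j; rewrite !mxE; ring.
apply/rowP => j; rewrite [RHS]mxE; apply/eqP; rewrite -normr_eq0.
apply/negPn/negP => yj0.
have yj : 0 < `|y 0 j| by rewrite lt_neqAle eq_sym yj0 /=.
pose X := `|x 0 j| + (\sum_i `|x 0 i|).
have bound n : n%:R * `|y 0 j| <= X.
  have h : `|(x *m A ^+ n) 0 j| <= \sum_i `|x 0 i|.
    have -> : (x *m A ^+ n) 0 j = (x *m (A ^+ n *m (delta_mx j 0 : 'cV[R]_k))) 0 0.
      by rewrite mulmxA -colE [RHS]mxE.
    rewrite (le_trans (row_mul_bound _ _))// ler_piMr ?sumr_ge0//.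
    rewrite (le_trans (cnorm_stochastic_pow _ _))//; apply: cnorm_le => // i.
    by rewrite mxE; case: (_ && _); rewrite ?normr1 ?normr0.
  move: h; rewrite pw !mxE normrM normrX normrN1 expr1n mul1r => h.
  have -> : n%:R * `|y 0 j| = `|n%:R * y 0 j| by rewrite normrM normr_nat.
  have -> : n%:R * y 0 j = x 0 j - (x 0 j - n%:R * y 0 j) by ring.
  by rewrite (le_trans (ler_normB _ _))// lerD2l.
have := bound (Num.trunc (X / `|y 0 j|)).+1.
by apply/negP; rewrite -ltNge -ltr_pdivrMr// truncnS_gt.
Qed.

(** Hence [1 + A] has a group inverse, i.e. the space splits into the kernel and
    the image of [1 + A]. *)
Lemma eigenN1_split : exists P Y : 'M[R]_k,
  [/\ P + D *m Y = 1%:M, D *m P = 0 & P *m D = 0].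
Proof.
have kerD : (kermx (D *m D) <= kermx D)%MS.
  apply/row_subP => i; apply/sub_kermxP; apply: eigenN1_semisimple.
  by rewrite -row_mul mulmx_ker row0.
have rk : \rank (D *m D) = \rank D.
  apply/eqP; rewrite eqn_leq mxrankS ?submxMl//=.
  have := mxrankS kerD; rewrite !mxrank_ker leq_sub2lE ?rank_leq_row//.
have [Y1 Y1E] : exists Y, D = Y *m (D *m D).
  apply/submxP; rewrite -(mxrank_leqif_sup (submxMl D D)); exact/eqP.
have [Y2 Y2E] : exists Y, D^T = Y *m (D^T *m D^T).
  apply/submxP; rewrite -(mxrank_leqif_sup (submxMl D^T D^T)).
  by rewrite -trmx_mul !mxrank_tr rk.
have Y2T : D = D *m D *m Y2^T by rewrite -[LHS]trmxK Y2E !trmx_mul !trmxK.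
have E : Y1 *m D = D *m Y2^T.
  by rewrite {1}Y2T !mulmxA -(mulmxA Y1) -Y1E.
exists (1%:M - D *m Y2^T), Y2^T; split.
- by rewrite subrK.
- by rewrite mulmxBr mulmx1 mulmxA -Y2T subrr.
- by rewrite mulmxBl mul1mx -E -mulmxA -Y1E subrr.
Qed.

Section Contraction.
Variables (P Y : 'M[R]_k).
Hypotheses (PY : P + D *m Y = 1%:M) (PD : P *m D = 0).
Local Notation H := (2^-1 *: (1%:M - A)).
Local Notation K := (- A).

Lemma cnormN t : cnorm (- t) = cnorm t.
Proof. by rewrite /cnorm; apply: eq_bigr => i _; rewrite mxE normrN. Qed.

Lemma cnorm_pow_neg n t : cnorm (K ^+ n *m t) <= cnorm t.
Proof.
elim: n => [|n IH]; first by rewrite expr0 mul1mx.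
by rewrite exprS -mulmxE -mulmxA mulNmx cnormN (le_trans (cnorm_stochastic _)).
Qed.

Lemma cnorm_half t : cnorm (H *m t) <= cnorm t.
Proof.
rewrite -scalemxAl mulmxBl mul1mx (le_trans (cnormZ _ _))// ger0_norm ?invr_ge0//.
have := cnormD t (- (A *m t)); rewrite cnormN; have := cnorm_stochastic t; lra.
Qed.

Lemma cnorm_half_pow n t : cnorm (H ^+ n *m t) <= cnorm t.
Proof.
elim: n => [|n IH]; first by rewrite expr0 mul1mx.
by rewrite exprS -mulmxE -mulmxA (le_trans (cnorm_half _)).
Qed.

(** If [P *m t = 0] then [t] is in the image of [1 + A], where the partial sums of
    the powers of [- A] telescope. *)
Lemma cesaro_bound n t : P *m t = 0 ->
  cnorm ((\sum_(i < n) K ^+ i) *m t) <= 2 * entry_sum Y * cnorm t.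
Proof.
move=> Pt; have tE : t = D *m (Y *m t).
  have : (P + D *m Y) *m t = t by rewrite PY mul1mx.
  by rewrite (mulmxDl P) Pt add0r -mulmxA => ->.
have -> : (\sum_(i < n) K ^+ i) *m t = (\sum_(i < n) K ^+ i) *m D *m (Y *m t).
  by rewrite -mulmxA -tE.
have -> : (\sum_(i < n) K ^+ i) *m D = 1%:M - K ^+ n.
  elim: n => [|n IH]; first by rewrite big_ord0 mul0mx expr0 subrr.
  rewrite big_ord_recr/= mulmxDl IH mulmxDr mulmx1 exprSr -mulmxE mulmxN.
  by rewrite opprK addrA subrK.
rewrite mulmxBl mul1mx (le_trans (cnormD _ _))// cnormN.
have h := cnorm_pow_neg n (Y *m t); have h2 := cnorm_mul Y t.
lra.
Qed.

(** The binomial weights of [H ^+ n], a polynomial in [- A], dominate a small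
    multiple of uniform weights, and uniform averages are small off the kernel. *)
Lemma half_pow_contraction : exists2 n, (2 <= n)%N & exists2 q : R, 0 <= q < 1 &
  forall t, P *m t = 0 -> cnorm (H ^+ n *m t) <= q * cnorm t.
Proof.
pose y := 2 * entry_sum Y.
have y0 : 0 <= y by rewrite mulr_ge0 ?entry_sum_ge0.
pose n := (Num.trunc y).+2.
have ny : y < n.+1%:R.
  by rewrite (lt_le_trans (truncnS_gt _))// ler_nat /n ltnS !leqW.
have n2 : (0 : R) < 2 ^+ n by rewrite exprn_gt0.
exists n => //; exists (1 - (n.+1%:R - y) / 2 ^+ n).
  have nle : n.+1%:R <= 2 ^+ n :> R by rewrite -natrX ler_nat ltn_expl.
  rewrite subr_ge0 ler_pdivrMr// mul1r (le_trans _ nle) ?gerBl//=.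
  by rewrite gtrBl divr_gt0// subr_gt0.
move=> t Pt.
have HE : H ^+ n = 2 ^- n *: (\sum_(i < n.+1) K ^+ i +
    \sum_(i < n.+1) ('C(n, i)%:R - 1) *: K ^+ i).
  have scale_pow (a : R) (M : 'M[R]_k) m : (a *: M) ^+ m = a ^+ m *: M ^+ m.
    elim: m => [|m IH]; first by rewrite !expr0 scale1r.
    by rewrite !exprS IH -!mulmxE -scalemxAl -scalemxAr scalerA.
  rewrite scale_pow exprVn; congr (_ *: _).
  rewrite -[1%:M]/(1 : 'M[R]_k) (addrC 1) exprD1n -big_split/=; apply: eq_bigr => i _.
  by rewrite scalerBl scale1r addrC subrK scaler_nat.
rewrite HE -scalemxAl mulmxDl (le_trans (cnormZ _ _))//.
rewrite ger0_norm ?invr_ge0 ?(ltW n2)// mulrC ler_pdivrMr//.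
rewrite (le_trans (cnormD _ _))//.
have h1 := cesaro_bound n.+1 Pt.
have h2 : cnorm ((\sum_(i < n.+1) ('C(n, i)%:R - 1) *: K ^+ i) *m t) <=
    (2 ^+ n - n.+1%:R) * cnorm t.
  have -> : (2 ^+ n - n.+1%:R : R) = \sum_(i < n.+1) ('C(n, i)%:R - 1).
    rewrite sumrB sumr_const card_ord; congr (_ - _).
    by rewrite -natrX -[in LHS](addn1 1) expnDn natr_sum; apply: eq_bigr => i _;
      rewrite !exp1n !muln1.
  rewrite mulmx_suml mulr_suml.
  elim/big_ind2: _ => [|u1 v1 u2 v2 h1' h2'|i _].
  - by apply: cnorm_le => // i; rewrite mxE normr0.
  - by rewrite (le_trans (cnormD _ _))// lerD.
  rewrite -scalemxAl (le_trans (cnormZ _ _))// ger0_norm.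
    by rewrite ler_wpM2l ?cnorm_pow_neg// subr_ge0 ler1n bin_gt0 -ltnS.
  by rewrite subr_ge0 ler1n bin_gt0 -ltnS.
have -> : (1 - (n.+1%:R - y) / 2 ^+ n) * cnorm t * 2 ^+ n =
   (2 ^+ n - n.+1%:R + y) * cnorm t by field; rewrite gt_eqF.
by rewrite mulrDl addrC lerD.
Qed.
End Contraction.
End StochasticNorm.

(** * Decay off the critical eigenspace *)

Section AdaptedNorm.
Context (R : realType) (k : nat) (A P Y : 'M[R]_k).
Hypothesis hA : stochastic_mx A.
Local Notation D := (1%:M + A).
Hypotheses (PY : P + D *m Y = 1%:M) (PD : P *m D = 0).
Local Notation H := (2^-1 *: (1%:M - A)).
Local Notation B := (- 2^-1 *: A).
Implicit Types t : 'cV[R]_k.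

Lemma bernoulli_ineq (u : R) n : 0 <= u <= 1 -> 1 - n%:R * u <= (1 - u) ^+ n.
Proof.
move=> /andP[u0 u1]; elim: n => [|n IH]; first by rewrite mul0r subr0 expr0.
rewrite exprS -natr1; have u1' : 0 <= 1 - u by rewrite subr_ge0.
apply: (le_trans _ (ler_wpM2l u1' IH)).
have : 0 <= n%:R * u ^+ 2 by rewrite mulr_ge0// sqr_ge0.
by move: (n%:R : R) => x hx; lra.
Qed.

Let PA_ : P *m A = - P.
Proof.
apply/eqP; rewrite -addr_eq0 addrC -[X in X + _]mulmx1 -mulmxDr.
exact/eqP/PD.
Qed.

Let PH t : P *m t = 0 -> P *m (H *m t) = 0.
Proof.
move=> Pt; rewrite -scalemxAl -scalemxAr mulmxBl mul1mx mulmxBr Pt mulmxA PA_.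
by rewrite mulNmx Pt oppr0 subr0 scaler0.
Qed.

(** On the complement of the kernel, a power of [H = (1 - A) / 2] is a strict
    contraction; [nu] is the usual adapted norm for which [H] itself contracts,
    by a factor [r < 1].  Since [B = H - 1/2], the growth rate there is [r - 1/2]. *)
Lemma subcritical_split : exists b C : R, [/\ 0 <= b < 1 / 2, 0 <= C &
  forall m N t, (m <= N)%N ->
    cnorm (flow B m N *m ((1%:M - P) *m t)) <= C * gprod b m N * cnorm t].
Proof.
have [[//|n] n2 [q /andP[q0 q1] contr]] := half_pow_contraction hA PY.
have n0 : (0 : R) < n.+1%:R by rewrite ltr0n.
have n2R : (2 : R) <= n.+1%:R by rewrite ler_nat.
(* a lower bound for the root of q of order n + 1, by Bernoulli's inequality *)
pose r := 1 - (1 - q) / n.+1%:R.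
have u1 : (1 - q) / n.+1%:R <= 1 / 2.
  by rewrite ler_pdivrMr//; move: n2R; move: (n.+1%:R : R) => x hx; lra.
have u0 : 0 < (1 - q) / n.+1%:R by rewrite divr_gt0// subr_gt0.
have r12 : 1 / 2 <= r by rewrite /r; move: u1; move: ((1 - q) / _) => x hx; lra.
have r0 : 0 < r by lra.
have r1 : r < 1 by rewrite /r; move: u0; move: ((1 - q) / _) => x hx; lra.
have rq : q <= r ^+ n.+1.
  have := @bernoulli_ineq ((1 - q) / n.+1%:R) n.+1; rewrite -/r.
  rewrite [_ * ((1 - q) / _)]mulrCA divff ?gt_eqF// mulr1.
  have -> : 1 - (1 - q) = q by lra.
  apply; rewrite (ltW u0)/=; move: u1; move: ((1 - q) / _) => x hx; lra.
pose nu t := \sum_(j < n.+1) r ^- j * cnorm (H ^+ j *m t).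
have rj j : 0 < r ^- j by rewrite invr_gt0 exprn_gt0.
have nuD s t : nu (s + t) <= nu s + nu t.
  rewrite /nu -big_split/=; apply: ler_sum => j _.
  by rewrite -mulrDr ler_wpM2l ?(ltW (rj j))// mulmxDr cnormD.
have nuZ a t : 0 <= a -> nu (a *: t) <= a * nu t.
  move=> a0; rewrite /nu mulr_sumr; apply: ler_sum => j _.
  rewrite mulrCA ler_wpM2l ?(ltW (rj j))// -scalemxAr.
  by rewrite (le_trans (cnormZ _ _))// ger0_norm.
have nuH t : P *m t = 0 -> nu (H *m t) <= r * nu t.
  move=> Pt.
  rewrite /nu big_ord_recr [in X in _ <= X]big_ord_recl/= !expr0 invr1 !mul1r mul1mx mulrDr.
  rewrite addrC lerD//.
    rewrite mulmxA mulmxE -exprSr.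
    have h := contr t Pt.
    rewrite mulrC ler_pdivrMr ?exprn_gt0// (le_trans h)//.
    rewrite mulrAC -exprS mulrC [leRHS]mulrC ler_wpM2l// cnorm_ge0//.
  rewrite mulr_sumr; apply: ler_sum => j _.
  rewrite mulmxA mulmxE -exprSr mulrA ler_wpM2r ?cnorm_ge0//.
  by rewrite /bump/= exprS invfM mulrA divff ?mul1r// gt_eqF.
have step m t : P *m t = 0 -> P *m (growth B m.+1 *m t) = 0 /\
    nu (growth B m.+1 *m t) <= (1 + (r - 1 / 2) / m.+1%:R) * nu t.
  move=> Pt.
  pose x : R := m.+1%:R^-1.
  have x0 : 0 <= x by rewrite invr_ge0.
  have x1 : x <= 1 by rewrite invf_le1 ?ler1n// ltr0n.
  have gE : growth B m.+1 *m t = (1 - x / 2) *: t + x *: (H *m t).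
    rewrite /growth -/x mulmxDl mul1mx -scalemxAl mulmxBl mul1mx -!scalemxAl.
    by apply/colP => i; move: (A *m t) => At; rewrite !mxE; field.
  rewrite gE; split.
    by rewrite mulmxDr -!scalemxAr Pt PH// !scaler0 addr0.
  rewrite (le_trans (nuD _ _))// -/x.
  have a0 : 0 <= 1 - x / 2 by lra.
  have h1 := nuZ _ t a0; have h2 := nuZ _ (H *m t) x0.
  have h3 := ler_wpM2l x0 (nuH t Pt).
  rewrite (_ : (1 + (r - 1 / 2) * x) * nu t = (1 - x / 2) * nu t + x * (r * nu t)); last by field.
  lra.
have b0 : 0 <= r - 1 / 2 by lra.
pose Cnu := \sum_(j < n.+1) r ^- j.
have Cnu0 : 0 <= Cnu by apply: sumr_ge0 => j _; exact: ltW.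
exists (r - 1 / 2), (Cnu * entry_sum (1%:M - P)); split.
- by apply/andP; split; lra.
- by rewrite mulr_ge0 ?entry_sum_ge0.
move=> m N t mN.
have PQ : P *m ((1%:M - P) *m t) = 0.
  rewrite mulmxA mulmxBr mulmx1.
  suff -> : P *m P = P by rewrite subrr mul0mx.
  by rewrite -[RHS]mulmx1 -PY mulmxDr mulmxA PD mul0mx addr0.
have [_ h] := flow_ind b0 step mN PQ.
have nuge s : cnorm s <= nu s.
  rewrite /nu.
  rewrite big_ord_recl/= expr0 invr1 mul1r mul1mx lerDl.
  by apply: sumr_ge0 => j _; rewrite mulr_ge0 ?cnorm_ge0// ltW.
have nule s : nu s <= Cnu * cnorm s.
  rewrite /nu /Cnu mulr_suml; apply: ler_sum => j _.
  by rewrite ler_wpM2l ?(ltW (rj j))// cnorm_half_pow.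
rewrite (le_trans (nuge _))// (le_trans h)//.
rewrite [leRHS](_ : _ = gprod (r - 1 / 2) m N * (Cnu * (entry_sum (1%:M - P) * cnorm t))); last by ring.
rewrite ler_wpM2l ?gprod_ge0// (le_trans (nule _))// ler_wpM2l//.
exact: cnorm_mul.
Qed.
End AdaptedNorm.

(** * Splitting of the deviations of the urn *)

Lemma flow_contraction (R : realType) (k : nat) (B : 'M[R]_k) b m N t :
  0 <= b -> (m <= N)%N ->
  (forall l s, cnorm (growth B l.+1 *m s) <= (1 + b / l.+1%:R) * cnorm s) ->
  cnorm (flow B m N *m t) <= gprod b m N * cnorm t.
Proof.
move=> b0 mN Bb.
by have [] := @flow_ind R k B (fun=> True) _ b b0 (fun l s _ => conj I (Bb l s)) m N t mN I.
Qed.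

Section SplitExistence.
Context (R : realType) (k : nat) (theta : R) (A : 'M[R]_k).
Hypotheses (hk : (2 <= k)%N) (htheta : 1 <= theta).
Hypotheses (hA : stochastic_mx A).
Local Notation c := (k%:R * theta - 1).

(** Raising the rate to at least 1/4 makes it positive, as the estimate of the
    drift by [gprod_harmonic_sum] requires. *)
Lemma stable_split_intro crit (B P : 'M[R]_k) C b :
  B *m P = (1 / 2) *: P -> (~~ crit -> P = 0) -> 0 <= b < 1 / 2 -> 0 <= C ->
  (forall m N t, (m <= N)%N ->
    cnorm (flow B m N *m ((1%:M - P) *m t)) <= C * gprod b m N * cnorm t) ->
  stable_split crit B P C (Num.max b (1 / 4)).
Proof.
move=> BP P0 /andP[b0 b2] C0 bnd; split=> //.
  by rewrite lt_max gt_max b2 orbC /=; apply/andP; split; lra.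
move=> m N t mN; rewrite (le_trans (bnd m N t mN))// ler_wpM2r ?cnorm_ge0//.
by rewrite ler_wpM2l// gprod_mono// b0 le_max lexx.
Qed.

(** A stochastic matrix has norm at most 1, so the rate is at most
    [1 / (k theta - 1)].  This is below 1/2 unless [k = 3] and [theta = 1]. *)
Lemma split_three_colours : (3 <= k)%N -> exists (B P : 'M[R]_k) (C b : R),
  (forall x : 'rV[R]_k, x *m B = - c^-1 *: (x *m A)) /\
  stable_split [&& k == 3%N, theta == 1 & eigenvalue A (-1)] B P C b.
Proof.
move=> k3; have c0 := scale_gt0 hk htheta.
have k3R : (3 : R) <= k%:R by rewrite ler_nat.
have c2 : 2 <= c.
  have : (3 : R) * 1 <= k%:R * theta by apply: ler_pM.
  by lra.
have [ceq|cne] := eqVneq c 2; last first.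
  have ncrit : [&& k == 3%N, theta == 1 & eigenvalue A (-1)] = false.
    apply/negbTE/negP => /and3P[/eqP ke /eqP te _]; move/eqP: cne; apply.
    by rewrite ke te; lra.
  exists (- c^-1 *: A), 0, 1, (Num.max c^-1 (1 / 4)); split.
    by move=> x; rewrite -scalemxAr.
  apply: stable_split_intro; rewrite ?mulmx0 ?scaler0//.
    rewrite invr_ge0 (ltW c0)/= mul1r ltf_pV2 ?posrE//.
    by rewrite lt_neqAle eq_sym cne.
  move=> m N t mN; rewrite subr0 !mul1mx mul1r.
  apply: flow_contraction => //; first by rewrite invr_ge0 ltW.
  move=> l s; rewrite /growth mulmxDl mul1mx (le_trans (cnormD _ _))//.
  rewrite mulrDl mul1r lerD2l -!scalemxAl scalerA (le_trans (cnormZ _ _))//.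
  have cl : 0 <= l.+1%:R^-1 * c^-1 by rewrite mulr_ge0 ?invr_ge0 ?(ltW c0).
  by rewrite mulrN normrN ger0_norm// [c^-1 / _]mulrC ler_wpM2l// cnorm_stochastic.
have [ke te] : k = 3%N /\ theta = 1.
  have te : theta = 1.
    apply/eqP; rewrite eq_le htheta andbT leNgt; apply/negP => t1.
    have : (3 : R) * theta <= k%:R * theta by rewrite ler_wpM2r//; lra.
    by lra.
  split=> //; apply/eqP; rewrite eqn_leq k3 andbT -(ler_nat R).
  by move: ceq; rewrite te mulr1; lra.
have [P [Y [PY DP PD]]] := eigenN1_split hA.
have [b [C [b12 C0 bnd]]] := subcritical_split hA PY PD.
exists (- 2^-1 *: A), P, C, (Num.max b (1 / 4)); split.
  by move=> x; rewrite -scalemxAr ceq.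
apply: stable_split_intro => //.
  have AP : A *m P = - P.
    by apply/eqP; rewrite -addr_eq0 addrC -[X in X + _]mul1mx -mulmxDl DP.
  by rewrite -scalemxAl AP scalerN scaleNr opprK mul1r.
move=> ncrit; have ev : ~~ eigenvalue A (-1).
  by apply: contra ncrit => ->; rewrite andbT; apply/andP; split; apply/eqP.
have DU : 1%:M + A \in unitmx.
  rewrite -row_free_unit -kermx_eq0; apply: contraR ev.
  rewrite /eigenvalue /eigenspace (_ : A - (-1)%:M = 1%:M + A)//.
  by rewrite raddfN opprK addrC.
by rewrite -[P](mulKmx DU) DP mulmx0.
Qed.

End SplitExistence.

(** With two colours the deviations live on a line, on which [A] acts by its
    second eigenvalue, its trace minus one. *)
Lemma split_two_colours (R : realType) (theta : R) (A : 'M[R]_2) (lambda : R) :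
  1 <= theta -> stochastic_mx A ->
  char_poly A = ('X - 1%:P) * ('X - lambda%:P) -> (1 - 2 * theta) / 2 <= lambda ->
  exists (B P : 'M[R]_2) (C b : R),
  (forall x : 'rV[R]_2, \sum_j x 0 j = 0 ->
    x *m B = - (2 * theta - 1)^-1 *: (x *m A)) /\
  stable_split (lambda == (1 - 2 * theta) / 2) B P C b.
Proof.
move=> t1 hA cp lam; pose c := 2 * theta - 1.
have sum2 (f : 'I_2 -> R) : \sum_j f j = f 0 + f 1.
  by rewrite !big_ord_recl big_ord0 addr0; congr (_ + f _); apply/val_inj.
have c1 : 1 <= c by rewrite /c; lra.
have c0 : 0 < c by lra.
have trA : \tr A = 1 + lambda.
  have := @char_poly_trace R 2 A isT; rewrite cp.
  have -> : ('X - 1%:P) * ('X - lambda%:P) =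
      'X^2 - (1 + lambda) *: 'X + lambda%:P :> {poly R}.
    by rewrite -mul_polyC polyCD; ring.
  rewrite !coefE /=; lra.
have lamE : lambda = A 0 0 + A 1 1 - 1.
  by move: trA; rewrite /mxtrace sum2; lra.
have row i : A i 0 + A i 1 = 1 by rewrite -sum2 stochastic_row_sum.
have Age i j := stochastic_ge0 hA i j.
have r0 := row 0; have r1 := row 1.
have lam1 : lambda <= 1 by have := Age 0 1; have := Age 1 0; lra.
pose beta := - lambda / c.
pose B : 'M[R]_2 := beta%:M.
have hB (x : 'rV[R]_2) : \sum_j x 0 j = 0 -> x *m B = - c^-1 *: (x *m A).
  rewrite sum2 => xs; have x1 : x 0 1 = - x 0 0 by move: xs; lra.
  have xA : x *m A = lambda *: x.
    apply/rowP => j; rewrite !mxE sum2.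
    have [->|->] : j = 0 \/ j = 1.
      by case: j => -[|[|//]] p; [left|right]; apply/val_inj.
    - by rewrite x1 (_ : A 1 0 = 1 - A 1 1) ?lamE; [ring | lra].
    - by rewrite x1 (_ : A 0 1 = 1 - A 0 0) ?lamE; [ring | lra].
  by rewrite xA scalerA /B mul_mx_scalar /beta mulNr mulrC mulNr.
have betac : beta <= 1 / 2 by rewrite /beta ler_pdivrMr// /c; lra.
have [le|ne] := eqVneq lambda ((1 - 2 * theta) / 2).
  exists B, 1%:M, 0, (Num.max 0 (1 / 4)); split=> //.
  apply: stable_split_intro => //; rewrite ?mulmx1 ?subrr ?lexx//=.
  - by rewrite /B scalemx1; congr _%:M; rewrite /beta le /c; field; rewrite gt_eqF.
  - move=> m N t mN; rewrite mul0mx mulmx0 !mul0r.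
    by apply: cnorm_le => // i; rewrite mxE normr0.
exists B, 0, 1, (Num.max (Num.max 0 beta) (1 / 4)); split=> //.
have bm0 : 0 <= Num.max 0 beta by rewrite le_max lexx.
apply: stable_split_intro; rewrite ?mulmx0 ?scaler0//.
  rewrite bm0 gt_max/= divr_gt0//= /beta ltr_pdivrMr// /c.
  have : (1 - 2 * theta) / 2 < lambda by rewrite lt_neqAle eq_sym ne.
  lra.
move=> m N t mN; rewrite subr0 !mul1mx mul1r.
apply: flow_contraction => // l s.
have -> : growth B l.+1 *m s = (1 + l.+1%:R^-1 * beta) *: s.
  by rewrite /growth /B scale_scalar_mx mulmxDl mul1mx mul_scalar_mx scalerDl scale1r.
rewrite (le_trans (cnormZ _ _))// ler_wpM2r ?cnorm_ge0//.
have l0 : 0 <= l.+1%:R^-1 :> R by rewrite invr_ge0.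
have l1 : l.+1%:R^-1 <= 1 :> R by rewrite invf_le1 ?ler1n ?ltr0n.
have betaN1 : - 1 <= beta by rewrite /beta ler_pdivlMr//; lra.
have bb : beta <= Num.max 0 beta by rewrite le_max lexx orbT.
rewrite ger0_norm; first by rewrite lerD2l mulrC ler_wpM2r.
by move: l0 l1; move: (l.+1%:R^-1 : R) => y y0 y1; nra.
Qed.

(** * A Toeplitz lemma *)

Section Toeplitz.
Variable R : realType.

Lemma cvg0_of_sqr (x : nat -> R) : (x N ^+ 2) @[N --> \oo] --> (0 : R) ->
  x N @[N --> \oo] --> (0 : R).
Proof.
move=> h'; have /cvgrPdist_le h := h'; apply/cvgrPdist_le => e e0.
have e2 : 0 < e ^+ 2 by rewrite exprn_gt0.
apply: filterS (h _ e2) => N; rewrite !sub0r !normrN normrX.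
by rewrite ler_pXn2r ?nnegrE ?(ltW e0).
Qed.

(** Early terms are killed by the decay of the weights, late ones by that of
    [w]. *)
Lemma toeplitz_cvg0 (a : nat -> nat -> R) (top w : nat -> R) K :
  (forall N l, 0 <= a N l) -> (forall N l, (l < N)%N -> a N l <= top N) ->
  top N @[N --> \oo] --> (0 : R) ->
  (\forall N \near \oo, \sum_(l < N) a N l <= K) ->
  (forall l, 0 <= w l) -> w N @[N --> \oo] --> (0 : R) ->
  (\sum_(l < N) a N l * w l) @[N --> \oo] --> (0 : R).
Proof.
move=> a0 atop top0 aK w0 wcv; apply/cvgrPdist_le => e e0.
have K1 : 0 < 2 * (`|K| + 1) by rewrite mulr_gt0// ltr_wpDl.
have /cvgrPdist_le /(_ _ (divr_gt0 e0 K1)) [n0 _ n0P] := wcv.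
pose S := \sum_(l < n0) w l.
have S0 : 0 <= S by exact: sumr_ge0.
have /cvgrPdist_le h := top0.
have S1 : 0 < 2 * (S + 1) by rewrite mulr_gt0// ltr_wpDl.
near=> N.
have topN : `|0 - top N| <= e / (2 * (S + 1)) by near: N; apply: h; exact: divr_gt0.
have sumN : \sum_(l < N) a N l <= K by near: N.
have nN : (n0 <= N)%N by near: N; exact: nbhs_infty_ge.
have nN' : (0 < N)%N by near: N; exact: nbhs_infty_ge.
have top_ge0 : 0 <= top N by rewrite (le_trans (a0 N 0%N))// atop.
rewrite sub0r normrN ger0_norm; last first.
  by apply: sumr_ge0 => l _; rewrite mulr_ge0.
rewrite sub0r normrN ger0_norm// in topN.
apply: (@le_trans _ _ (top N * S + \sum_(l < N) a N l * (e / (2 * (`|K| + 1))))).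
  rewrite /S (big_ord_widen _ _ nN) mulr_sumr [X in X + _]big_mkcond -big_split/=.
  apply: ler_sum => l _; case: ifPn => ln.
    rewrite -[leLHS]addr0 lerD ?ler_wpM2r ?atop//.
    by rewrite mulr_ge0// ltW// divr_gt0.
  rewrite add0r ler_wpM2l//; rewrite -leqNgt in ln.
  by have := n0P l ln; rewrite /= sub0r normrN ger0_norm.
rewrite -mulr_suml [leRHS](splitr e) lerD//.
  rewrite (le_trans (ler_wpM2r S0 topN))// -mulrA ler_wpM2l ?(ltW e0)//.
  by rewrite mulrC ler_pdivrMr// mulrDr mulrC mulr1; move: (S) S0 => x hx; lra.
apply: (@le_trans _ _ (`|K| * (e / (2 * (`|K| + 1))))).
  by rewrite ler_wpM2r ?(ltW (divr_gt0 _ _))// (le_trans sumN)// ler_norm.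
rewrite mulrCA ler_wpM2l ?(ltW e0)// ler_pdivrMr//.
by have := normr_ge0 K; move: (`|K|) => x hx; lra.
Unshelve. all: by end_near. Qed.
End Toeplitz.

(** * Limit of the counts *)

Section UrnMoments.
Context (R : realType) (k : nat) (theta : R) (A B P : 'M[R]_k) (C b : R)
  (mu u0 : 'rV[R]_k) (crit : bool).
Hypotheses (hk : (2 <= k)%N) (htheta : 1 <= theta).
Hypotheses (hA : stochastic_mx A) (hu0 : probability_row u0).
Hypothesis hmu : (theta *: const_mx 1 - mu) *m A = (k%:R * theta - 1) *: mu.
Hypothesis hB : forall x : 'rV[R]_k, \sum_j x 0 j = 0 ->
  x *m B = - (k%:R * theta - 1)^-1 *: (x *m A).
Hypothesis split : stable_split crit B P C b.

Local Notation c := (k%:R * theta - 1).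
Local Notation p := (limit_draw theta mu).
Local Notation W := (centred theta mu).
Local Notation cmean := (count_mean theta A u0).
Local Notation s2 := (scale2 R crit).
Local Notation rho := (rate crit b).
Let sig (N : nat) : R := clt_scale R crit N.

Let sig_sqr N : (2 <= N)%N -> sig N ^+ 2 = s2 N.
Proof. exact: sqr_clt_scale. Qed.

Let sig_ge0 N : 0 <= sig N.
Proof. by rewrite /sig scale2E sqrtr_ge0. Qed.

Let sig_gt0 N : (2 <= N)%N -> 0 < sig N.
Proof. by move=> N2; rewrite /sig scale2E sqrtr_gt0 scale2_gt0. Qed.

Let near2 : \forall N \near \oo, (2 <= N)%N.
Proof. exact: nbhs_infty_ge. Qed.

Let Cf := sval (cid2 (flow_bound split)).
Let Cf0 : 0 <= Cf.
Proof. exact: (s2valP (cid2 (flow_bound split))). Qed.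
Let CfP m N t : (m <= N)%N -> cnorm (flow B m N *m t) <= Cf * gprod rho m N * cnorm t.
Proof. exact: (s2valP' (cid2 (flow_bound split))). Qed.

Lemma draw_error_ge0 n : 0 <= draw_error theta A mu u0 n.
Proof.
rewrite -[leLHS](count_mean_cst hk htheta hA hu0 n); apply: count_mean_le => // x _.
by apply: sumr_ge0.
Qed.

(** The covariance of one draw with probabilities [p]. *)
Definition draw_cov : 'M[R]_k := diag_mx p - p^T *m p.

Lemma bil_draw_cov (s : 'cV[R]_k) : bil draw_cov s s = fvar (p 0) (fun j => s j 0).
Proof.
rewrite bilBm /fvar; congr (_ - _).
  rewrite /bil mxE; apply: eq_bigr => j _; rewrite mul_mx_diag !mxE; ring.
rewrite /bil mulmxA -mulmxA -trmx_mul mxE big_ord_recl big_ord0 addr0 expr2 mxE.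
by rewrite /fmean mxE.
Qed.

Section Direction.
Variable t : 'rV[R]_k.

(** The direction [t] transported back from time [N] to time [m]. *)
Definition column (N m : nat) : 'cV[R]_k := (sig N)^-1 *: (flow B m N *m t^T).

Let Kt := Cf * cnorm t^T.
Let Kt0 : 0 <= Kt. Proof. by rewrite mulr_ge0 ?cnorm_ge0. Qed.
(* bound on the increment of step m; top bounds all of them *)
Let M (N m : nat) : R := (sig N)^-1 * (Kt * gprod rho m N).
Let M0 N m : 0 <= M N m.
Proof.
rewrite /M mulr_ge0 ?invr_ge0 ?sig_ge0//.
by apply: mulr_ge0; [exact: Kt0 | apply: gprod_ge0; exact: rate_ge0 split].
Qed.

Let columnM N m i : `|column N m i 0| <= M N m.
Proof.
rewrite (le_trans (le_cnorm _ _))// (le_trans (cnormZ _ _))//.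
rewrite ger0_norm ?invr_ge0// /M ler_wpM2l ?invr_ge0// /Kt mulrAC.
have [mN|/ltnW Nm] := leqP m N; first exact: CfP.
have := @CfP N N t^T (leqnn N); rewrite /gprod !big_geq// /flow.
by have /eqP -> : (N - m == 0)%N by []; rewrite subnn.
Qed.

Let columnE N m : (m < N)%N -> column N m = growth B m.+1 *m column N m.+1.
Proof. by move=> mN; rewrite /column flow_step// -scalemxAr mulmxA. Qed.

Let top N : R := M N 0.
Let top_ge0 N : 0 <= top N. Proof. exact: M0. Qed.

Let M_top N m : (m <= N)%N -> M N m <= top N.
Proof.
move=> mN; apply: ler_wpM2l; first by rewrite invr_ge0.
by apply: ler_wpM2l => //; apply: gprod_le0 => //; exact: rate_ge0 split.
Qed.

Let top_cvg : top N @[N --> \oo] --> (0 : R).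
Proof.
apply: cvg0_of_sqr; rewrite -(mulr0 (Kt ^+ 2)).
apply: cvg_trans (cvgMl_tmp (rate_sqr_o split)).
apply: near_eq_cvg; apply: filterS near2 => N N2.
rewrite /top /M -(sig_sqr N2) !exprMn exprVn.
by rewrite mulrC; ring.
Qed.

Let sqr_bounded : exists2 K, 0 <= K & \forall N \near \oo, \sum_(l < N) M N l.+1 ^+ 2 <= K.
Proof.
have [K hK] := rate_gsum_bounded split.
exists (Kt ^+ 2 * `|K|); first by rewrite mulr_ge0 ?sqr_ge0.
near=> N; have N2 : (2 <= N)%N by near: N.
have -> : \sum_(l < N) M N l.+1 ^+ 2 = Kt ^+ 2 * (gsum rho rho (fun=> 1) N / s2 N).
  rewrite /gsum mulr_suml mulr_sumr; apply: eq_bigr => l _.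
  by rewrite /M -(sig_sqr N2) !exprMn exprVn; ring.
rewrite ler_wpM2l ?sqr_ge0// (le_trans _ (ler_norm _))//.
by near: N.
Unshelve. all: by end_near. Qed.

Let rdrift N := remaining_drift theta mu u0 N (column N) 0.

Let rdrift_cvg : rdrift N @[N --> \oo] --> (0 : R).
Proof.
pose D := \sum_i `|drift theta mu u0 0 i|.
have r0 : 0 < rho := rate_gt0 split.
apply: norm_cvg0; apply: (@squeeze_cvgr _ _ _ _ (fun=> 0) (fun N => D / rho * top N)); last 2 first.
- exact: cvg_cst.
- by rewrite -(mulr0 (D / rho)); apply: cvgMl_tmp.
near=> N; rewrite normr_ge0/= /rdrift /remaining_drift big_mkord.
have D0 : 0 <= D by exact: sumr_ge0.
have step (l : 'I_N) : `|l.+1%:R^-1 * (drift theta mu u0 *m column N l.+1) 0 0| <=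
    D * ((sig N)^-1 * Kt * (gprod rho l.+1 N / l.+1%:R)).
  rewrite normrM ger0_norm ?invr_ge0//.
  have -> : D * ((sig N)^-1 * Kt * (gprod rho l.+1 N / l.+1%:R)) =
    l.+1%:R^-1 * (D * M N l.+1) by rewrite /M; ring.
  rewrite ler_wpM2l ?invr_ge0// mxE (le_trans (ler_norm_sum _ _ _))// /D mulr_suml.
  by apply: ler_sum => i _; rewrite normrM ler_wpM2l.
rewrite (le_trans (ler_norm_sum _ _ _))// (le_trans (ler_sum _ (fun l _ => step l)))//.
rewrite -!mulr_sumr -mulrA ler_wpM2l//.
have -> : rho^-1 * top N = (sig N)^-1 * Kt * (gprod rho 0 N / rho) by rewrite /top /M; ring.
by apply: ler_wpM2l; [rewrite mulr_ge0 ?invr_ge0|exact: gprod_harmonic_sum].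
Unshelve. all: by end_near. Qed.

Let Y N (x : 'rV[R]_k) : R := rdot t ((sig N)^-1 *: W N x).

Let compensated_end N x : compensated theta mu u0 N (column N) N x = Y N x.
Proof.
rewrite /compensated /remaining_drift big_geq// addr0 /column flow_nil mul1mx.
by rewrite /Y /rdot -scalemxAr -scalemxAl.
Qed.

(** At the horizon the drift is exhausted, and the compensated martingale is the
    normalised deviation itself. *)
Lemma second_moment_bounded : exists2 K, 0 <= K &
  \forall N \near \oo, cmean N (fun x => Y N x ^+ 2) <= K.
Proof.
have [K K0 hK] := sqr_bounded; exists (1 + K); first by rewrite addr_ge0.
near=> N.
have h := compensated_sqr hk htheta hA hu0 hmu hB (@columnE N) (columnM N) (leqnn N).
have -> : (fun x => Y N x ^+ 2) = (fun x => compensated theta mu u0 N (column N) N x ^+ 2).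
  by apply/funext => x; rewrite compensated_end.
rewrite (le_trans h)// lerD//; last by near: N.
have r1 : `|rdrift N| <= 1.
  near: N; have /cvgrPdist_le /(_ 1 ltr01) := rdrift_cvg.
  by apply: filterS => N; rewrite sub0r normrN.
by rewrite -[leLHS]real_normK ?num_real// exprn_ile1.
Unshelve. all: by end_near. Qed.


Hypothesis limit_ge0 : forall j, 0 <= p 0 j.
Hypothesis draw_error_cvg : draw_error theta A mu u0 N @[N --> \oo] --> (0 : R).

Let error N : R := \sum_(l < N) (3 / 2 * M N l.+1 ^+ 2 * draw_error theta A mu u0 l +
  16 * M N l.+1 ^+ 3 + M N l.+1 ^+ 4).

Let error_cvg : error N @[N --> \oo] --> (0 : R).
Proof.
have [K K0 hK] := sqr_bounded.
have lim1 : (\sum_(l < N) M N l.+1 ^+ 2 * draw_error theta A mu u0 l) @[N --> \oo] --> (0 : R).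
  apply: (@toeplitz_cvg0 R (fun N l => M N l.+1 ^+ 2) (fun N => top N ^+ 2)
    (draw_error theta A mu u0) K) => //.
  - by move=> N l; rewrite sqr_ge0.
  - by move=> N l lN; apply: lerXn2r; rewrite ?nnegrE ?M0//; exact: M_top.
  - by rewrite -[X in _ --> X](mulr0 0); exact: (cvgM top_cvg top_cvg).
  - by move=> l; exact: draw_error_ge0.
pose bnd N := 3 / 2 * (\sum_(l < N) M N l.+1 ^+ 2 * draw_error theta A mu u0 l) +
  (16 * top N + top N * top N) * K.
apply: norm_cvg0; apply: (@squeeze_cvgr _ _ _ _ (fun=> 0) bnd); last 2 first.
- exact: cvg_cst.
- have -> : (0 : R) = 3 / 2 * 0 + (16 * 0 + 0 * 0) * K by rewrite !mulr0 addr0 mul0r addr0.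
  apply: cvgD; first exact: cvgMl_tmp.
  apply: cvgMr_tmp; apply: cvgD; first exact: cvgMl_tmp.
  exact: (cvgM top_cvg top_cvg).
near=> N; rewrite normr_ge0/= ger0_norm; last first.
  apply: sumr_ge0 => l _; have e0 := draw_error_ge0 l; have m0 := M0 N l.+1.
  move: (M N l.+1) m0 => z z0.
  by rewrite !addr_ge0 ?mulr_ge0 ?exprn_ge0.
rewrite /error /bnd.
under eq_bigr do rewrite -addrA -mulrA.
rewrite big_split/= -mulr_sumr lerD2l.
have sumK : \sum_(l < N) M N l.+1 ^+ 2 <= K by near: N.
apply: (@le_trans _ _ ((16 * top N + top N * top N) * \sum_(l < N) M N l.+1 ^+ 2)).
  rewrite mulr_sumr; apply: ler_sum => l _.
  have Mt := M_top (ltn_ord l); have m0 := M0 N l.+1.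
  have : M N l.+1 * M N l.+1 <= top N * top N by exact: ler_pM.
  have := sqr_ge0 (M N l.+1).
  rewrite (_ : 16 * M N l.+1 ^+ 3 + _ = (16 * M N l.+1 + M N l.+1 * M N l.+1) * M N l.+1 ^+ 2); last by ring.
  by move=> h1 h2; rewrite ler_wpM2r// lerD// ler_wpM2l.
apply: ler_wpM2l; last exact: sumK.
by move: (top N) (top_ge0 N) => z z0; rewrite addr_ge0 ?mulr_ge0.
Unshelve. all: by end_near. Qed.

(** The replacement error of [compensated_cos] vanishes: cubes and fourth powers
    because the largest increment does, squares because they are weighted by the
    draw errors. *)
Lemma count_cos_cvg (S : 'M[R]_k) a :
  (forall s t, (cumulated_var B draw_cov N s t / s2 N) @[N --> \oo] --> bil S s t) ->
  cmean N (fun x => cos (Y N x + a)) @[N --> \oo] --> expR (- (bil S t^T t^T / 2)) * cos a.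
Proof.
move=> hS.
pose V N := remaining_var theta mu N (column N) 0.
have Vcvg : V N @[N --> \oo] --> bil S t^T t^T.
  apply: cvg_trans (hS t^T t^T); apply: near_eq_cvg; apply: filterS near2 => N N2.
  rewrite /V /remaining_var big_mkord /cumulated_var mulr_suml; apply: eq_bigr => l _.
  rewrite /step_var -bil_draw_cov /column bilZl bilZr -(sig_sqr N2) -exprVn; ring.
have main : (cos (rdrift N + a) * expR (- (V N / 2))) @[N --> \oo] -->
    cos (0 + a) * expR (- (bil S t^T t^T / 2)).
  have c1 : (rdrift N + a) @[N --> \oo] --> 0 + a by apply: cvgD => //; exact: cvg_cst.
  have c2 : (- (V N / 2)) @[N --> \oo] --> - (bil S t^T t^T / 2).
    by apply: cvgN; apply: cvgMr_tmp.
  apply: cvgM.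
    exact: (@cvg_comp _ _ _ _ cos _ _ _ c1 (@continuous_cos R _)).
  exact: (@cvg_comp _ _ _ _ expR _ _ _ c2 (@continuous_expR R _)).
rewrite add0r in main; rewrite mulrC -[X in _ --> X]addr0.
have diff : (cmean N (fun x => cos (Y N x + a)) - cos (rdrift N + a) * expR (- (V N / 2)))
    @[N --> \oo] --> (0 : R).
  apply: norm_cvg0; apply: (@squeeze_cvgr _ _ _ _ (fun=> 0) error); last 2 first.
  - exact: cvg_cst.
  - exact: error_cvg.
  apply: nearW => N; rewrite normr_ge0/=.
  have := @compensated_cos R k theta A B mu u0 hk htheta hA hu0 hmu hB N (column N) (M N) a (@columnE N) (columnM N) (M0 N) limit_ge0 N (leqnn N).
  rewrite {1}/remaining_var big_geq// mul0r oppr0 expR0 mulr1.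
  have -> : (fun x => cos (compensated theta mu u0 N (column N) N x + a)) =
    (fun x => cos (Y N x + a)) by apply/funext => x; rewrite compensated_end.
  exact.
apply: cvg_trans (cvgD main diff); apply: near_eq_cvg; apply: nearW => N /=.
by rewrite -[LHS]/(_ + _) addrC subrK.
Qed.

End Direction.

Let sig_ratio_cvg : (sig N / N.+1%:R) @[N --> \oo] --> (0 : R).
Proof.
apply: cvg0_of_sqr; apply: cvg_trans (cvg_scale2_sqr crit).
apply: near_eq_cvg; apply: filterS near2 => N N2.
by rewrite -(sig_sqr N2) exprMn exprVn.
Qed.

(** By [draw_centred] the error is [W_n / n], of order [clt_scale n / n] in mean. *)
Lemma draw_deviation_cvg j :
  cmean n (fun x => `|draw_prob theta A u0 n x j - p 0 j|) @[n --> \oo] --> (0 : R).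
Proof.
pose t : 'rV[R]_k := (col j A)^T.
have [K K0 hK] := second_moment_bounded t.
have c0 := scale_gt0 hk htheta.
pose D := `|drift theta mu u0 0 j|.
pose bnd n := D * n.+1%:R^-1 + c^-1 * (1 + K) * (sig n / n.+1%:R).
apply: (@squeeze_cvgr _ _ _ _ (fun=> 0) bnd); last 2 first.
- exact: cvg_cst.
- have -> : (0 : R) = D * 0 + c^-1 * (1 + K) * 0 by rewrite !mulr0 addr0.
  apply: cvgD; last exact: cvgMl_tmp.
  by apply: cvgMl_tmp; exact: (@cvg_harmonic R).
near=> n; have n2 : (2 <= n)%N by near: n.
have secn : cmean n (fun x => rdot t ((sig n)^-1 *: W n x) ^+ 2) <= K by near: n.
have s0 := sig_gt0 n2.
have n0 : (0 : R) < n.+1%:R by rewrite ltr0n.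
apply/andP; split.
  by rewrite -[leLHS](count_mean_cst hk htheta hA hu0 n); apply: count_mean_le.
have cn0 : 0 <= c^-1 * (sig n / n.+1%:R) by rewrite mulr_ge0 ?invr_ge0 ?divr_ge0 ?(ltW c0) ?(ltW n0).
apply: (@le_trans _ _ (cmean n (fun x => (D * n.+1%:R^-1 + c^-1 * (sig n / n.+1%:R)) +
    c^-1 * (sig n / n.+1%:R) * rdot t ((sig n)^-1 *: W n x) ^+ 2))); last first.
  rewrite count_meanD count_meanZ count_mean_cst// /bnd.
  by rewrite -addrA lerD2l [leRHS]mulrAC mulrDr mulr1 lerD2l ler_wpM2l.
apply: count_mean_le => // x rx.
have -> : draw_prob theta A u0 n x j - p 0 j =
    n.+1%:R^-1 * drift theta mu u0 0 j - (c * n.+1%:R)^-1 * (W n x *m A) 0 j.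
  have /rowP /(_ j) := draw_centred u0 hk htheta hmu n x.
  by rewrite !mxE => ->; ring.
have -> : (W n x *m A) 0 j = sig n * rdot t ((sig n)^-1 *: W n x).
  rewrite /rdot trmxK -scalemxAl [X in _ = _ * X]mxE mulrA divff ?gt_eqF// mul1r.
  by move: (W n x) => z; rewrite !mxE; apply: eq_bigr => i _; rewrite mxE.
move: (rdot _ _) => y.
rewrite (le_trans (ler_normB _ _))// -addrA lerD//.
  by rewrite normrM ger0_norm ?invr_ge0// mulrC.
rewrite -[X in _ <= X + _]mulr1 -mulrDr.
have -> : (c * n.+1%:R)^-1 * (sig n * y) = c^-1 * (sig n / n.+1%:R) * y.
  by rewrite invfM; ring.
rewrite normrM ger0_norm// ler_wpM2l//.
rewrite -(real_normK (num_real y)); have := sqr_ge0 (`|y| - 1); nra.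
Unshelve. all: by end_near. Qed.

Lemma draw_error_cvg : draw_error theta A mu u0 N @[N --> \oo] --> (0 : R).
Proof.
have h : (\sum_j cmean N (fun x => `|draw_prob theta A u0 N x j - p 0 j|))
    @[N --> \oo] --> \sum_(j < k) (0 : R).
  by apply: cvg_sumr => j; exact: draw_deviation_cvg.
rewrite big1_eq in h; apply: cvg_trans h; apply: near_eq_cvg; apply: nearW => N.
by rewrite /draw_error count_mean_sum.
Qed.

(** As a limit of means of draw probabilities. *)
Lemma limit_draw_ge0 j : 0 <= p 0 j.
Proof.
have lim : cmean n (fun x => draw_prob theta A u0 n x j) @[n --> \oo] --> p 0 j.
  have h : (cmean n (fun x => draw_prob theta A u0 n x j) - p 0 j) @[n --> \oo] --> (0 : R).
    apply: norm_cvg0; apply: (@squeeze_cvgr _ _ _ _ (fun=> 0) _ _ _ _ _ (draw_deviation_cvg j)); last first.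
      exact: cvg_cst.
    apply: nearW => n; rewrite normr_ge0/=.
    rewrite -[X in _ - X](count_mean_cst hk htheta hA hu0 n).
    exact: count_mean_dist.
  rewrite -[p 0 j]add0r; apply: cvg_trans (cvgD h (cvg_cst (p 0 j))).
  apply: near_eq_cvg; apply: nearW => n; rewrite -[LHS]/(_ + _); exact: subrK.
apply: (cvg_ge0 lim); apply: nearW => n.
rewrite -[leLHS](count_mean_cst hk htheta hA hu0 n); apply: count_mean_le => // x rx.
exact: draw_prob_ge0.
Qed.

End UrnMoments.

Section CountLimit.
Context (R : realType) (k : nat) (theta : R) (A B P : 'M[R]_k) (C b : R)
  (mu : 'rV[R]_k) (crit : bool).
Hypotheses (hk : (2 <= k)%N) (htheta : 1 <= theta).
Hypotheses (hA : stochastic_mx A).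
Hypothesis hmu : (theta *: const_mx 1 - mu) *m A = (k%:R * theta - 1) *: mu.
Hypothesis hB : forall x : 'rV[R]_k, \sum_j x 0 j = 0 ->
  x *m B = - (k%:R * theta - 1)^-1 *: (x *m A).
Hypothesis split : stable_split crit B P C b.

(** The covariance comes from [variance_limit] and is the same for all initial
    configurations; its positivity is read off the urn started from a row of [A]. *)
Lemma count_limit : exists2 S, covariance_mx S &
  forall u0, probability_row u0 -> forall t a,
    count_mean theta A u0 N (fun x =>
      cos (rdot t ((clt_scale R crit N)^-1 *: centred theta mu N x) + a)) @[N --> \oo] -->
    expR (- ((t *m S *m t^T) 0 0 / 2)) * cos a.
Proof.
have [S hS] := variance_limit split (draw_cov theta mu).
have i0 : 'I_k by exact: (Ordinal (ltnW hk)).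
have p0 := limit_draw_ge0 hk htheta hA (hA i0) hmu hB split.
have p1 := limit_draw_sum hk htheta hA hmu.
exists S.
  apply: (bil_cvg hS) => [N s t|N t].
    congr (_ / _); apply: eq_bigr => m _; rewrite bil_sym; congr bil.
    by rewrite /draw_cov linearB/= tr_diag_mx trmx_mul trmxK.
  have sg : 0 <= scale2 R crit N.
    rewrite /scale2; case: (crit) => //; case: N => [|N]; first by rewrite mul0r.
    by rewrite mulr_ge0// ln_ge0// ler1n.
  rewrite divr_ge0//; apply: sumr_ge0 => m _.
  by rewrite bil_draw_cov; exact: fvar_ge0.
move=> u0 hu0 t a.
have -> : (t *m S *m t^T) 0 0 = bil S t^T t^T by rewrite /bil trmxK.
apply: (@count_cos_cvg R k theta A B P C b mu u0 crit) => //.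
exact: (draw_error_cvg hk htheta hA hu0 hmu hB split).
Qed.
End CountLimit.

(** * Linear images of the counts and the theorem *)

Section LinearImage.
Context (R : realType) (k : nat) (theta : R) (A B Q : 'M[R]_k) (C b : R)
  (mu u0 : 'rV[R]_k) (crit : bool).
Hypotheses (hk : (2 <= k)%N) (htheta : 1 <= theta).
Hypotheses (hA : stochastic_mx A) (hu0 : probability_row u0).
Hypothesis hmu : (theta *: const_mx 1 - mu) *m A = (k%:R * theta - 1) *: mu.
Hypothesis hB : forall x : 'rV[R]_k, \sum_j x 0 j = 0 ->
  x *m B = - (k%:R * theta - 1)^-1 *: (x *m A).
Hypothesis split : stable_split crit B Q C b.

Local Notation W := (centred theta mu).
Local Notation cmean := (count_mean theta A u0).
Let sig (N : nat) : R := clt_scale R crit N.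

Variables (L : 'M[R]_k) (v : 'rV[R]_k).
Let X N (x : 'rV[R]_k) := (sig N)^-1 *: (v + W N x *m L).

Let rdot_X N t x : rdot t (X N x) =
  (sig N)^-1 * rdot t v + rdot (t *m L^T) ((sig N)^-1 *: W N x).
Proof.
rewrite /X /rdot trmx_mul trmxK -!scalemxAl mulmxDl !mulmxA.
by rewrite scalerDr !mxE.
Qed.

Let shift_cvg t : ((sig N)^-1 * rdot t v) @[N --> \oo] --> (0 : R).
Proof.
rewrite -[X in _ --> X](mul0r (rdot t v)); apply: cvgMr_tmp.
apply: cvg0_of_sqr; apply: cvg_trans (@cvg_scale2_inv R crit).
apply: near_eq_cvg; near=> N; rewrite exprVn sqr_clt_scale//.
by near: N; exact: nbhs_infty_ge.
Unshelve. all: by end_near. Qed.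

(** The shift [v], divided by the normalisation, only perturbs the phase by a
    vanishing amount. *)
Lemma linear_image_cos (S : 'M[R]_k) :
  (forall t a, cmean N (fun x => cos (rdot t ((clt_scale R crit N)^-1 *: W N x) + a))
     @[N --> \oo] --> expR (- ((t *m S *m t^T) 0 0 / 2)) * cos a) ->
  forall t a, cmean N (fun x => cos (rdot t (X N x) + a)) @[N --> \oo] -->
    expR (- ((t *m (L^T *m S *m L) *m t^T) 0 0 / 2)) * cos a.
Proof.
move=> lim t a; pose y N := (sig N)^-1 * rdot t v.
have := lim (t *m L^T) a; rewrite trmx_mul trmxK !mulmxA => main.
rewrite -[X in _ --> X]addr0.
have d0 : (`|1 - cos (y N)| + `|sin (y N)|) @[N --> \oo] --> (0 : R).
  have -> : (0 : R) = `|1 - cos 0| + `|sin (0 : R)|.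
    by rewrite cos0 sin0 subrr normr0 addr0.
  have cy := shift_cvg t.
  apply: cvgD; apply: cvg_norm.
    apply: cvgB; first exact: cvg_cst.
    exact: (@cvg_comp _ _ _ _ cos _ _ _ cy (@continuous_cos R _)).
  exact: (@cvg_comp _ _ _ _ sin _ _ _ cy (@continuous_sin R _)).
have diff : (cmean N (fun x => cos (rdot t (X N x) + a)) -
    cmean N (fun x => cos (rdot (t *m L^T) ((sig N)^-1 *: W N x) + a)))
    @[N --> \oo] --> (0 : R).
  apply: norm_cvg0; apply: (@squeeze_cvgr _ _ _ _ (fun=> 0) _ _ _ _ _ d0); last first.
    exact: cvg_cst.
  apply: nearW => N; rewrite normr_ge0/=.
  rewrite -[leRHS](count_mean_cst hk htheta hA hu0 N).
  apply: count_mean_dist => // x _; rewrite rdot_X -/(y N).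
  move: (rdot (t *m L^T) _) => z; rewrite -addrA; move: (z + a) => u; rewrite cosD.
  have -> : cos (y N) * cos u - sin (y N) * sin u - cos u =
    - ((1 - cos (y N)) * cos u) - sin (y N) * sin u by ring.
  rewrite (le_trans (ler_normB _ _))// normrN !normrM lerD//.
    by rewrite ler_piMr// ler_norml cos_geN1 cos_le1.
  by rewrite ler_piMr// ler_norml sin_geN1 sin_le1.
apply: cvg_trans (cvgD main diff); apply: near_eq_cvg; apply: nearW => N.
by rewrite -[LHS]/(_ + _) addrC subrK.
Qed.

(** Markov's inequality in disguise: the cutoff is bounded by second moments. *)
Lemma linear_image_tight e : 0 < e -> \forall m \near \oo, \forall N \near \oo,
  cmean N (fun x => cutoff m.+1%:R (X N x)) <= e.
Proof.
move=> e0.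
pose t i : 'rV[R]_k := delta_mx 0 i *m L^T.
have hK i := second_moment_bounded hk htheta hA hu0 hmu hB split (t i).
pose K i := sval (cid2 (hK i)).
have K0 i : 0 <= K i by exact: (s2valP (cid2 (hK i))).
have KP i : \forall N \near \oo, cmean N (fun x => rdot (t i) ((sig N)^-1 *: W N x) ^+ 2) <= K i.
  exact: (s2valP' (cid2 (hK i))).
pose KK := \sum_i (2 + 2 * K i).
have KK0 : 0 <= KK by apply: sumr_ge0 => i _; rewrite addr_ge0 ?mulr_ge0.
have KK1 : 0 < KK + 1 by rewrite ltr_wpDl.
have [m0 m0P] := inv_le_eventually (divr_gt0 e0 KK1).
near=> m; have mm : (m0 <= m)%N by near: m; exact: nbhs_infty_ge.
have m1 : (0 : R) < m.+1%:R by rewrite ltr0n.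
near=> N.
have KN : forall i, cmean N (fun x => rdot (t i) ((sig N)^-1 *: W N x) ^+ 2) <= K i.
  by near: N; apply: filter_forall.
have vN : forall i, `|(sig N)^-1 * rdot (delta_mx 0 i) v| <= 1.
  near: N; apply: filter_forall => i.
  have /cvgrPdist_le /(_ 1 ltr01) := shift_cvg (delta_mx 0 i).
  by apply: filterS => N; rewrite sub0r normrN.
apply: (@le_trans _ _ (m.+1%:R^-1 * KK)); last first.
  have h := m0P m mm; rewrite (le_trans (ler_wpM2r KK0 h))// -mulrA ler_piMr ?(ltW e0)//.
  by rewrite mulrC ler_pdivrMr// mul1r lerDl.
have inv2 : (m.+1%:R^-1) ^+ 2 <= m.+1%:R^-1 :> R.
  by rewrite expr2 ler_piMr ?invr_ge0// invf_le1 ?ler1n.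
apply: (@le_trans _ _ (cmean N (fun x => m.+1%:R^-1 *
   (\sum_i (2 + 2 * rdot (t i) ((sig N)^-1 *: W N x) ^+ 2))))); last first.
  rewrite count_meanZ ler_wpM2l ?invr_ge0// count_mean_sum; apply: ler_sum => i _.
  by rewrite count_meanD count_meanZ count_mean_cst// lerD2l ler_wpM2l.
apply: count_mean_le => // x _; rewrite /cutoff mulr_sumr; apply: ler_sum => i _.
apply: (@le_trans _ _ ((X N x 0 i / m.+1%:R) ^+ 2)); first by rewrite ge_min lexx orbT.
have -> : X N x 0 i = rdot (delta_mx 0 i) (X N x) by rewrite rdot_delta.
rewrite rdot_X -/(t i); have := vN i; move: ((sig N)^-1 * _) (rdot (t i) _) => y z y1.
rewrite exprMn mulrC ler_pM ?sqr_ge0//.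
have y2 : y ^+ 2 <= 1 by rewrite -(real_normK (num_real y)) exprn_ile1.
by have := sqr_ge0 (y - z); lra.
Unshelve. all: by end_near. Qed.

Lemma linear_image_clt (S : 'M[R]_k) d (T : measurableType d) (P : probability T R)
    (U : nat -> T -> 'rV[R]_k) (Z : nat -> T -> 'I_k) :
  negative_urn theta A u0 P U Z -> covariance_mx (L^T *m S *m L) ->
  (forall t a, cmean N (fun x => cos (rdot t ((clt_scale R crit N)^-1 *: W N x) + a))
     @[N --> \oo] --> expR (- ((t *m S *m t^T) 0 0 / 2)) * cos a) ->
  cvg_to_normal P (fun N w => X N (colour_count R Z N w)) (L^T *m S *m L).
Proof.
move=> urn cS lim.
have [d' [T' [P' [G [gG GE]]]]] := gaussian_vector_exists cS.
exists d', T', P', G; split=> //.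
apply: cvg_in_distribution_of_cos.
- by move=> n i; have [] := bounded_mfun_count urn n (fun x => X n x 0 i).
- by have [] := gG.
- move=> t a; rewrite GE; have h := @linear_image_cos S lim t a; apply: cvg_trans h.
  apply: near_eq_cvg; apply: nearW => N.
  by rewrite -(mean_count urn).
- move=> e e0; have := linear_image_tight e0.
  apply: filterS => m; apply: filterS => N.
  by rewrite -(mean_count urn).
Qed.
End LinearImage.

Theorem theorem5 (R : realType) (k : nat) (theta : R) (A : 'M[R]_k)
    (mu : 'rV[R]_k) (sigma : nat -> R)
    (hk : (2 <= k)%N)
    (htheta : 1 <= theta)
    (hA : stochastic_mx A)
    (hirr : irreducible_mx (hat_mx theta A))
    (hmu : (theta *: const_mx 1 - mu) *m A = (k%:R * theta - 1) *: mu)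
    (hsigma :
      ((3 <= k)%N /\
        forall n, sigma n =
          clt_scale R [&& k == 3%N, theta == 1 & eigenvalue A (-1)] n)
      \/
      [/\ k = 2%N, 1 <= theta <= 3 / 2 &
        exists lambda : R,
          [/\ char_poly A = ('X - 1%:P) * ('X - lambda%:P),
              (1 - 2 * theta) / 2 <= lambda &
              forall n, sigma n =
                clt_scale R (lambda == (1 - 2 * theta) / 2) n]]) :
  exists St : 'M[R]_k, covariance_mx St /\
  exists S : 'M[R]_k, [/\ covariance_mx S, S = A^T *m St *m A &
    forall (u0 : 'rV[R]_k) (d : measure_display) (T : measurableType d)
      (P : probability T R) (U : nat -> T -> 'rV[R]_k) (Z : nat -> T -> 'I_k),
      probability_row u0 ->
      negative_urn theta A u0 P U Z ->
      cvg_to_normal P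
        (fun n w => (sigma n)^-1 *:
          (colour_count R Z n w
           - (n%:R / (k%:R * theta - 1)) *: (theta *: const_mx 1 - mu))) St
      /\
      cvg_to_normal P
        (fun n w => (sigma n)^-1 *: (U n w - n%:R *: mu)) S].

Proof.
have [B [Q [C [b [crit [hB split hsig]]]]]] : exists (B Q : 'M[R]_k) (C b : R) (crit : bool),
    [/\ forall x : 'rV[R]_k, \sum_j x 0 j = 0 ->
          x *m B = - (k%:R * theta - 1)^-1 *: (x *m A),
        stable_split crit B Q C b & forall n, sigma n = clt_scale R crit n].
  case: hsigma => [[k3 hs]|[k2 _ [lambda [cp lam hs]]]].
    have [B [Q [C [b [hB split]]]]] := split_three_colours hk htheta hA k3.
    by exists B, Q, C, b, [&& k == 3%N, theta == 1 & eigenvalue A (-1)]; split.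
  subst k.
  have [B [Q [C [b [hB split]]]]] := split_two_colours htheta hA cp lam.
  by exists B, Q, C, b, (lambda == (1 - 2 * theta) / 2); split.
have [St cSt lim] := count_limit hk htheta hA hmu hB split.
exists St; split=> //.
have cS : covariance_mx (A^T *m St *m A).
  split=> [|t]; first by rewrite !trmx_mul trmxK cSt.1 mulmxA.
  by have := cSt.2 (t *m A^T); rewrite trmx_mul trmxK !mulmxA.
exists (A^T *m St *m A); split=> // u0 d T P U Z hu0 urn.
(* the counts are the image by the identity without shift, the configurations the
   image by A shifted by u0 *)
have clt := linear_image_clt hk htheta hA hu0 hmu hB split.
split.
- have := clt 1%:M 0 St d T P U Z urn; rewrite trmx1 mul1mx mulmx1 => /(_ cSt (lim u0 hu0)).
  have -> // : (fun N w => (clt_scale R crit N)^-1 *: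
      (0 + centred theta mu N (colour_count R Z N w) *m 1%:M)) =
    (fun N w => (sigma N)^-1 *: (colour_count R Z N w
      - (N%:R / (k%:R * theta - 1)) *: (theta *: const_mx 1 - mu))).
  apply/funext => N; apply/funext => w.
  by rewrite hsig add0r mulmx1 /centred /limit_draw scalerA.
- have := clt A u0 St d T P U Z urn cS (lim u0 hu0).
  have -> // : (fun N w => (clt_scale R crit N)^-1 *:
      (u0 + centred theta mu N (colour_count R Z N w) *m A)) =
    (fun N w => (sigma N)^-1 *: (U N w - N%:R *: mu)).
  apply/funext => N; apply/funext => w.
  rewrite hsig (config_count urn) /centred mulmxBl -scalemxAl addrA.
  by rewrite (limit_draw_mul hk htheta hmu).
Qed.
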